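(* Let $\overline{M}$ be a smooth manifold of dimension $n+1$ with boundary $\partial M$ and interior $M$. Let $\nabla$ be a special affine connection on $M$ which is projectively compact of order two, let $\mathrm{Ric}_{ab}$ be its Ricci curvature, and let $\tau\in\Gamma(\mathcal{E}(2))$ be the corresponding defining density for $\partial M$. Then: (i) $\tau$ is a solution of the first BGG operator on $\mathcal{E}(2)$ if and only if $\nabla_{(a}\mathrm{Ric}_{bc)}=0$. (ii) $\tau$ is a normal solution if and only if $\nabla_a\mathrm{Ric}_{bc}=0$. Assuming further that $\mathrm{Ric}_{ab}$ is non-degenerate, it defines a pseudo-Riemannian Einstein metric on $M$ with Levi-Civita connection $\nabla$. In this case, $L(\tau)$ defines a non-degenerate parallel bundle metric (necessarily of indefinite signature) on the standard tractor bundle $\mathcal{T}$ over $\overline{M}$, hence a reduction of projective holonomy to an orthogonal group, with the closed curved orbit given by the boundary $\partial M$ and the open curved orbit given by the interior $M$. In particular, the boundary $\partial M$ inherits a conformal structure.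
   Context: All affine connections are torsion free; smooth means $C^\infty$. For a one-form $\Upsilon$, write $\hat\nabla=\nabla+\Upsilon$ for $\hat\nabla_\xi\eta=\nabla_\xi\eta+\Upsilon(\xi)\eta+\Upsilon(\eta)\xi$; connections so related are projectively equivalent, and a projective structure is an equivalence class. A local defining function for $\partial M$ (assumed non-empty) is a smooth $\rho:U\to\mathbb{R}_{\ge0}$, $U\subset\overline{M}$ open, with $\rho^{-1}(\{0\})=U\cap\partial M$ and $d\rho\neq0$ along $U\cap\partial M$. $\nabla$ on $M$ is projectively compact of order $\alpha>0$ if near each boundary point there is a defining function $\rho$ such that $\nabla+\frac{d\rho}{\alpha\rho}$ extends smoothly to the boundary. Then the projective class of $\nabla$ extends uniquely to a projective structure on $\overline{M}$. Densities: $\mathrm{vol}(N)$ is the bundle of volume densities and $\mathcal{E}(w)=\mathrm{vol}(N)^{-w/(n+2)}$ for $\dim N=n+1$. A connection is special if it admits a nowhere vanishing parallel section of $\mathrm{vol}$. A defining density is a section of a density bundle over $\overline M$ with zero locus $\partial M$ that in local trivializations is represented (up to sign) by a defining function. If $\nabla$ is special and projectively compact of order $\alpha$, a non-zero $\nabla$-parallel section of $\mathcal{E}(\alpha)$ extends by $0$ to a defining density (unique up to a constant factor): the corresponding defining density. Tractors (indices $a,b,\dots$ abstract, $\mathcal{E}_a=T^*N$, ''$(w)$'' means tensoring with $\mathcal{E}(w)$, $\dim N=n+1\geq2$): the cotractor bundle is $\mathcal{T}^*=J^1(\mathcal{E}(1))$. A connection $\tilde\nabla$ in the class gives $\mathcal{T}^*\cong\mathcal{E}(1)\oplus\mathcal{E}_a(1)$,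 elements written $\binom{\sigma}{\mu_a}$; passing to $\tilde\nabla+\Upsilon$ changes this to $\binom{\sigma}{\mu_a+\Upsilon_a\sigma}$. The tractor connection is $\nabla^{\mathcal{T}^*}_a\binom{\sigma}{\mu_b}=\binom{\tilde\nabla_a\sigma-\mu_a}{\tilde\nabla_a\mu_b+\tilde{\mathsf P}_{ab}\sigma}$; for special $\tilde\nabla$, $\tilde{\mathsf P}_{ab}=\frac1n\widetilde{\mathrm{Ric}}_{ab}$ is symmetric. The standard tractor bundle $\mathcal{T}$ is the dual; it contains the natural line subbundle $\mathcal{E}(-1)$, the annihilator of $\mathcal{E}_a(1)\subset\mathcal{T}^*$, with $\mathcal{T}/\mathcal{E}(-1)\cong TN(-1)$. Correspondingly $S^2\mathcal{T}^*\cong\mathcal{E}(2)\oplus\mathcal{E}_a(2)\oplus\mathcal{E}_{(ab)}(2)$ with elements $(\tau,\nu_a,\rho_{ab})$ and induced connection $$\nabla^{S^2\mathcal{T}^*}_a(\tau,\nu_b,\rho_{bc})=(\tilde\nabla_a\tau-2\nu_a,\ \tilde\nabla_a\nu_b+\tilde{\mathsf P}_{ab}\tau-\rho_{ab},\ \tilde\nabla_a\rho_{bc}+2\tilde{\mathsf P}_{a(b}\nu_{c)}).$$ The component $\tau\in\mathcal{E}(2)$ is the restriction of the bilinear form to the line subbundle $\mathcal{E}(-1)\subset\mathcal{T}$. Splitting operator: $L(\tau)=(\tau,\frac12\tilde\nabla_a\tau,\frac12\tilde\nabla_{(a}\tilde\nabla_{b)}\tau+\tilde{\mathsf P}_{(ab)}\tau)\in\Gamma(S^2\mathcal{T}^*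 )$, independent of $\tilde\nabla$. The first BGG operator on $\mathcal{E}(2)$ sends $\tau$ to the complete symmetrization, in $\Gamma(\mathcal{E}_{(abc)}(2))$, of the bottom (third) slot of $\nabla^{S^2\mathcal{T}^*}L(\tau)$ (computed with a special connection in the class); it is projectively invariant. A solution is normal if $\nabla^{S^2\mathcal{T}^*}L(\tau)=0$ on $\overline M$. Projective holonomy is the holonomy of the tractor connection. Curved orbits of a parallel non-degenerate bundle metric $H$ on $\mathcal{T}$: the closed one is the set of points where the line $\mathcal{E}(-1)\subset\mathcal{T}$ is $H$-isotropic, the open ones the sets where it is positive, respectively negative. The conformal structure on $\partial M$ is the one induced by $H$ on $\mathcal{E}(-1)^\perp/\mathcal{E}(-1)\cong T\partial M(-1)$ over $\partial M$. Einstein means that the Ricci curvature is a constant multiple of the metric. *)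

(* Defs.v *)
From HB Require Import structures.
From mathcomp Require Import all_boot all_order all_algebra.
From mathcomp Require Import all_classical all_reals all_analysis.
Set Implicit Arguments.
Unset Strict Implicit.
Unset Printing Implicit Defensive.
Import Order.TTheory GRing.Theory Num.Theory.
Import numFieldNormedType.Exports.
Local Open Scope classical_set_scope.
Local Open Scope ring_scope.

(* Geometric objects on a manifold with boundary are given classically: by
   components in every chart of an atlas, subject to smoothness and to the
   transformation law on overlaps.  The dimension is n.+1 throughout.  Components in chart i are total functions of
   the coordinates; only their values on the image of the chart matter. *)

Definition halfspace (R : realType) (n : nat) : set 'rV[R]_n.+1 :=
  [set x | 0 <= x 0 0].

Definition basisv (R : realType) (n : nat) (a : 'I_n.+1) : 'rV[R]_n.+1 :=
  delta_mx 0 a.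

(* C^k on an open subset V of R^(n+1). *)
Fixpoint Ck (R : realType) (n k : nat) (V : set 'rV[R]_n.+1)
    (f : 'rV[R]_n.+1 -> R) : Prop :=
  match k with
  | 0 => forall x, V x -> {for x, continuous f}
  | k'.+1 =>
      (forall x, V x -> {for x, continuous f}) /\
      (forall a : 'I_n.+1,
         (forall x, V x -> derivable f x (basisv R a)) /\
         Ck k' V (fun x => 'D_(basisv R a) f x))
  end.

(* Smoothness on an arbitrary subset (in particular up to the boundary):
   local existence of C^infinity extensions to open subsets of R^(n+1). *)
Definition smooth_on (R : realType) (n : nat) (A : set 'rV[R]_n.+1)
    (f : 'rV[R]_n.+1 -> R) : Prop :=
  forall x, A x -> exists (V : set 'rV[R]_n.+1) (g : 'rV[R]_n.+1 -> R),
    [/\ open V, V x, (forall k, Ck k V g)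
      & forall y, V y -> A y -> f y = g y].

(* Partial derivative within the half space: the usual one at interior points,
   one-sided in the direction 0 at boundary points. *)
Definition pder (R : realType) (n : nat) (a : 'I_n.+1)
    (f : 'rV[R]_n.+1 -> R) (x : 'rV[R]_n.+1) : R :=
  lim ((fun h : R => h^-1 * (f (x + h *: basisv R a) - f x)) @
       within [set h : R | halfspace (x + h *: basisv R a)] 0^').

Record bmanifold (R : realType) (n : nat) := BManifold {
  carrier :> topologicalType;
  bm_hausdorff : hausdorff_space carrier;
  bm_second_countable : @second_countable carrier;
  idx : Type;
  dom : idx -> set carrier;
  chart : idx -> carrier -> 'rV[R]_n.+1;
  chartV : idx -> 'rV[R]_n.+1 -> carrier;
  dom_open : forall i, open (dom i);
  dom_cover : forall p, exists i, dom i p;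
  chartK : forall i p, dom i p -> chartV i (chart i p) = p;
  chart_image_open : forall i, exists2 W : set 'rV[R]_n.+1,
    open W & chart i @` dom i = W `&` @halfspace R n;
  chart_continuous : forall i, {within dom i, continuous (chart i)};
  chartV_continuous :
    forall i, {within chart i @` dom i, continuous (chartV i)};
  transition_smooth : forall i j (b : 'I_n.+1),
    smooth_on (chart i @` (dom i `&` dom j))
              (fun x => chart j (chartV i x) 0 b)
}.

Definition boundary (R : realType) (n : nat) (M : bmanifold R n) : set M :=
  [set p | exists2 i, dom i p & chart i p 0 0 = 0].
Arguments boundary {R n} M _.

Definition minterior (R : realType) (n : nat) (M : bmanifold R n) : set M :=
  ~` boundary M.
Arguments minterior {R n} M _.

Definition crd (R : realType) (n : nat) (M : bmanifold R n) (U : set M)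
    (i : idx M) : set 'rV[R]_n.+1 :=
  chart i @` (dom i `&` U).

(* jac i j x a b = d x_j^b / d x_i^a at the point with x_i-coordinates x *)
Definition jac (R : realType) (n : nat) (M : bmanifold R n) (i j : idx M)
    (x : 'rV[R]_n.+1) : 'M[R]_n.+1 :=
  \matrix_(a, b) pder a (fun y => chart j (chartV i y) 0 b) x.

Definition density (R : realType) (n : nat) (M : bmanifold R n) :=
  idx M -> 'rV[R]_n.+1 -> R.
Definition oneform (R : realType) (n : nat) (M : bmanifold R n) :=
  idx M -> 'rV[R]_n.+1 -> 'rV[R]_n.+1.
Definition tensor2 (R : realType) (n : nat) (M : bmanifold R n) :=
  idx M -> 'rV[R]_n.+1 -> 'M[R]_n.+1.
Definition tensor3 (R : realType) (n : nat) (M : bmanifold R n) :=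
  idx M -> 'rV[R]_n.+1 -> 'I_n.+1 -> 'I_n.+1 -> 'I_n.+1 -> R.
(* G i x c a b is the Christoffel symbol Gamma^c_{ab} in chart i *)
Definition conn (R : realType) (n : nat) (M : bmanifold R n) :=
  idx M -> 'rV[R]_n.+1 -> 'I_n.+1 -> 'I_n.+1 -> 'I_n.+1 -> R.

Definition smooth_function (R : realType) (n : nat) (M : bmanifold R n)
    (U : set M) (rho : M -> R) : Prop :=
  forall i, smooth_on (crd U i) (fun x => rho (chartV i x)).

(* Sections over U of E(w) = vol^(-w/(n+2)), trivialized in chart i by the
   corresponding power of |dx_i|; so vol itself is E(-(n+2)). *)
Definition is_density (R : realType) (n : nat) (M : bmanifold R n) (w : R)
    (U : set M) (f : density M) : Prop :=
  (forall i, smooth_on (crd U i) (f i)) /\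
  (forall i j p, dom i p -> dom j p -> U p ->
     f i (chart i p) =
       `|\det (jac i j (chart i p))| `^ (- w / n.+2%:R) * f j (chart j p)).

Definition is_oneform (R : realType) (n : nat) (M : bmanifold R n)
    (U : set M) (om : oneform M) : Prop :=
  (forall i a, smooth_on (crd U i) (fun x => om i x 0 a)) /\
  (forall i j p, dom i p -> dom j p -> U p ->
     om i (chart i p) = om j (chart j p) *m (jac i j (chart i p))^T).

Definition is_tensor2 (R : realType) (n : nat) (M : bmanifold R n)
    (U : set M) (T : tensor2 M) : Prop :=
  (forall i a b, smooth_on (crd U i) (fun x => T i x a b)) /\
  (forall i j p, dom i p -> dom j p -> U p ->
     let J := jac i j (chart i p) in
     T i (chart i p) = J *m T j (chart j p) *m J^T).

(* Torsion free affine connections over U. *)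
Definition is_connection (R : realType) (n : nat) (M : bmanifold R n)
    (U : set M) (G : conn M) : Prop :=
  [/\ forall i c a b, smooth_on (crd U i) (fun x => G i x c a b),
      forall i x c a b, crd U i x -> G i x c a b = G i x c b a
    & forall i j p (c a b : 'I_n.+1), dom i p -> dom j p -> U p ->
        let x := chart i p in
        let J := jac i j x in
        \sum_d \sum_e G j (chart j p) c d e * J a d * J b e =
        \sum_d G i x d a b * J d c - pder a (fun y => jac i j y b c) x].

(* gam_a = Gamma^c_{ac} / (n+2): the connection form of E(1) *)
Definition gam (R : realType) (n : nat) (M : bmanifold R n) (G : conn M) :
    oneform M :=
  fun i x => \row_a ((n.+2%:R)^-1 * \sum_c G i x c a c).

(* Covariant derivatives of sections of E(w), E_b(w), E_bc(w); the index of
   the derivative comes first. *)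
Definition nab0 (R : realType) (n : nat) (M : bmanifold R n) (w : R)
    (G : conn M) (f : density M) : oneform M :=
  fun i x => \row_a (pder a (f i) x + w * gam G i x 0 a * f i x).

Definition nab1 (R : realType) (n : nat) (M : bmanifold R n) (w : R)
    (G : conn M) (om : oneform M) : tensor2 M :=
  fun i x => \matrix_(a, b)
    (pder a (fun y => om i y 0 b) x - \sum_c G i x c a b * om i x 0 c
     + w * gam G i x 0 a * om i x 0 b).

Definition nab2 (R : realType) (n : nat) (M : bmanifold R n) (w : R)
    (G : conn M) (T : tensor2 M) : tensor3 M :=
  fun i x a b c =>
    pder a (fun y => T i y b c) x
    - \sum_d G i x d a b * T i x d c - \sum_d G i x d a c * T i x b d
    + w * gam G i x 0 a * T i x b c.

Definition sym2 (R : realType) (n : nat) (T : 'M[R]_n.+1) : 'M[R]_n.+1 :=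
  2^-1 *: (T + T^T).

Definition sym3 (R : realType) (n : nat)
    (T : 'I_n.+1 -> 'I_n.+1 -> 'I_n.+1 -> R) (a b c : 'I_n.+1) : R :=
  6^-1 * (T a b c + T a c b + T b a c + T b c a + T c a b + T c b a).

(* Ric_{bd} = R_{cb}^c_d, where
   (nabla_a nabla_b - nabla_b nabla_a) xi^c = R_{ab}^c_d xi^d *)
Definition Ric (R : realType) (n : nat) (M : bmanifold R n) (G : conn M) :
    tensor2 M :=
  fun i x => \matrix_(b, d)
    (\sum_c pder c (fun y => G i y c b d) x
     - \sum_c pder b (fun y => G i y c c d) x
     + \sum_c \sum_e (G i x c c e * G i x e b d - G i x c b e * G i x e c d)).

(* The projective Schouten tensor of a special connection. *)
Definition Schouten (R : realType) (n : nat) (M : bmanifold R n) (G : conn M) :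
    tensor2 M :=
  fun i x => (n%:R)^-1 *: Ric G i x.

Definition parallel_density (R : realType) (n : nat) (M : bmanifold R n)
    (w : R) (U : set M) (G : conn M) (f : density M) : Prop :=
  forall i x, crd U i x -> nab0 w G f i x = 0.

Definition special (R : realType) (n : nat) (M : bmanifold R n)
    (U : set M) (G : conn M) : Prop :=
  exists v : density M,
    [/\ is_density (- n.+2%:R) U v,
        forall i x, crd U i x -> v i x != 0
      & parallel_density (- n.+2%:R) U G v].

(* G' = G + om over U *)
Definition proj_change (R : realType) (n : nat) (M : bmanifold R n)
    (U : set M) (G : conn M) (om : oneform M) (G' : conn M) : Prop :=
  forall i x c a b, crd U i x ->
    G' i x c a b = G i x c a b + om i x 0 a * (c == b)%:R
                               + om i x 0 b * (c == a)%:R.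

Definition proj_equiv (R : realType) (n : nat) (M : bmanifold R n)
    (U : set M) (G G' : conn M) : Prop :=
  exists2 om : oneform M, is_oneform U om & proj_change U G om G'.

Definition defining_function (R : realType) (n : nat) (M : bmanifold R n)
    (U : set M) (rho : M -> R) : Prop :=
  [/\ open U, smooth_function U rho,
      forall p, U p -> 0 <= rho p,
      forall p, U p -> (rho p = 0 <-> boundary M p)
    & forall i p, dom i p -> U p -> boundary M p ->
        exists a, pder a (fun x => rho (chartV i x)) (chart i p) != 0].

Definition proj_compact (R : realType) (n : nat) (M : bmanifold R n)
    (alpha : R) (G : conn M) : Prop :=
  forall q, boundary M q -> exists (U : set M) (rho : M -> R) (G' : conn M),
    [/\ U q, defining_function U rho, is_connection U G'
      & proj_change (U `&` minterior M) G
          (fun i x => \row_a (pder a (fun y => rho (chartV i y)) x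
                              / (alpha * rho (chartV i x)))) G'].

(* For a projectively compact connection G on the interior: G' is a connection
   over the open subset U of the whole manifold, smooth up to the boundary,
   which belongs to the (unique) extension of the projective class of G.
   Projective compactness provides such G' around every boundary point, which
   moreover can be taken special when G is special. *)
Definition in_class (R : realType) (n : nat) (M : bmanifold R n)
    (G : conn M) (U : set M) (G' : conn M) : Prop :=
  [/\ open U, is_connection U G' & proj_equiv (U `&` minterior M) G G'].

Definition special_in_class (R : realType) (n : nat) (M : bmanifold R n)
    (G : conn M) (U : set M) (G' : conn M) : Prop :=
  in_class G U G' /\ special U G'.

(* Smooth sections over the whole manifold with zero locus the boundary,
   represented up to sign by a defining function in local trivializations. *)
Definition defining_density (R : realType) (n : nat) (M : bmanifold R n)
    (w : R) (f : density M) : Prop :=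
  [/\ is_density w [set: M] f,
      forall i p, dom i p -> (f i (chart i p) = 0 <-> boundary M p)
    & forall i q, dom i q -> boundary M q -> exists (U : set M) (s : bool),
        [/\ U q, U `<=` dom i
          & defining_function U (fun p => (-1) ^+ s * f i (chart i p))]].

Definition corresponding_defining_density (R : realType) (n : nat)
    (M : bmanifold R n) (alpha : R) (G : conn M) (f : density M) : Prop :=
  defining_density alpha f /\ parallel_density alpha (minterior M) G f.

(* A section of T^* = J^1(E(1)) has in chart i the 1-jet components
   (s; l_a) : 'cV_(1 + n.+1), which for the 1-jet of f are (f; d_a f).  The
   transition matrix is obtained by differentiating the transformation law of
   E(1):  (s; l)_i = cotractor_trans i j (s; l)_j. *)
Definition cotractor_trans (R : realType) (n : nat) (M : bmanifold R n)
    (i j : idx M) (x : 'rV[R]_n.+1) : 'M[R]_(1 + n.+1) :=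
  let d y := `|\det (jac i j y)| `^ (- 1 / n.+2%:R) in
  block_mx (d x)%:M 0 (\col_a pder a d x) (d x *: jac i j x).

(* The isomorphism T^* = E(1) + E_a(1) determined by a connection:
   it maps the 1-jet of f to (f; nabla_a f). *)
Definition split_mx (R : realType) (n : nat) (M : bmanifold R n) (G : conn M)
    (i : idx M) (x : 'rV[R]_n.+1) : 'M[R]_(1 + n.+1) :=
  block_mx 1%:M 0 (gam G i x)^T 1%:M.

(* Sections of S^2 T^*, as bilinear forms on T in the frame dual
   to the 1-jet frame. *)
Definition S2cotractor (R : realType) (n : nat) (M : bmanifold R n) :=
  idx M -> 'rV[R]_n.+1 -> 'M[R]_(1 + n.+1).

Definition is_S2cotractor (R : realType) (n : nat) (M : bmanifold R n)
    (U : set M) (H : S2cotractor M) : Prop :=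
  [/\ forall i a b, smooth_on (crd U i) (fun x => H i x a b),
      forall i x, crd U i x -> (H i x)^T = H i x
    & forall i j p, dom i p -> dom j p -> U p ->
        let g := cotractor_trans i j (chart i p) in
        H i (chart i p) = g *m H j (chart j p) *m g^T].

(* Elements (tau, nu_a, rho_ab) of E(2) + E_a(2) + E_(ab)(2). *)
Record triple (R : realType) (n : nat) (M : bmanifold R n) := Triple {
  slot0 : density M;
  slot1 : oneform M;
  slot2 : tensor2 M
}.

Definition slots (R : realType) (n : nat) (M : bmanifold R n) (G : conn M)
    (H : S2cotractor M) : triple M :=
  let Q i x : 'M[R]_(1 + n.+1) :=
    split_mx G i x *m H i x *m (split_mx G i x)^T in
  Triple (fun i x => ulsubmx (Q i x) 0 0)
         (fun i x => ursubmx (Q i x))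
         (fun i x => drsubmx (Q i x)).

(* The three slots of the connection on S^2 T^*, in the splitting of a special
   connection G. *)
Definition S2conn0 (R : realType) (n : nat) (M : bmanifold R n) (G : conn M)
    (t : triple M) : oneform M :=
  fun i x => nab0 2 G (slot0 t) i x - 2 *: slot1 t i x.

Definition S2conn1 (R : realType) (n : nat) (M : bmanifold R n) (G : conn M)
    (t : triple M) : tensor2 M :=
  fun i x => nab1 2 G (slot1 t) i x + slot0 t i x *: Schouten G i x
             - slot2 t i x.

Definition S2conn2 (R : realType) (n : nat) (M : bmanifold R n) (G : conn M)
    (t : triple M) : tensor3 M :=
  fun i x a b c => nab2 2 G (slot2 t) i x a b c
    + Schouten G i x a b * slot1 t i x 0 c
    + Schouten G i x a c * slot1 t i x 0 b.

Definition S2parallel (R : realType) (n : nat) (M : bmanifold R n)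
    (U : set M) (G : conn M) (t : triple M) : Prop :=
  forall i x, crd U i x ->
    [/\ S2conn0 G t i x = 0, S2conn1 G t i x = 0
      & forall a b c, S2conn2 G t i x a b c = 0].

(* The splitting operator L, in the splitting of G. *)
Definition Lop (R : realType) (n : nat) (M : bmanifold R n) (G : conn M)
    (tau : density M) : triple M :=
  Triple tau
    (fun i x => 2^-1 *: nab0 2 G tau i x)
    (fun i x => 2^-1 *: sym2 (nab1 2 G (nab0 2 G tau) i x)
                + tau i x *: sym2 (Schouten G i x)).

(* H is the section L(tau) of S^2 T^* over the whole manifold. *)
Definition is_L (R : realType) (n : nat) (M : bmanifold R n) (G : conn M)
    (tau : density M) (H : S2cotractor M) : Prop :=
  is_S2cotractor [set: M] H /\
  forall U G', special_in_class G U G' -> forall i x, crd U i x ->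
    [/\ slot0 (slots G' H) i x = slot0 (Lop G' tau) i x,
        slot1 (slots G' H) i x = slot1 (Lop G' tau) i x
      & slot2 (slots G' H) i x = slot2 (Lop G' tau) i x].

Definition bgg_solution (R : realType) (n : nat) (M : bmanifold R n)
    (G : conn M) (tau : density M) : Prop :=
  forall U G', special_in_class G U G' -> forall i x a b c, crd U i x ->
    sym3 (S2conn2 G' (Lop G' tau) i x) a b c = 0.

Definition normal_solution (R : realType) (n : nat) (M : bmanifold R n)
    (G : conn M) (tau : density M) : Prop :=
  forall U G', special_in_class G U G' -> S2parallel U G' (Lop G' tau).

(* H is parallel for the tractor connection of the extended class. *)
Definition tractor_parallel (R : realType) (n : nat) (M : bmanifold R n)
    (G : conn M) (H : S2cotractor M) : Prop :=
  forall U G', special_in_class G U G' -> S2parallel U G' (slots G' H).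

Definition nondegenerate_on (R : realType) (n m : nat) (M : bmanifold R n)
    (U : set M) (T : idx M -> 'rV[R]_n.+1 -> 'M[R]_m) : Prop :=
  forall i x, crd U i x -> T i x \in unitmx.

Definition bform (R : realType) (m : nat) (Q : 'M[R]_m) (v w : 'cV[R]_m) : R :=
  (v^T *m Q *m w) 0 0.

Definition indefinite_at (R : realType) (n : nat) (M : bmanifold R n)
    (H : S2cotractor M) (p : M) : Prop :=
  forall i, dom i p ->
    (exists v, 0 < bform (H i (chart i p)) v v) /\
    (exists v, bform (H i (chart i p)) v v < 0).

(* In the splitting of G the connection on T^* is d_a + cotractor_conn_mx a,
   acting on columns (sigma; mu_b):
   (d_a sigma + gam_a sigma - mu_a;
    d_a mu_b + gam_a mu_b - Gamma^c_{ab} mu_c + P_ab sigma). *)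
Definition cotractor_conn_mx (R : realType) (n : nat) (M : bmanifold R n)
    (G : conn M) (i : idx M) (x : 'rV[R]_n.+1) (a : 'I_n.+1) :
    'M[R]_(1 + n.+1) :=
  block_mx (gam G i x 0 a)%:M (- basisv R a)
           (row a (Schouten G i x))^T
           (\matrix_(b, c) (gam G i x 0 a * (b == c)%:R - G i x c a b)).

Definition C1_curve (R : realType) (n : nat) (c : R -> 'rV[R]_n.+1) : Prop :=
  forall a, (forall t, derivable (fun s => c s 0 a) t 1) /\
            continuous (derive1 (fun s => c s 0 a)).

(* V, in the frame of T dual to the splitting of T^*, is parallel along the
   restriction of c to [0, 1] for the dual of the cotractor connection. *)
Definition tractor_parallel_along (R : realType) (n : nat)
    (M : bmanifold R n) (G : conn M) (i : idx M) (c : R -> 'rV[R]_n.+1)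
    (V : R -> 'cV[R]_(1 + n.+1)) : Prop :=
  forall k, {within `[0, 1], continuous (fun t => V t k 0)} /\
    forall t : R, 0 < t < 1 ->
      is_derive t (1 : R) (fun s => V s k 0)
        ((\sum_a derive1 (fun s => c s 0 a) t *:
            ((cotractor_conn_mx G i (c t) a)^T *m V t)) k 0).

(* tractor_transport G i p j q A: the matrix A, from the fibre of T at p in the
   frame of chart i to the fibre at q in the frame of chart j (both dual to the
   1-jet frames of T^* ), is parallel transport along some piecewise C^1 curve
   from p to q.  Such curves are concatenations of curves which run in one chart
   and in the domain of one special connection of the class. *)
Inductive tractor_transport (R : realType) (n : nat) (M : bmanifold R n)
    (G : conn M) : idx M -> M -> idx M -> M -> 'M[R]_(1 + n.+1) -> Prop :=
| transport_frame i j p :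
    dom i p -> dom j p ->
    tractor_transport G i p j p (cotractor_trans i j (chart i p))^T
| transport_curve i U G' c (A : 'M[R]_(1 + n.+1)) :
    special_in_class G U G' -> C1_curve c ->
    (forall t : R, 0 <= t <= 1 -> crd U i (c t)) ->
    (forall v : 'cV[R]_(1 + n.+1), exists V,
       [/\ tractor_parallel_along G' i c V,
           (split_mx G' i (c 0))^T *m V 0 = v
         & (split_mx G' i (c 1))^T *m V 1 = A *m v]) ->
    tractor_transport G i (chartV i (c 0)) i (chartV i (c 1)) A
| transport_comp i p j q k r A B :
    tractor_transport G i p j q A -> tractor_transport G j q k r B ->
    tractor_transport G i p k r (B *m A).

Definition tractor_holonomy (R : realType) (n : nat) (M : bmanifold R n)
    (G : conn M) (i : idx M) (p : M) : set 'M[R]_(1 + n.+1) :=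
  [set A | tractor_transport G i p i p A].

Definition orthogonal_group (R : realType) (m : nat) (Q : 'M[R]_m) :
    set 'M[R]_m :=
  [set A | A \in unitmx /\ A^T *m Q *m A = Q].

(* Generator of E(-1), the annihilator of {sigma = 0}, in every frame dual to
   a 1-jet frame; the projection T -> T/E(-1) = TN(-1) is dsubmx. *)
Definition tline (R : realType) (n : nat) : 'cV[R]_(1 + n.+1) :=
  col_mx 1%:M 0.

Definition closed_orbit (R : realType) (n : nat) (M : bmanifold R n)
    (H : S2cotractor M) : set M :=
  [set p | forall i, dom i p ->
     bform (H i (chart i p)) (tline R n) (tline R n) = 0].

Definition positive_orbit (R : realType) (n : nat) (M : bmanifold R n)
    (H : S2cotractor M) : set M :=
  [set p | forall i, dom i p ->
     0 < bform (H i (chart i p)) (tline R n) (tline R n)].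

Definition negative_orbit (R : realType) (n : nat) (M : bmanifold R n)
    (H : S2cotractor M) : set M :=
  [set p | forall i, dom i p ->
     bform (H i (chart i p)) (tline R n) (tline R n) < 0].

Definition is_metric (R : realType) (n : nat) (M : bmanifold R n)
    (U : set M) (g : tensor2 M) : Prop :=
  [/\ is_tensor2 U g, forall i x, crd U i x -> (g i x)^T = g i x
    & nondegenerate_on U g].

(* The torsion free connection preserving g. *)
Definition levi_civita (R : realType) (n : nat) (M : bmanifold R n)
    (U : set M) (g : tensor2 M) (G : conn M) : Prop :=
  is_connection U G /\
  forall i x a b c, crd U i x -> nab2 0 G g i x a b c = 0.

Definition einstein (R : realType) (n : nat) (M : bmanifold R n)
    (U : set M) (g : tensor2 M) : Prop :=
  is_metric U g /\
  exists2 G : conn M, levi_civita U g G &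
    exists lam : R, forall i x, crd U i x -> Ric G i x = lam *: g i x.

(* A conformal structure on the boundary, whose charts are the restrictions of
   the charts of M with coordinates x_1, ..., x_n: local pseudo-Riemannian
   metrics agreeing up to a positive factor on overlaps. *)
Definition boundary_conformal_structure (R : realType) (n : nat)
    (M : bmanifold R n) (h : idx M -> 'rV[R]_n.+1 -> 'M[R]_n) : Prop :=
  [/\ forall i a b, smooth_on (crd (boundary M) i) (fun x => h i x a b),
      forall i x, crd (boundary M) i x -> (h i x)^T = h i x,
      nondegenerate_on (boundary M) h
    & forall i j p, dom i p -> dom j p -> boundary M p ->
        let J := row' 0 (col' 0 (jac i j (chart i p))) in
        exists2 om : R, 0 < om &
          h i (chart i p) = om *: (J *m h j (chart j p) *m J^T)].

(* Along the boundary, E(-1) is contained in its H-orthogonal complement, the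
   latter projects onto T(boundary)(-1) = {nu | nu^0 = 0}, and h is the form
   induced by H on the quotient. *)
Definition induces_on_boundary (R : realType) (n : nat) (M : bmanifold R n)
    (H : S2cotractor M) (h : idx M -> 'rV[R]_n.+1 -> 'M[R]_n) : Prop :=
  forall i x, crd (boundary M) i x ->
    let perp (v : 'cV[R]_(1 + n.+1)) := bform (H i x) (tline R n) v = 0 in
    [/\ perp (tline R n),
        forall v, perp v <-> dsubmx v 0 0 = 0
      & forall v w, perp v -> perp w ->
          bform (H i x) v w =
          bform (h i x) (row' 0 (dsubmx v)) (row' 0 (dsubmx w))].

(* Main.v *)
(* Let G' = nabla + om be a connection of the class with om closed.  As tau is
   parallel for nabla, nab' tau = 2 om tau, hence L(tau) has the slots
   (tau, om tau, tau (P + om om)) in the splitting of G', and the bottom slot of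
   the derivative of L(tau) comes out as tau (nabla P), whatever om is, while the
   other two vanish.  With P = Ric / n and tau <> 0 this gives (i) and (ii) in the
   interior; both sides are smooth up to the boundary, where the statements
   follow by density of the interior.

   In 1-jet frames the same computation gives, in the interior,
   L(tau) = (tau, - tau gam, tau (P + gam gam)) with gam the connection form of
   nabla on E(1).  Its expressions through the connections G' = nabla + d rho / (2 rho)
   extend it over the boundary.  If nabla Ric = 0 then L(tau) is parallel; it is
   nondegenerate in the interior if Ric is, and since its determinant satisfies a
   linear differential equation along curves, also on the boundary.  There
   E(-1) is isotropic, so L(tau) is indefinite, and indefiniteness is an open and
   closed condition. *)

From HB Require Import structures.
Require Import Defs.
From mathcomp Require Import all_boot all_order all_algebra.
From mathcomp Require Import all_classical all_reals all_analysis.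
From mathcomp Require Import perm ring lra.
Set Implicit Arguments.
Unset Strict Implicit.
Unset Printing Implicit Defensive.
Import Order.TTheory GRing.Theory Num.Theory.
Import numFieldNormedType.Exports.
Local Open Scope classical_set_scope.
Local Open Scope ring_scope.

(** * Differential calculus on open subsets of R^(n+1) *)

(** The obstacle is the boundary: [nabla] is given only in the interior, while the connections that
    are smooth across the boundary are tied to it only there. So each identity is computed in the
    interior through the difference of the connection forms on E(1), which determines the change of
    connection, and is then extended by [smooth_eq_closure]. This needs derivatives up to the
    boundary, so [pder] is first matched with ordinary derivatives of local extensions. A connection
    carries only the transformation law of its Christoffel symbols; that Ric is a tensor has to be
    proved, and this is what makes the chart expressions of L(tau) a single section. The section is
    assembled from connections chosen arbitrarily, one per point, because different choices agree by
    continuity. No existence theorem for differential equations enters: the determinant argument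
    needs only a Gronwall estimate, and transport is a relation between end values of parallel
    fields, along which the pairing by L(tau) has zero derivative. *)

Lemma cvg_sumR (R : realType) (I T : Type) (F : set_system T) {FF : Filter F}
    (r : seq I) (P : pred I) (f : I -> T -> R) (l : I -> R) :
  (forall i, P i -> f i x @[x --> F] --> l i) ->
  (\sum_(i <- r | P i) f i x) @[x --> F] --> \sum_(i <- r | P i) l i.
Proof. by move=> H; apply: (cvg_big (@add_continuous R)). Qed.

Section euclidean.
Context (R : realType) (n : nat).
Notation V := 'rV[R]_n.+1.
Implicit Types (f g : V -> R) (x y : V).

Lemma near_rvP x (P : set V) :
  (\forall y \near x, P y) <->
  exists2 e : R, 0 < e & forall y, (forall a, `|y 0 a - x 0 a| < e) -> P y.
Proof.
split.
  move/nbhs_ballP => [e /= e0 He]; exists e => // y Hy; apply: He.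
  split=> // i j; rewrite (ord1 i) /ball /= distrC; exact: Hy.
move=> [e e0 He]; apply/nbhs_ballP; exists e => //= y [_ Hy]; apply: He => a.
by move: (Hy 0 a); rewrite /ball /= distrC.
Qed.

Lemma coord_le_norm (v : V) a : `|v 0 a| <= `|v|.
Proof.
rewrite {2}/Num.Def.normr /= mx_normrE.
exact: (le_bigmax _ (fun ij : 'I_1 * 'I_n.+1 => `|v ij.1 ij.2|) (0, a)).
Qed.

(** Meant for restrictions to coordinate lines. The increment [u] is a coordinate of a displacement
    and may be negative, hence two applications of the mean value theorem. *)
Lemma mvt_estimate (phi dphi : R -> R) (u D e : R) :
  (forall t : R, `|t| <= `|u| -> is_derive t (1 : R) phi (dphi t)) ->
  (forall t : R, `|t| <= `|u| -> `|dphi t - D| <= e) ->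
  `|phi u - phi 0 - u * D| <= `|u| * e.
Proof.
move=> dp bd.
have cont a b : `|a| <= `|u| -> `|b| <= `|u| -> {within `[a, b], continuous phi}.
  move=> au bu; apply: derivable_within_continuous => t; rewrite in_itv /= => /andP[at_ tb].
  have tu : `|t| <= `|u|.
    move: au bu; rewrite !ler_norml => /andP[a1 a2] /andP[b1 b2].
    by rewrite (le_trans a1 at_) (le_trans tb b2).
  by have [] := dp t tu.
have H0 : `|0 : R| <= `|u| by rewrite normr0.
case: (leP 0 u) => u0.
  have [||c] := @MVT_segment R phi dphi 0 u u0.
  - move=> t; rewrite in_itv /= => /andP[t0 tu]; apply: dp.
    by rewrite (ger0_norm u0) (ger0_norm (ltW t0)) ltW.
  - exact: cont.
  rewrite in_itv /= subr0 => /andP[c0 cu] ->.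
  rewrite [dphi c * u]mulrC -mulrBr normrM ler_wpM2l //.
  by apply: bd; rewrite (ger0_norm u0) (ger0_norm c0).
have [||c] := @MVT_segment R phi dphi u 0 (ltW u0).
- move=> t; rewrite in_itv /= => /andP[t0 tu]; apply: dp.
  by rewrite (ltr0_norm u0) (ltr0_norm tu) lerN2 ltW.
- exact: cont.
rewrite in_itv /= sub0r => /andP[c0 cu] E.
have -> : phi u - phi 0 - u * D = u * (dphi c - D).
  by rewrite -(opprB (phi 0)) E; ring.
rewrite normrM ler_wpM2l //.
by apply: bd; rewrite (ltr0_norm u0) (ler0_norm cu) lerN2.
Qed.

Lemma is_derive_line f x (v : V) (t : R) :
  derivable f (x + t *: v) v ->
  is_derive t (1 : R) (fun s : R => f (x + s *: v)) ('D_v f (x + t *: v)).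
Proof.
move=> df.
have E : (fun h : R => h^-1 *: (((fun s : R => f (x + s *: v)) \o shift t) (h *: 1) -
            f (x + t *: v))) =
    (fun h : R => h^-1 *: ((f \o shift (x + t *: v)) (h *: v) - f (x + t *: v))).
  apply/funext => h /=; congr (_ *: (f _ - _)).
  by rewrite [h%:A](mulr1 h) scalerDl addrCA.
by split; rewrite /derivable /derive E.
Qed.

Definition rvdot (D : 'cV[R]_n.+1) (v : V) : R := (v *m D) 0 0.

Lemma rvdot_linear D : linear (rvdot D).
Proof. by move=> k u v; rewrite /rvdot mulmxDl -scalemxAl !mxE. Qed.

HB.instance Definition _ D :=
  GRing.isLinear.Build R V R _ (rvdot D) (rvdot_linear D).

Lemma rvdotE D (v : V) : rvdot D v = \sum_a v 0 a * D a 0.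
Proof. by rewrite /rvdot mxE. Qed.

Lemma rvdot_continuous D : continuous (rvdot D).
Proof.
move=> x; rewrite (_ : rvdot D = fun v => \sum_a v 0 a * D a 0); last first.
  by apply/funext => v; rewrite rvdotE.
apply: (cvg_sumR (F := nbhs x) (f := fun a (v : V) => v 0 a * D a 0)) => a _.
by apply: cvgM; [exact: coord_continuous | exact: cvg_cst].
Qed.

(** Move from [x] to [x + h] one coordinate at a time. Each move contributes an error of at most
    [e' * |h|] by [mvt_estimate], and there are [n.+1] moves. *)
Lemma C1_estimate f x :
  (forall a, \forall y \near x, derivable f y (basisv R a)) ->
  (forall a, {for x, continuous (fun y => 'D_(basisv R a) f y)}) ->
  forall e : R, 0 < e -> \forall h \near (0 : V),
    `|f (x + h) - f x - \sum_a h 0 a * 'D_(basisv R a) f x| <= e * `|h|.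
Proof.
move=> df cf e e0.
pose e' := e / n.+1%:R.
have e'0 : 0 < e' by rewrite divr_gt0.
have : \forall y \near x, forall a, derivable f y (basisv R a) /\
    `|'D_(basisv R a) f x - 'D_(basisv R a) f y| < e'.
  apply: (@filter_forall V _ (fun a y => derivable f y (basisv R a) /\
    `|'D_(basisv R a) f x - 'D_(basisv R a) f y| < e') (nbhs x)) => a.
  have C : \forall y \near x, `|'D_(basisv R a) f x - 'D_(basisv R a) f y| < e'.
    by have /cvgrPdist_lt := cf a; apply.
  by apply: filterS2 (df a) C.
move/near_rvP => [d d0 Hd].
apply/near_rvP; exists d => // h Hh.
(* [tr s] keeps only the coordinates of [h] listed in [s]: adding an index moves along one axis, and
   the full enumeration gives [h]. *)
pose tr (s : seq 'I_n.+1) : V := \row_b (if b \in s then h 0 b else 0).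
have Hs (s : seq 'I_n.+1) : uniq s ->
    `|f (x + tr s) - f x - \sum_(a <- s) h 0 a * 'D_(basisv R a) f x|
      <= (size s)%:R * e' * `|h|.
  elim: s => [_|a s IH /= /andP[as_ us]].
    rewrite big_nil subr0 (_ : tr [::] = 0) ?addr0 ?subrr ?normr0 ?mul0r //.
    by apply/rowP => b; rewrite !mxE.
  have trE : x + tr (a :: s) = (x + tr s) + h 0 a *: basisv R a.
    rewrite -addrA; congr (_ + _); apply/rowP => b; rewrite !mxE inE eqxx /=.
    case: eqVneq => [->|ba] /=; first by rewrite (negbTE as_) mulr1 add0r.
    by rewrite mulr0 addr0.
  have Hball t : `|t| <= `|h 0 a| ->
      forall b, `|(x + tr s + t *: basisv R a) 0 b - x 0 b| < d.
    move=> th b; rewrite !mxE eqxx /= [_ - x 0 b]addrAC [x 0 b + _]addrC addrK.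
    have Hhb c : `|h 0 c| < d by have := Hh c; rewrite mxE subr0.
    case: eqVneq => [->|ba] /=.
      by rewrite (negbTE as_) add0r mulr1 (le_lt_trans th).
    by rewrite mulr0 addr0; case: ifP; rewrite ?normr0.
  have M := @mvt_estimate (fun t => f (x + tr s + t *: basisv R a))
      (fun t => 'D_(basisv R a) f (x + tr s + t *: basisv R a)) (h 0 a)
      ('D_(basisv R a) f x) e' _ _.
  rewrite scale0r addr0 -trE in M.
  rewrite big_cons.
  rewrite (_ : _ - _ = (f (x + tr (a :: s)) - f (x + tr s)
     - h 0 a * 'D_(basisv R a) f x) + (f (x + tr s) - f x -
     \sum_(b <- s) h 0 b * 'D_(basisv R b) f x)); last by ring.
  apply: le_trans (ler_normD _ _) _.
  rewrite [(size (a :: s))%:R]mulrS !mulrDl mul1r lerD ?IH //.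
  apply: le_trans; first apply: M.
  - by move=> t ht; apply: is_derive_line; have [] := Hd _ (Hball t ht) a.
  - by move=> t ht; have [_ /ltW] := Hd _ (Hball t ht) a; rewrite distrC.
  by rewrite mulrC ler_wpM2l ?coord_le_norm // ltW.
have := Hs (enum 'I_n.+1) (enum_uniq _).
rewrite big_enum size_enum_ord [_ * e']mulrC /e' divfK ?pnatr_eq0 //.
by rewrite (_ : tr _ = h) //; apply/rowP => b; rewrite mxE mem_enum.
Qed.

Lemma differentiable_approx (W W' : normedModType R) (f : W -> W')
    (df : {linear W -> W'}) (x : W) :
  continuous df ->
  (forall e : R, 0 < e -> \forall h \near (0 : W),
      `|f (x + h) - f x - df h| <= e * `|h|) ->
  differentiable f x /\ 'd f x = df :> (W -> W').
Proof.
move=> cdf Hf.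
have E : f \o shift x = cst (f x) + df +o_ 0 id.
  apply/eqaddoP => e e0; have := Hf e e0; apply: filterS => h.
  by rewrite !fctE /= opprD addrA [h + x]addrC.
have D := diff_unique cdf E.
by split=> //; apply/diff_locallyP; rewrite D; split.
Qed.

Lemma C1_differentiable f x :
  (forall a, \forall y \near x, derivable f y (basisv R a)) ->
  (forall a, {for x, continuous (fun y => 'D_(basisv R a) f y)}) ->
  differentiable f x /\
  forall v, 'd f x v = \sum_a v 0 a * 'D_(basisv R a) f x.
Proof.
move=> df cf.
pose D : 'cV[R]_n.+1 := \col_a 'D_(basisv R a) f x.
have DE v : rvdot D v = \sum_a v 0 a * 'D_(basisv R a) f x.
  by rewrite rvdotE; apply: eq_bigr => a _; rewrite mxE.
have [|dif difE] := @differentiable_approx V R f (rvdot D) x (@rvdot_continuous D).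
  move=> e e0; have := C1_estimate df cf e0; apply: filterS => h.
  by rewrite -DE.
by split=> // v; rewrite difE -DE.
Qed.
End euclidean.

Lemma derive_lineE (R : realType) (V W : normedModType R) (f : V -> W) x v :
  'D_v f x = 'D_1 (fun h : R => f (h *: v + x)) 0.
Proof.
rewrite /derive; set g1 := fun h => h^-1 *: _; set g2 := fun h => h^-1 *: _.
suff -> : g1 = g2 by [].
by rewrite funeqE /g1 /g2 => h /=; rewrite addr0 scale0r add0r [_%:A]mulr1.
Qed.

Section derive_rules.
Context (R : realType) (W : normedModType R).
Implicit Types (f g : W -> R) (x v : W).

Lemma is_derive_add f g x v (df dg : R) :
  is_derive x v f df -> is_derive x v g dg ->
  is_derive x v (fun y => f y + g y) (df + dg).
Proof. exact: is_deriveD. Qed.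

Lemma is_derive_mul f g x v (df dg : R) :
  is_derive x v f df -> is_derive x v g dg ->
  is_derive x v (fun y => f y * g y) (df * g x + f x * dg).
Proof.
move=> Hf Hg; have H := is_deriveM Hf Hg.
by rewrite addrC [df * _]mulrC; exact: H.
Qed.

Lemma is_derive_const (c : R) x v : is_derive x v (fun=> c) 0.
Proof. exact: is_derive_cst. Qed.

Lemma is_derive_bigsum (I : Type) (r : seq I) (P : pred I) (f : I -> W -> R) x v
    (df : I -> R) :
  (forall i, is_derive x v (f i) (df i)) ->
  is_derive x v (fun y => \sum_(i <- r | P i) f i y) (\sum_(i <- r | P i) df i).
Proof.
move=> H; elim: r => [|i r IH].
  rewrite big_nil; under eq_fun do rewrite big_nil; exact: is_derive_const.
rewrite big_cons; under eq_fun do rewrite big_cons.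
by case: (P i) => //; exact: is_derive_add.
Qed.

Lemma is_derive_bigprod (I : finType) (f : I -> W -> R) x v (df : I -> R) :
  (forall i, is_derive x v (f i) (df i)) ->
  is_derive x v (fun y => \prod_i f i y)
    (\sum_i df i * \prod_(j | j != i) f j x).
Proof.
move=> H.
(* Without repetitions, the condition [j != i] removes exactly one factor. *)
suff : forall r : seq I, uniq r -> is_derive x v (fun y => \prod_(i <- r) f i y)
    (\sum_(i <- r) df i * \prod_(j <- r | j != i) f j x).
  by move=> /(_ _ (index_enum_uniq I)).
elim=> [_|i r IH /= /andP[ir ur]].
  rewrite big_nil; under eq_fun do rewrite big_nil; exact: is_derive_const.
under eq_fun do rewrite big_cons.
have := is_derive_mul (H i) (IH ur); congr is_derive.
rewrite big_cons; congr (_ + _).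
  rewrite big_cons eqxx /=; congr (_ * _).
  rewrite big_seq [RHS]big_seq_cond; apply: eq_bigl => j.
  case jr: (j \in r) => //=; symmetry.
  by apply/eqP => ji; move: ir; rewrite -ji jr.
rewrite mulr_sumr big_seq [RHS]big_seq; apply: eq_bigr => j jr.
rewrite big_cons; case: eqVneq => [ij|_] /=.
  by move: ir; rewrite ij jr.
by rewrite mulrCA.
Qed.

Lemma is_derive_comp1 (phi : R -> R) f x v (df dphi : R) :
  is_derive x v f df -> is_derive (f x) (1 : R) phi dphi ->
  is_derive x v (fun y => phi (f y)) (df * dphi).
Proof.
move=> [fd <-] [pd <-].
pose h := fun t : R => f (t *: v + x).
have hd : derivable h 0 1 by apply/(derivable1P f x v).1.
have h0 : h 0 = f x by rewrite /h scale0r add0r.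
have pd' : derivable phi (h 0) 1 by rewrite h0.
split.
  apply/derivable1P/derivable1_diffP.
  by apply: (@differentiable_comp _ _ _ _ h phi); apply/derivable1_diffP.
rewrite derive_lineE (derive_lineE f) -/h -!derive1E -h0 mulrC.
exact: (derive1_comp hd pd').
Qed.
End derive_rules.

Section chain_rule.
Context (R : realType) (W : normedModType R) (n : nat).
Notation V := 'rV[R]_n.+1.

Lemma cvg_rv (T : Type) (F : set_system T) {FF : Filter F} (c : T -> V) (l : V) :
  (forall a, c t 0 a @[t --> F] --> l 0 a) -> c t @[t --> F] --> l.
Proof.
move=> H; apply/cvgrPdist_lt => e e0.
have : \forall t \near F, forall a, `|l 0 a - c t 0 a| < e.
  apply: (@filter_forall T _ (fun a t => `|l 0 a - c t 0 a| < e) F) => a.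
  by have /cvgrPdist_lt := H a; apply.
apply: filterS => t Ht; rewrite {1}/Num.Def.normr /= mx_normrE.
by apply/bigmax_ltP; split=> //= -[i j] _ /=; rewrite !mxE ord1.
Qed.

(** Restricting [c] to the line through [t] in direction [v] reduces this to the composition of
    differentials. [W] is general so that curves and maps between charts are both covered. *)
Lemma chain_rule (c : W -> V) (dc : 'I_n.+1 -> R) (g : V -> R) t v :
  (forall b, is_derive t v (fun s => c s 0 b) (dc b)) ->
  differentiable g (c t) ->
  is_derive t v (fun s => g (c s)) ('d g (c t) (\row_b dc b)).
Proof.
move=> Hc dg.
have cd : derivable c t v.
  by apply/derivable_mxP => i j; rewrite (ord1 i); have [] := Hc j.
pose h := fun s : R => c (s *: v + t).
have hd : differentiable h 0 by apply/derivable1_diffP/(derivable1P c t v).1.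
have h0 : h 0 = c t by rewrite /h scale0r add0r.
have dg' : differentiable g (h 0) by rewrite h0.
have dgh : differentiable (g \o h) 0 by apply: differentiable_comp.
split; first by apply/derivable1P/derivable1_diffP.
have E1 : 'D_v c t = 'd h 0 1 := etrans (derive_lineE c t v) (deriveE (1 : R) hd).
have E2 : 'D_v (fun s => g (c s)) t = 'd (g \o h) 0 1.
  exact: etrans (derive_lineE (fun s => g (c s)) t v) (deriveE (1 : R) dgh).
rewrite E2 (diff_comp hd dg') h0 /= -E1 (derive_mx cd).
congr ('d g (c t) _).
apply/rowP => b; rewrite !mxE; have [_ <-] := Hc b.
by congr ('D_v _ t).
Qed.
End chain_rule.

(** * Functions of class C^k and symmetry of second derivatives *)

Section Ck_calculus.
Context (R : realType) (n : nat).
Notation V := 'rV[R]_n.+1.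
Implicit Types (f g : V -> R) (U : set V).
Notation e_ := (basisv R).

Lemma CkW k U f : Ck k.+1 U f -> Ck k U f.
Proof.
elim: k f => [|k IH] f [cf df]; first exact: cf.
by split=> // a; have [da Ca] := df a; split=> //; exact: IH.
Qed.

Lemma Ck_continuous k U f x : Ck k U f -> U x -> {for x, continuous f}.
Proof. by case: k => [|k] => [H|[H _]]; exact: H. Qed.

Lemma Ck_derivable k U f x a : Ck k.+1 U f -> U x -> derivable f x (e_ a).
Proof. by move=> [_ /(_ a)[H _]]; exact: H. Qed.

Lemma Ck_derive k U f a : Ck k.+1 U f -> Ck k U (fun x => 'D_(e_ a) f x).
Proof. by move=> [_ /(_ a)[_ H]]. Qed.

Lemma Ck_sub k U U' f : U' `<=` U -> Ck k U f -> Ck k U' f.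
Proof.
move=> sU; elim: k f => [|k IH] f; first by move=> H x /sU; exact: H.
move=> [cf df]; split=> [x /sU /cf //|a]; have [da Ca] := df a.
by split=> [x /sU /da //|]; exact: IH.
Qed.

Lemma eq_Ck k U f g : open U -> {in U, f =1 g} -> Ck k U f -> Ck k U g.
Proof.
move=> oU; elim: k f g => [|k IH] f g fg.
  move=> H x Ux; have Hx := H x Ux.
  have nfg : \forall y \near x, f y = g y.
    by apply: filterS (open_nbhs_nbhs (conj oU Ux)) => y Uy; apply: fg; rewrite inE.
  rewrite /prop_for /continuous_at -fg ?inE //.
  exact: cvg_trans (near_eq_cvg nfg) Hx.
move=> H; have [cf df] := H.
have nfg x : U x -> \forall y \near x, f y = g y.
  move=> Ux.
  by apply: filterS (open_nbhs_nbhs (conj oU Ux)) => y Uy; apply: fg; rewrite inE.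
split=> [x Ux|a].
  rewrite /prop_for /continuous_at -fg ?inE //.
  exact: cvg_trans (near_eq_cvg (nfg x Ux)) (cf x Ux).
split=> [x Ux|].
  exact: near_eq_derivable (nfg x Ux) (proj1 (df a) x Ux).
apply: IH (proj2 (df a)) => x; rewrite inE => Ux.
exact: near_eq_derive (nfg x Ux).
Qed.

Lemma Ck_cst k U (c : R) : Ck k U (fun=> c).
Proof.
elim: k c => [|k IH] c; first by move=> x _; exact: cst_continuous.
split=> [x _|a]; first exact: cst_continuous.
split=> [x _|]; first exact: derivable_cst.
have -> : (fun x : V => 'D_(e_ a) (fun=> c) x) = (fun=> (0 : R)).
  by apply/funext => x; exact: derive_cst.
exact: IH.
Qed.

Lemma CkD k U f g : open U -> Ck k U f -> Ck k U g -> Ck k U (fun x => f x + g x).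
Proof.
move=> oU; elim: k f g => [|k IH] f g.
  by move=> Hf Hg x Ux; exact: (@continuousD _ _ _ f g x (Hf x Ux) (Hg x Ux)).
move=> [cf df] [cg dg]; split=> [x Ux|a].
  exact: (@continuousD _ _ _ f g x (cf x Ux) (cg x Ux)).
have [fa Fa] := df a; have [ga Ga] := dg a.
split=> [x Ux|]; first by apply: derivableD; [exact: (fa x Ux)|exact: (ga x Ux)].
apply: eq_Ck (IH _ _ Fa Ga) => // x; rewrite inE => Ux.
by rewrite [RHS]deriveD //; [exact: (fa x Ux)|exact: (ga x Ux)].
Qed.

Lemma CkM k U f g : open U -> Ck k U f -> Ck k U g -> Ck k U (fun x => f x * g x).
Proof.
move=> oU; elim: k f g => [|k IH] f g.
  by move=> Hf Hg x Ux; exact: (@continuousM _ _ f g x (Hf x Ux) (Hg x Ux)).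
move=> Hf Hg; have [cf df] := Hf; have [cg dg] := Hg; split=> [x Ux|a].
  exact: (@continuousM _ _ f g x (cf x Ux) (cg x Ux)).
have [fa Fa] := df a; have [ga Ga] := dg a.
split=> [x Ux|]; first by apply: derivableM; [exact: (fa x Ux)|exact: (ga x Ux)].
have H1 := IH _ _ (CkW Hf) Ga; have H2 := IH _ _ (CkW Hg) Fa.
apply: eq_Ck (CkD oU H1 H2) => // x; rewrite inE => Ux.
by rewrite [RHS]deriveM //; [exact: (fa x Ux)|exact: (ga x Ux)].
Qed.

Lemma Ck_sum k U (I : Type) (r : seq I) (P : pred I) (f : I -> V -> R) :
  open U -> (forall i, P i -> Ck k U (f i)) ->
  Ck k U (fun x => \sum_(i <- r | P i) f i x).
Proof.
move=> oU H; elim: r => [|i r IH].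
  by under eq_fun do rewrite big_nil; exact: Ck_cst.
under eq_fun do rewrite big_cons.
by case Pi: (P i) => //; apply: CkD => //; exact: H.
Qed.

Lemma Ck1_differentiable U f x : open U -> Ck 1 U f -> U x ->
  differentiable f x /\
  forall v, 'd f x v = \sum_a v 0 a * 'D_(e_ a) f x.
Proof.
move=> oU Hf Ux; apply: C1_differentiable => a.
  apply: filterS (open_nbhs_nbhs (conj oU Ux)) => y Uy.
  exact: Ck_derivable Hf Uy.
exact: (Ck_continuous (Ck_derive a Hf) Ux).
Qed.

Lemma Ck_chain_rule (W : normedModType R) (c : W -> V) (dc : 'I_n.+1 -> R)
    U g t v : open U -> Ck 1 U g -> U (c t) ->
  (forall b, is_derive t v (fun s => c s 0 b) (dc b)) ->
  is_derive t v (fun s => g (c s)) (\sum_b dc b * 'D_(e_ b) g (c t)).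
Proof.
move=> oU Hg Uc Hc; have [dg gE] := Ck1_differentiable oU Hg Uc.
have := chain_rule Hc dg; rewrite gE; congr is_derive.
by apply: eq_bigr => b _; rewrite mxE.
Qed.

Lemma Ck_comp k U U' g (phi : V -> V) : open U -> open U' ->
  (forall x, U x -> U' (phi x)) -> (forall b, Ck k U (fun x => phi x 0 b)) ->
  Ck k U' g -> Ck k U (fun x => g (phi x)).
Proof.
move=> oU oU' sU Hphi; have Cphi x : U x -> {for x, continuous phi}.
  by move=> Ux; apply: (@cvg_rv _ _ _ (nbhs x) _) => b; exact: Ck_continuous (Hphi b) Ux.
elim: k g Hphi => [|k IH] g Hphi Hg.
  move=> x Ux; apply: continuous_comp; first exact: Cphi.
  exact: Hg (sU x Ux).
have Cg x : U x -> {for x, continuous (fun x => g (phi x))}.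
  move=> Ux; apply: continuous_comp; first exact: Cphi.
  exact: (Ck_continuous Hg (sU x Ux)).
have Hg1 : Ck 1 U' g by move: Hg; clear; elim: k => // k IH /CkW.
have D a x : U x -> is_derive x (e_ a) (fun x => g (phi x))
    (\sum_b 'D_(e_ a) (fun x => phi x 0 b) x * 'D_(e_ b) g (phi x)).
  move=> Ux; apply: (Ck_chain_rule oU' Hg1 (sU x Ux)) => b.
  by apply: derivableP; exact: Ck_derivable (Hphi b) Ux.
split=> // a; split=> [x Ux|]; first by have [] := D a x Ux.
have : Ck k U (fun x => \sum_b 'D_(e_ a) (fun x => phi x 0 b) x
    * 'D_(e_ b) g (phi x)).
  apply: Ck_sum => // b _; apply: CkM => //; first exact: (Ck_derive a (Hphi b)).
  apply: (IH (fun y => 'D_(e_ b) g y)); last exact: Ck_derive.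
  by move=> c; apply: CkW.
apply: eq_Ck => // x; rewrite inE => Ux.
by symmetry; have [] := D a x Ux.
Qed.

Lemma Ck_powR k U f (r : R) : open U -> (forall x, U x -> 0 < f x) ->
  Ck k U f -> Ck k U (fun x => f x `^ r).
Proof.
move=> oU f0; elim: k r => [|k IH] r Hf.
  move=> x Ux; apply: (@continuous_comp _ _ _ f (@powR R ^~ r)); first exact: (Hf x Ux).
  apply/differentiable_continuous/derivable1_diffP.
  by have [] := is_derive1_powR r (f0 x Ux).
have D a x : U x -> is_derive x (e_ a) (fun x => f x `^ r)
    ('D_(e_ a) f x * (r * f x `^ (r - 1))).
  move=> Ux; apply: (@is_derive_comp1 _ _ (@powR R ^~ r)).
    by apply: derivableP; exact: Ck_derivable Hf Ux.
  exact: is_derive1_powR (f0 x Ux).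
split=> [x Ux|a].
  apply: (@continuous_comp _ _ _ f (@powR R ^~ r)).
    exact: (Ck_continuous Hf Ux).
  apply/differentiable_continuous/derivable1_diffP.
  by have [] := is_derive1_powR r (f0 x Ux).
split=> [x Ux|]; first by have [] := D a x Ux.
have : Ck k U (fun x => 'D_(e_ a) f x * (r * f x `^ (r - 1))).
  apply: CkM => //; first exact: Ck_derive.
  by apply: CkM => //; [exact: Ck_cst|apply: IH; exact: CkW].
apply: eq_Ck => // x; rewrite inE => Ux.
by symmetry; have [] := D a x Ux.
Qed.

Lemma is_derive_translate f (w x v : V) : derivable f (x + w) v ->
  is_derive x v (fun y => f (y + w)) ('D_v f (x + w)).
Proof.
move=> df; have E : (fun h : R => h^-1 *: (((fun y => f (y + w)) \o shift x) (h *: v)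
      - f (x + w))) =
    (fun h : R => h^-1 *: ((f \o shift (x + w)) (h *: v) - f (x + w))).
  by apply/funext => h /=; rewrite addrA.
by split; rewrite /derivable /derive E.
Qed.

Lemma mvt_line f (y v : V) (t : R) : 0 < t ->
  (forall s : R, 0 <= s <= t -> derivable f (y + s *: v) v) ->
  exists2 s : R, 0 <= s <= t & f (y + t *: v) - f y = t * 'D_v f (y + s *: v).
Proof.
move=> t0 df.
have D s : 0 <= s <= t -> is_derive s (1 : R) (fun s : R => f (y + s *: v))
    ('D_v f (y + s *: v)) by move=> /df /is_derive_line.
have [||s] := @MVT_segment R (fun s => f (y + s *: v))
  (fun s => 'D_v f (y + s *: v)) 0 t (ltW t0).
- by move=> s; rewrite in_itv /= => /andP[s0 st]; apply: D; rewrite !ltW.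
- apply: derivable_within_continuous => s; rewrite in_itv /= => st.
  by have [] := D s st.
rewrite in_itv /= subr0 scale0r addr0 => st E.
by exists s; rewrite // E mulrC.
Qed.

(** The mean value theorem is used twice: in direction [a] for [f (y + t *: e_ b) - f y], then in
    direction [b] for the derivative of [f] along [a]. Continuity of the mixed derivative does the
    rest. *)
Lemma second_difference U f x a b : open U -> Ck 2 U f -> U x ->
  forall e : R, 0 < e -> exists2 d : R, 0 < d & forall t : R, 0 < t < d ->
  `|f (x + t *: e_ a + t *: e_ b) - f (x + t *: e_ a)
    - (f (x + t *: e_ b) - f x)
    - t ^+ 2 * 'D_(e_ b) (fun y => 'D_(e_ a) f y) x| <= t ^+ 2 * e.
Proof.
move=> oU Hf Ux e e0.
have /cvgrPdist_lt /(_ e e0) C := Ck_continuous (Ck_derive b (Ck_derive a Hf)) Ux.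
have : \forall y \near x, U y /\ `|'D_(e_ b) (fun y => 'D_(e_ a) f y) x
    - 'D_(e_ b) (fun y => 'D_(e_ a) f y) y| < e.
  exact: filterI (open_nbhs_nbhs (conj oU Ux)) C.
move/near_rvP => [d d0 Hd].
(* When [a = b] the two displacements add up in one coordinate, so each has to stay below half of
   [d]. *)
exists (d / 2); first by rewrite divr_gt0.
move=> t /andP[t0 td].
have near_pt (s1 s2 : R) : 0 <= s1 <= t -> 0 <= s2 <= t ->
    forall c, `|(x + s1 *: e_ a + s2 *: e_ b) 0 c - x 0 c| < d.
  move=> /andP[s10 s1t] /andP[s20 s2t] c; rewrite !mxE eqxx /=.
  rewrite (_ : _ - _ = s1 * (c == a)%:R + s2 * (c == b)%:R); last by ring.
  rewrite ger0_norm; last by case: eqP; case: eqP; rewrite ?mulr1 ?mulr0 ?addr0 ?add0r ?addr_ge0.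
  apply: (@le_lt_trans _ _ (s1 + s2)); last by lra.
  by apply: lerD; case: eqP => _; rewrite ?mulr1 ?mulr0.
have tt : 0 <= t <= t by rewrite lexx ltW.
have zt : (0 : R) <= 0 <= t by rewrite lexx ltW.
pose F y := f (y + t *: e_ b) - f y.
have Fd s : 0 <= s <= t -> is_derive (x + s *: e_ a) (e_ a) F
    ('D_(e_ a) f (x + s *: e_ a + t *: e_ b) - 'D_(e_ a) f (x + s *: e_ a)).
  move=> st; have [U1 _] := Hd _ (near_pt s t st tt).
  have [U0 _] := Hd _ (near_pt s 0 st zt); rewrite scale0r addr0 in U0.
  have d1 : derivable f (x + s *: e_ a + t *: e_ b) (e_ a).
    exact: Ck_derivable Hf U1.
  have d0' : derivable f (x + s *: e_ a) (e_ a) by exact: Ck_derivable Hf U0.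
  apply: is_deriveB; last exact: derivableP.
  exact: is_derive_translate.
have [s st E] := @mvt_line F x (e_ a) t t0 (fun s st => @ex_derive _ _ _ _ _ _ _ (Fd s st)).
have [_ DF] := Fd s st; rewrite DF in E.
have [|r rt E2] := @mvt_line (fun y => 'D_(e_ a) f y) (x + s *: e_ a) (e_ b) t t0 _.
  move=> r rt; have [U1 _] := Hd _ (near_pt s r st rt).
  exact: Ck_derivable (Ck_derive a Hf) U1.
rewrite E2 /F in E; rewrite E mulrA -expr2 -mulrBr normrM ger0_norm ?sqr_ge0 //.
rewrite ler_wpM2l ?sqr_ge0 // distrC.
by have [_ /ltW] := Hd _ (near_pt s r st rt).
Qed.

(** The second difference is symmetric in [a] and [b], and both mixed derivatives are its limit
    after division by [t ^+ 2]. *)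
Lemma schwarz U f x a b : open U -> Ck 2 U f -> U x ->
  'D_(e_ b) (fun y => 'D_(e_ a) f y) x = 'D_(e_ a) (fun y => 'D_(e_ b) f y) x.
Proof.
move=> oU Hf Ux; apply/eqP; rewrite -subr_eq0 -normr_le0.
apply/ler_addgt0Pr => e e0; rewrite add0r.
have e20 : 0 < e / 2 by rewrite divr_gt0.
have [d1 d10 H1] := second_difference a b oU Hf Ux e20.
have [d2 d20 H2] := second_difference b a oU Hf Ux e20.
pose t := Num.min d1 d2 / 2.
have m0 : 0 < Num.min d1 d2 by rewrite lt_min d10.
have t0 : 0 < t by rewrite divr_gt0.
have t1 : 0 < t < d1.
  by rewrite t0 ltr_pdivrMr // (@le_lt_trans _ _ d1) ?ge_min ?lexx // ltr_pMr // ltr1n.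
have t2 : 0 < t < d2.
  by rewrite t0 ltr_pdivrMr // (@le_lt_trans _ _ d2) ?ge_min ?lexx ?orbT // ltr_pMr // ltr1n.
have t20 : 0 < t ^+ 2 by rewrite exprn_gt0.
rewrite -(ler_pM2l t20).
have := H1 t t1; have := H2 t t2.
rewrite [x + t *: e_ b + _]addrAC.
set A := f (x + t *: e_ a + t *: e_ b); set B := f (x + t *: e_ a).
set C := f (x + t *: e_ b); set D1 := 'D_(e_ a) _ x; set D2 := 'D_(e_ b) _ x => G1 G2.
rewrite -{1}(ger0_norm (ltW t20)) -normrM mulrBr.
have -> : t ^+ 2 * D2 - t ^+ 2 * D1 =
   (A - C - (B - f x) - t ^+ 2 * D1) - (A - B - (C - f x) - t ^+ 2 * D2) by ring.
apply: le_trans (ler_normB _ _) _.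
apply: le_trans (lerD G1 G2) _.
by rewrite -mulrDr -splitr.
Qed.
End Ck_calculus.

(** * Calculus up to the boundary of the half space *)

Section smooth_calculus.
Context (R : realType) (n : nat).
Notation V := 'rV[R]_n.+1.
Implicit Types (f g : V -> R) (A B U : set V).
Notation e_ := (basisv R).
Notation half := (@halfspace R n).

(** Relative openness in the half space: the form of chart images, and what makes [pder] depend only
    on values inside [A]. *)
Definition ropen A := A `<=` half /\
  forall x, A x -> \forall y \near x, half y -> A y.

Lemma half_dir (x : V) (a : 'I_n.+1) (h : R) : half x -> 0 <= h ->
  half (x + h *: e_ a).
Proof.
rewrite /halfspace /= !mxE eqxx /= => x0 h0.
by rewrite addr_ge0 // mulr_ge0.
Qed.

(** Small positive [h] stay in the half space for every direction [a], so the limit defining [pder]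
    is over a proper filter also at boundary points. *)
Lemma within_dir_proper (x : V) (a : 'I_n.+1) : half x ->
  ProperFilter (within [set h : R | half (x + h *: e_ a)] 0^').
Proof.
move=> hx; apply: Build_ProperFilter_ex => P.
rewrite /within /= => H.
have [e /= e0 He] : nbhs_ball (0 : R) [set h | h != 0 -> half (x + h *: e_ a) -> P h].
  by apply/nbhs_ballP; move: H; rewrite /dnbhs /within.
exists (e / 2); apply: He.
- by rewrite /ball /= sub0r normrN gtr0_norm ?divr_gt0 // ltr_pdivrMr // ltr_pMr // ltr1n.
- by rewrite gt_eqF // divr_gt0.
- by apply: half_dir => //; rewrite divr_ge0 // ltW.
Qed.

Lemma near_within_dnbhs (S : set R) (F G : R -> R) :
  (\forall h \near (0 : R), h != 0 -> S h -> F h = G h) ->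
  {near within S 0^', F =1 G}.
Proof. by []. Qed.

Lemma near_dir (x : V) (a : 'I_n.+1) (P : set V) : (\forall y \near x, P y) ->
  \forall h \near (0 : R), P (x + h *: e_ a).
Proof.
move=> N; have C : x + h *: e_ a @[h --> (0 : R)] --> x + 0 *: e_ a.
  by apply: cvgD; [exact: cvg_cst | apply: cvgZr_tmp; exact: cvg_id].
rewrite scale0r addr0 in C.
exact: C.
Qed.

(** The two-sided limit for [g] restricts to the admissible [h], where the difference quotients of
    [f] and [g] coincide. Thus any extension computes [pder]. *)
Lemma pder_ext f g x a : half x -> derivable g x (e_ a) ->
  (\forall y \near x, half y -> f y = g y) -> pder a f x = 'D_(e_ a) g x.
Proof.
move=> hx dg fg.
have PF := within_dir_proper a hx.
apply: cvg_lim => //.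
apply: (@cvg_trans _ ((fun h : R => h^-1 *: ((g \o shift x) (h *: e_ a) - g x)) @
    within [set h : R | half (x + h *: e_ a)] 0^')); last first.
  have dg' : h^-1 *: ((g \o shift x) (h *: e_ a) - g x) @[h --> 0^'] -->
      'D_(e_ a) g x by exact: dg.
  apply: cvg_trans dg'; apply: cvg_app; exact: cvg_within.
apply/near_eq_cvg/near_within_dnbhs.
have fgx : f x = g x by apply: (nbhs_singleton fg).
apply: filterS (near_dir a fg) => h Hh _ hh /=.
by rewrite fgx Hh // [h *: _ + x]addrC.
Qed.

Lemma near_half_eq A f g x : ropen A -> A x -> {in A, f =1 g} ->
  \forall y \near x, half y -> f y = g y.
Proof.
move=> [_ oA] Ax fg; apply: filterS (oA x Ax) => y H hy.
by apply: fg; rewrite inE; exact: H.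
Qed.

Lemma pder_eq A f g x a : ropen A -> A x -> {in A, f =1 g} ->
  pder a f x = pder a g x.
Proof.
move=> oA Ax fg; have N := near_half_eq oA Ax fg.
have hx : half x by case: oA => sA _; exact: sA.
have fgx : f x = g x by apply: fg; rewrite inE.
have PF := within_dir_proper a hx.
have N' := near_dir a N.
rewrite /pder; congr lim; rewrite eqEsubset; split; apply/near_eq_cvg/near_within_dnbhs;
  by apply: filterS N' => h Hh _ hh /=; rewrite fgx Hh.
Qed.

Lemma smooth_on_sub A B f : B `<=` A -> smooth_on A f -> smooth_on B f.
Proof.
move=> BA H x /BA Ax; have [U [g [oU Ux Hg fg]]] := H x Ax.
by exists U, g; split=> // y Uy /BA; exact: fg.
Qed.

Lemma smooth_ext A f x : ropen A -> smooth_on A f -> A x ->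
  exists (U : set V) (g : V -> R), [/\ open U, U x, forall k, Ck k U g,
    U `&` half `<=` A & forall y, U y -> half y -> f y = g y].
Proof.
move=> [sA oA] Hf Ax; have [U [g [oU Ux Hg fg]]] := Hf x Ax.
have : nbhs x (fun y => half y -> A y) := oA x Ax.
rewrite nbhsE => -[U' [oU' U'x] HU'].
exists (U `&` U'), g; split=> //.
- exact: openI.
- by move=> k; apply: Ck_sub (Hg k) => y [].
- by move=> y [[_ /HU']]; apply.
- by move=> y [Uy /HU' H] hy; apply: fg => //; exact: H.
Qed.

Lemma pder_extE A f x : ropen A -> smooth_on A f -> A x ->
  exists (U : set V) (g : V -> R), [/\ open U, U x, forall k, Ck k U g,
    U `&` half `<=` A & forall y, U y -> half y -> f y = g y /\
      forall a, pder a f y = 'D_(e_ a) g y].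
Proof.
move=> oA Hf Ax; have [U [g [oU Ux Hg UA fg]]] := smooth_ext oA Hf Ax.
exists U, g; split=> // y Uy hy; split; first exact: fg.
move=> a; apply: pder_ext => //; first exact: Ck_derivable (Hg 1) Uy.
by apply: filterS (open_nbhs_nbhs (conj oU Uy)) => z Uz hz; exact: fg.
Qed.

Lemma smooth_on_pder A f a : ropen A -> smooth_on A f -> smooth_on A (pder a f).
Proof.
move=> oA Hf x Ax; have [U [g [oU Ux Hg UA fg]]] := pder_extE oA Hf Ax.
exists U, (fun y => 'D_(e_ a) g y); split=> // [k|y Uy Ay].
  exact: Ck_derive (Hg k.+1).
by case: oA => sA _; have [_] := fg y Uy (sA y Ay).
Qed.

Lemma eq_smooth_on A f g : {in A, f =1 g} -> smooth_on A f -> smooth_on A g.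
Proof.
move=> fg Hf x Ax; have [U [h [oU Ux Hh fh]]] := Hf x Ax.
by exists U, h; split=> // y Uy Ay; rewrite -fg ?inE // fh.
Qed.

Lemma smooth_on_cst A (c : R) : smooth_on A (fun=> c).
Proof.
move=> x Ax; exists setT, (fun=> c); split=> //; first exact: openT.
by move=> k; exact: Ck_cst.
Qed.

Lemma smooth_on2 A (op : R -> R -> R) f g :
  (forall k U f g, open U -> Ck k U f -> Ck k U g ->
     Ck k U (fun x : V => op (f x) (g x))) ->
  smooth_on A f -> smooth_on A g -> smooth_on A (fun x => op (f x) (g x)).
Proof.
move=> Hop Hf Hg x Ax; have [U [f' [oU Ux Cf ff]]] := Hf x Ax.
have [U' [g' [oU' U'x Cg gg]]] := Hg x Ax.
have oI : open (U `&` U') by exact: openI.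
exists (U `&` U'), (fun x => op (f' x) (g' x)); split=> //.
  move=> k; apply: Hop => //; first by apply: Ck_sub (Cf k) => y [].
  by apply: Ck_sub (Cg k) => y [].
by move=> y [Uy U'y] Ay; rewrite ff // gg.
Qed.

Lemma smooth_onD A f g : smooth_on A f -> smooth_on A g ->
  smooth_on A (fun x => f x + g x).
Proof. by apply: (@smooth_on2 A +%R) => k U f' g' oU; exact: CkD. Qed.

Lemma smooth_onM A f g : smooth_on A f -> smooth_on A g ->
  smooth_on A (fun x => f x * g x).
Proof. by apply: (@smooth_on2 A *%R) => k U f' g' oU; exact: CkM. Qed.

Lemma smooth_onN A f : smooth_on A f -> smooth_on A (fun x => - f x).
Proof.
move=> Hf; apply: (@eq_smooth_on A (fun x => -1 * f x)).
  by move=> x _; rewrite mulN1r.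
by apply: smooth_onM => //; exact: smooth_on_cst.
Qed.

Lemma smooth_onB A f g : smooth_on A f -> smooth_on A g ->
  smooth_on A (fun x => f x - g x).
Proof. by move=> Hf Hg; apply: smooth_onD => //; exact: smooth_onN. Qed.

Lemma smooth_on_sum A (I : Type) (r : seq I) (P : pred I) (f : I -> V -> R) :
  (forall i, smooth_on A (f i)) ->
  smooth_on A (fun x => \sum_(i <- r | P i) f i x).
Proof.
move=> H; elim: r => [|i r IH].
  by under eq_fun do rewrite big_nil; exact: smooth_on_cst.
under eq_fun do rewrite big_cons.
by case: (P i) => //; exact: smooth_onD.
Qed.

Lemma smooth_on_prod A (I : Type) (r : seq I) (P : pred I) (f : I -> V -> R) :
  (forall i, smooth_on A (f i)) ->
  smooth_on A (fun x => \prod_(i <- r | P i) f i x).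
Proof.
move=> H; elim: r => [|i r IH].
  by under eq_fun do rewrite big_nil; exact: smooth_on_cst.
under eq_fun do rewrite big_cons.
by case: (P i) => //; exact: smooth_onM.
Qed.

Lemma smooth_on_det A m (F : V -> 'M[R]_m) :
  (forall i j, smooth_on A (fun x => F x i j)) ->
  smooth_on A (fun x => \det (F x)).
Proof.
move=> H; rewrite /determinant; apply: smooth_on_sum => s.
by apply: smooth_onM; [exact: smooth_on_cst | exact: smooth_on_prod].
Qed.

Lemma smooth_on_within_cvg A f x : smooth_on A f -> A x ->
  f y @[y --> within A (nbhs x)] --> f x.
Proof.
move=> Hf Ax; have [U [g [oU Ux Hg fg]]] := Hf x Ax.
rewrite (fg x Ux Ax).
apply: (@cvg_trans _ (g @ within A (nbhs x))).
  apply: near_eq_cvg.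
  suff : \forall y \near x, A y -> g y = f y by [].
  by apply: filterS (open_nbhs_nbhs (conj oU Ux)) => y Uy Ay /=; rewrite fg.
by apply: cvg_within_filter; exact: (Ck_continuous (Hg 0%N) Ux).
Qed.

Lemma smooth_on_powR A f (r : R) : (forall x, A x -> f x != 0) ->
  smooth_on A f -> smooth_on A (fun x => `|f x| `^ r).
Proof.
move=> f0 Hf x Ax; have [U [g [oU Ux Hg fg]]] := Hf x Ax.
have gx0 : g x != 0 by rewrite -fg ?f0.
(* The extension [g] may vanish away from [x]. Near [x] the product [s * g] is positive, so the
   absolute value can be replaced by it and [Ck_powR] applies. *)
pose s : R := Num.sg (g x).
have Hsg k : Ck k U (fun y => s * g y) by apply: CkM => //; exact: Ck_cst.
have sgx : 0 < s * g x by rewrite /s -normrEsg normr_gt0.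
have N : \forall y \near x, 0 < s * g y.
  have C := Ck_continuous (Hsg 0%N) Ux.
  exact: (C [set t | 0 < t] (lt_nbhsr sgx)).
have : nbhs x (U `&` (fun y => 0 < s * g y)).
  exact: filterI (open_nbhs_nbhs (conj oU Ux)) N.
rewrite nbhsE.
move=> [U' [oU' U'x] HU'].
exists U', (fun y => (s * g y) `^ r); split=> //.
  move=> k; apply: Ck_powR => // [y /HU' []//|].
  by apply: Ck_sub (Hsg k) => y /HU' [].
move=> y /HU' [Uy sy] Ay; rewrite fg //; congr (_ `^ _).
by rewrite -(gtr0_norm sy) normrM normr_sg gx0 mul1r.
Qed.

Section rules.
Variables (A : set V) (x : V).
Hypotheses (oA : ropen A) (Ax : A x).

Let hx : half x. Proof. by case: oA => sA _; exact: sA. Qed.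

(** Turns [pder] at [x] into an honest derivative of an extension, so that the rules below reduce to
    those of [is_derive]. *)
Lemma is_derive_ext f : smooth_on A f ->
  exists g, [/\ \forall y \near x, half y -> f y = g y,
    {for x, continuous g} & forall a, is_derive x (e_ a) g (pder a f x)].
Proof.
move=> Hf; have [U [g [oU Ux Hg UA fg]]] := pder_extE oA Hf Ax.
exists g; split.
- by apply: filterS (open_nbhs_nbhs (conj oU Ux)) => y Uy hy; have [] := fg y Uy hy.
- exact: Ck_continuous (Hg 0%N) Ux.
move=> a; have [_ ->] := fg x Ux hx.
by apply: derivableP; exact: Ck_derivable (Hg 1) Ux.
Qed.

Lemma pder_is_derive f g a (d : R) : (\forall y \near x, half y -> f y = g y) ->
  is_derive x (e_ a) g d -> pder a f x = d.
Proof. by move=> fg [dg <-]; exact: pder_ext. Qed.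

Lemma pder_cst (c : R) a : pder a (fun=> c) x = 0.
Proof.
apply: (pder_is_derive _ (is_derive_const c x (e_ a))).
by apply: filterS filterT => y.
Qed.

Lemma pderD f g a : smooth_on A f -> smooth_on A g ->
  pder a (fun y => f y + g y) x = pder a f x + pder a g x.
Proof.
move=> /is_derive_ext [f' [ff _ df]] /is_derive_ext [g' [gg _ dg]].
apply: pder_is_derive (is_derive_add (df a) (dg a)).
by apply: filterS2 ff gg => y H1 H2 hy; rewrite H1 // H2.
Qed.

Lemma pderM f g a : smooth_on A f -> smooth_on A g ->
  pder a (fun y => f y * g y) x = pder a f x * g x + f x * pder a g x.
Proof.
move=> /is_derive_ext [f' [ff _ df]] /is_derive_ext [g' [gg _ dg]].
rewrite (nbhs_singleton ff hx) (nbhs_singleton gg hx).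
apply: pder_is_derive (is_derive_mul (df a) (dg a)).
by apply: filterS2 ff gg => y H1 H2 hy; rewrite H1 // H2.
Qed.

Lemma pderMl (c : R) f a : smooth_on A f ->
  pder a (fun y => c * f y) x = c * pder a f x.
Proof.
move=> Hf; rewrite pderM //; last exact: smooth_on_cst.
by rewrite pder_cst mul0r add0r.
Qed.

Lemma pderN f a : smooth_on A f -> pder a (fun y => - f y) x = - pder a f x.
Proof.
move=> Hf; rewrite -mulN1r -pderMl //.
by congr pder; apply/funext => y; rewrite mulN1r.
Qed.

Lemma pderB f g a : smooth_on A f -> smooth_on A g ->
  pder a (fun y => f y - g y) x = pder a f x - pder a g x.
Proof. by move=> Hf Hg; rewrite pderD ?pderN //; exact: smooth_onN. Qed.

Lemma pder_sum (I : Type) (r : seq I) (P : pred I) (f : I -> V -> R) a :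
  (forall i, smooth_on A (f i)) ->
  pder a (fun y => \sum_(i <- r | P i) f i y) x =
  \sum_(i <- r | P i) pder a (f i) x.
Proof.
move=> H; elim: r => [|i r IH].
  by under eq_fun do rewrite big_nil; rewrite big_nil pder_cst.
under eq_fun do rewrite big_cons.
rewrite big_cons; case: (P i) => //.
by rewrite pderD ?IH //; exact: smooth_on_sum.
Qed.

Lemma pder_coord (b : 'I_n.+1) a : pder a (fun y : V => y 0 b) x = (b == a)%:R.
Proof.
have L : (fun h : R => h^-1 * ((x + h *: e_ a) 0 b - x 0 b)) @
    within [set h : R | half (x + h *: e_ a)] 0^' --> ((b == a)%:R : R).
  apply: (@cvg_trans _ ((fun=> (b == a)%:R : R) @
     within [set h : R | half (x + h *: e_ a)] 0^')).
    apply/near_eq_cvg/near_within_dnbhs.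
    apply: filterS filterT => h _ h0 _ /=.
    by rewrite !mxE eqxx /= addrAC subrr add0r mulKf.
  have PF := within_dir_proper a hx.
  exact: cvg_cst.
have PF := within_dir_proper a hx.
exact: cvg_lim L.
Qed.

Lemma pder_comm f a b : smooth_on A f ->
  pder a (pder b f) x = pder b (pder a f) x.
Proof.
move=> Hf; have [U [g [oU Ux Hg UA fg]]] := pder_extE oA Hf Ax.
have N c : \forall y \near x, half y -> pder c f y = 'D_(e_ c) g y.
  by apply: filterS (open_nbhs_nbhs (conj oU Ux)) => y Uy hy; have [_] := fg y Uy hy.
rewrite (pder_ext hx _ (N b)); last exact: Ck_derivable (Ck_derive b (Hg 2)) Ux.
rewrite (pder_ext hx _ (N a)); last exact: Ck_derivable (Ck_derive a (Hg 2)) Ux.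
exact: schwarz oU (Hg 2%N) Ux.
Qed.

Lemma pder_comp B f (phi : V -> V) a : ropen B -> smooth_on B f -> B (phi x) ->
  (forall b, smooth_on A (fun y => phi y 0 b)) -> (forall y, A y -> half (phi y)) ->
  pder a (fun y => f (phi y)) x =
  \sum_b pder a (fun y => phi y 0 b) x * pder b f (phi x).
Proof.
move=> oB Hf Bx Hphi hphi.
have [U [g [oU Ux Hg UB fg]]] := pder_extE oB Hf Bx.
have /choice [p Hp] := fun b => is_derive_ext (Hphi b).
(* The extension [P] of [phi] may leave the half space, so it is composed with the extension [g] of
   [f] rather than with [f]. *)
pose P (y : V) : V := \row_b p b y.
have Px : P x = phi x.
  by apply/rowP => b; rewrite mxE; have [H _ _] := Hp b; rewrite (nbhs_singleton H hx).
have NP : \forall y \near x, half y -> phi y = P y.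
  have : \forall y \near x, forall b, half y -> phi y 0 b = p b y.
    apply: (@filter_forall V _ (fun b y => half y -> phi y 0 b = p b y) (nbhs x)) => b.
    by have [] := Hp b.
  by apply: filterS => y H hy; apply/rowP => b; rewrite mxE H.
have D : is_derive x (e_ a) (fun y => g (P y))
   (\sum_b pder a (fun y => phi y 0 b) x * 'D_(e_ b) g (P x)).
  apply: (Ck_chain_rule oU (Hg 1%N)); first by rewrite Px.
  move=> b; under eq_fun do rewrite mxE.
  by have [_ _] := Hp b; apply.
have hpx : half (phi x) by exact: hphi.
rewrite (pder_is_derive _ D).
  by apply: eq_bigr => b _; rewrite Px; have [_ ->] := fg _ Ux hpx.
have NU : \forall y \near x, U (P y).
  have C : {for x, continuous P}.
    apply: (@cvg_rv _ _ _ (nbhs x) _) => b; rewrite mxE.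
    by under eq_fun do rewrite mxE; have [] := Hp b.
  have : nbhs (P x) U by rewrite Px; exact: open_nbhs_nbhs.
  by move=> /C.
case: oA => _ /(_ x Ax) NA.
near=> y => hy.
have Ay : A y by apply: (near NA y).
have E : phi y = P y by apply: (near NP y).
have UP : U (P y) by near: y.
by rewrite E; have [] := fg _ UP; rewrite // -E; exact: hphi.
Unshelve. all: by end_near. Qed.

End rules.
End smooth_calculus.

Section smooth_more.
Context (R : realType) (n : nat).
Notation V := 'rV[R]_n.+1.
Implicit Types (f g : V -> R) (A B U : set V).
Notation e_ := (basisv R).
Notation half := (@halfspace R n).

Lemma smooth_on_comp A B f (phi : V -> V) : smooth_on B f ->
  (forall x, A x -> B (phi x)) -> (forall b, smooth_on A (fun x => phi x 0 b)) ->
  smooth_on A (fun x => f (phi x)).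
Proof.
move=> Hf AB Hphi x Ax.
have [U [g [oU Ux Hg fg]]] := Hf _ (AB x Ax).
have /choice [p Hp] : forall b, exists p : set V * (V -> R),
    [/\ open p.1, p.1 x, forall k, Ck k p.1 p.2
      & forall y, p.1 y -> A y -> phi y 0 b = p.2 y].
  by move=> b; have [W [q H]] := Hphi b x Ax; exists (W, q).
pose P (y : V) : V := \row_b (p b).2 y.
have Px : P x = phi x.
  by apply/rowP => b; rewrite mxE; have [_ Wx _ H] := Hp b; rewrite H.
have cP : {for x, continuous P}.
  apply: (@cvg_rv _ _ _ (nbhs x) _) => b; rewrite mxE.
  under eq_fun do rewrite mxE.
  by have [_ Wx H _] := Hp b; exact: (Ck_continuous (H 0%N) Wx).
have NU : \forall y \near x, U (P y).
  have : nbhs (P x) U by rewrite Px; exact: open_nbhs_nbhs.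
  by move=> /cP.
have NW : \forall y \near x, forall b, (p b).1 y.
  apply: (@filter_forall V _ (fun b y => (p b).1 y) (nbhs x)) => b.
  by have [oW Wx _ _] := Hp b; exact: open_nbhs_nbhs.
have : nbhs x (fun y => U (P y) /\ forall b, (p b).1 y) by exact: filterI NU NW.
rewrite nbhsE => -[W [oW Wx] HW].
exists W, (fun y => g (P y)); split=> //.
  move=> k; apply: (Ck_comp oW oU _ _ (Hg k)) => [y /HW []//|b].
  under eq_fun do rewrite mxE.
  have [_ _ H _] := Hp b; apply: Ck_sub (H k) => y /HW [_]; exact.
move=> y /HW [UP Wy] Ay.
have E : phi y = P y.
  by apply/rowP => b; rewrite mxE; have [_ _ _ ->] := Hp b.
by rewrite E; apply: fg; rewrite // -E; exact: AB.
Qed.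

Lemma derive_along_curve A f (c : R -> V) (dc : 'I_n.+1 -> R) (t : R) :
  ropen A -> smooth_on A f -> A (c t) -> (\forall s \near t, A (c s)) ->
  (forall b, is_derive t (1 : R) (fun s => c s 0 b) (dc b)) ->
  is_derive t (1 : R) (fun s => f (c s)) (\sum_b dc b * pder b f (c t)).
Proof.
move=> oA Hf Act NA Hc.
have [U [g [oU Ux Hg UA fg]]] := pder_extE oA Hf Act.
have sA : A `<=` half by case: oA.
have D := Ck_chain_rule oU (Hg 1%N) Ux Hc.
have -> : \sum_b dc b * pder b f (c t) = \sum_b dc b * 'D_(e_ b) g (c t).
  by apply: eq_bigr => b _; have [_ ->] := fg _ Ux (sA _ Act).
apply: near_eq_is_derive D.
have cc : {for t, continuous c}.
  apply: (@cvg_rv _ _ _ (nbhs t) _) => b.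
  have [Hd _] := Hc b.
  exact: (differentiable_continuous ((derivable1_diffP _ _).1 Hd)).
have NU : \forall s \near t, U (c s).
  have : nbhs (c t) U by exact: open_nbhs_nbhs.
  by move=> /cc.
apply: filterS2 NA NU => s As Us.
by have [-> _] := fg _ Us (sA _ As).
Qed.

(** Every point of [A] is the limit of the interior points [x + h *: e_ 0] as [h] decreases to 0.
    All passages from the interior to the boundary go through this lemma. *)
Lemma smooth_eq_closure A f g x : ropen A -> smooth_on A f -> smooth_on A g ->
  (forall y, A y -> 0 < y 0 0 -> f y = g y) -> A x -> f x = g x.
Proof.
move=> oA Hf Hg fg Ax; apply/eqP; rewrite -subr_eq0; apply/eqP.
have [U [q [oU Ux Hq UA Eq]]] := smooth_ext oA (smooth_onB Hf Hg) Ax.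
have hx : half x by case: oA => sA _; exact: sA.
rewrite (Eq x Ux hx).
have Cq := Ck_continuous (Hq 0%N) Ux.
have L : q (x + h *: e_ 0) @[h --> (0 : R)^'+] --> q x.
  apply: cvg_at_right_filter.
  apply: (@cvg_comp _ _ _ (fun h : R => x + h *: e_ 0) q _ (nbhs x)) => //.
  move=> P /(near_dir (0 : 'I_n.+1)); apply.
have L0 : q (x + h *: e_ 0) @[h --> (0 : R)^'+] --> (0 : R).
  apply: (@cvg_trans _ ((fun=> (0 : R)) @ (0 : R)^'+)); last exact: cvg_cst.
  apply: near_eq_cvg.
  have NU := near_dir (0 : 'I_n.+1) (open_nbhs_nbhs (conj oU Ux)).
  suff : \forall h \near (0 : R), 0 < h -> 0 = q (x + h *: e_ 0) by [].
  apply: filterS NU => h Uh h0.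
  have hh : half (x + h *: e_ 0) by apply: half_dir => //; exact: ltW.
  rewrite -Eq // fg ?subrr //; first exact: UA.
  by rewrite !mxE eqxx /= mulr1 ltr_wpDl.
exact: cvg_unique L L0.
Qed.

Lemma pder_interior_min A f x a : ropen A -> smooth_on A f -> A x ->
  0 < x 0 0 -> (forall y, A y -> f x <= f y) -> pder a f x = 0.
Proof.
move=> oA Hf Ax x0 fmin.
have [U [g [oU Ux Hg UA fg]]] := pder_extE oA Hf Ax.
have hx : half x by exact: ltW.
have [fgx ->] := fg x Ux hx.
have N0 : \forall y \near x, 0 < (y : V) 0 0.
  have C := @coord_continuous R 1 n.+1 0 0 x.
  exact: (C [set t | 0 < t] (lt_nbhsr x0)).
have : nbhs (0 : R) (fun h => (U `&` (fun y : V => 0 < y 0 0)) (x + h *: e_ a)).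
  exact: near_dir (filterI (open_nbhs_nbhs (conj oU Ux)) N0).
move/nbhs_ballP => [d /= d0 Hd].
have Hd' (t : R) : t \in `](- d), d[ -> U (x + t *: e_ a) /\ half (x + t *: e_ a).
  rewrite in_itv /= => /andP[t1 t2].
  have [] : (U `&` (fun y : V => 0 < y 0 0)) (x + t *: e_ a).
    by apply: Hd; rewrite /ball /= sub0r normrN ltr_norml t1.
  by move=> Ut /ltW; split.
have D t : t \in `](- d), d[ -> is_derive t (1 : R) (fun s : R => g (x + s *: e_ a))
    ('D_(e_ a) g (x + t *: e_ a)).
  by move=> /Hd' [Ut _]; apply: is_derive_line; exact: Ck_derivable (Hg 1%N) Ut.
have z : (0 : R) \in `](- d), d[ by rewrite in_itv /= oppr_lt0 d0.
have [||||_ D0] := @derive1_at_min R (fun s : R => g (x + s *: e_ a)) (- d) d 0.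
- by rewrite ge0_cp // ltW.
- by move=> t /D [].
- exact: z.
- move=> t td; have [Ut ht] := Hd' t td.
  rewrite scale0r addr0 -fgx; have [<- _] := fg _ Ut ht.
  by apply: fmin; exact: UA.
by have [_] := D 0 z; rewrite D0 scale0r addr0.
Qed.
End smooth_more.

(** * Charts *)

Section charts.
Context (R : realType) (n : nat) (M : bmanifold R n).
Notation V := 'rV[R]_n.+1.
Notation half := (@halfspace R n).
Implicit Types (i j : idx M) (p : M) (U : set M).

Lemma crdP U i x : crd U i x ->
  [/\ dom i (chartV i x), U (chartV i x) & chart i (chartV i x) = x].
Proof. by move=> [p [dp Up] <-]; rewrite chartK. Qed.

Lemma crd_sub (U U' : set M) i : U `<=` U' -> crd U i `<=` crd U' i.
Proof. by move=> s x [p [dp /s Up] <-]; exists p. Qed.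

Lemma chart_half i p : dom i p -> half (chart i p).
Proof.
move=> dp; have [W _ E] := chart_image_open i.
have : (chart i @` dom i) (chart i p) by exists p.
by rewrite E => -[].
Qed.

Lemma crd_ropen U i : open U -> ropen (crd U i).
Proof.
move=> oU; split=> [x [p [dp _] <-]|x [p [dp Up] <-]]; first exact: chart_half.
have [W oW E] := chart_image_open i.
have Wx : W (chart i p).
  have : (chart i @` dom i) (chart i p) by exists p.
  by rewrite E => -[].
have xi : (chart i @` dom i) (chart i p) by exists p.
have NU : nbhs (chartV i (chart i p)) (dom i `&` U).
  rewrite chartK //; apply: open_nbhs_nbhs; split=> //.
  by apply: openI => //; exact: dom_open.
have := @chartV_continuous _ _ M i; move/subspace_continuousP => /(_ _ xi) C.
have N : \forall y \near chart i p, (chart i @` dom i) y ->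
    (dom i `&` U) (chartV i y) by exact: (C _ NU).
apply: filterS2 (open_nbhs_nbhs (conj oW Wx)) N => y Wy Hy hy.
have yi : (chart i @` dom i) y by rewrite E.
have := Hy yi; case: yi => q dq <-; rewrite chartK // => -[_ Uq].
by exists q.
Qed.

Lemma trans_half i j x : crd (dom j) i x -> half (chart j (chartV i x)).
Proof. by move=> /crdP [_ dj _]; exact: chart_half. Qed.

Lemma trans_smooth i j b : smooth_on (crd (dom j) i)
  (fun x => chart j (chartV i x) 0 b).
Proof. exact: transition_smooth. Qed.

Lemma jac_smooth i j a b : smooth_on (crd (dom j) i) (fun x => jac i j x a b).
Proof.
have oA : ropen (crd (dom j) i) by apply: crd_ropen; exact: dom_open.
apply: (eq_smooth_on _ (smooth_on_pder a oA (@trans_smooth i j b))).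
by move=> x _; rewrite mxE.
Qed.

Lemma pder_trans i j f p a U : open U -> smooth_on (crd U j) f ->
  dom i p -> dom j p -> U p ->
  pder a (fun y => f (chart j (chartV i y))) (chart i p) =
  \sum_b jac i j (chart i p) a b * pder b f (chart j p).
Proof.
move=> oU Hf dip djp Up.
have oA : ropen (crd (dom j) i) by apply: crd_ropen; exact: dom_open.
have Ax : crd (dom j) i (chart i p) by exists p.
have Bx : crd U j (chart j (chartV i (chart i p))) by rewrite chartK //; exists p.
rewrite (pder_comp oA Ax (phi := fun y => chart j (chartV i y)) a (crd_ropen j oU)
  Hf Bx (@trans_smooth i j)); last by move=> y /trans_half.
by rewrite chartK //; apply: eq_bigr => b _; rewrite mxE.
Qed.

Lemma jac_mul i j p : dom i p -> dom j p ->
  jac i j (chart i p) *m jac j i (chart j p) = 1%:M.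
Proof.
move=> dip djp; apply/matrixP => a b; rewrite mxE [RHS]mxE eq_sym.
have oA : ropen (crd (dom j) i) by apply: crd_ropen; exact: dom_open.
have Ax : crd (dom j) i (chart i p) by exists p.
(* The Kronecker delta is the derivative of the coordinate [b], which is then rewritten as the
   transition from [i] to [j] followed by the one back. *)
have <- := pder_coord oA Ax b a.
rewrite (pder_eq (g := fun y => chart i (chartV j (chart j (chartV i y))) 0 b) a oA Ax).
  rewrite (pder_trans a (dom_open i) (@trans_smooth j i b) dip djp dip).
  by apply: eq_bigr => c _; rewrite [jac j i _ _ _]mxE.
move=> y; rewrite inE => /crdP [di dj E] /=.
by rewrite (chartK dj) E.
Qed.

Lemma jac_unit i j p : dom i p -> dom j p -> jac i j (chart i p) \in unitmx.
Proof. by move=> dip djp; have [] := mulmx1_unit (jac_mul dip djp). Qed.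

(* If [chart i p] were an interior point, the first coordinate of the transition
   map would have a minimum there, making its Jacobian singular. *)
Lemma boundary_chart i p : boundary M p -> dom i p -> chart i p 0 0 = 0.
Proof.
move=> [j dj E] di; apply/eqP; case: eqVneq => // x0.
have xpos : 0 < chart i p 0 0 by rewrite lt_def x0; exact: chart_half di.
have oA : ropen (crd (dom j) i) by apply: crd_ropen; exact: dom_open.
have Ax : crd (dom j) i (chart i p) by exists p.
have D a : jac i j (chart i p) a 0 = 0.
  rewrite mxE; apply: (pder_interior_min a oA (@trans_smooth i j 0) Ax xpos).
  by move=> y /trans_half; rewrite chartK // E.
have := jac_mul dj di => /(congr1 (fun A : 'M[R]_n.+1 => A 0 0)).
rewrite !mxE eqxx big1 => [|c _]; last by rewrite D mulr0.
by move=> /esym /eqP; rewrite oner_eq0.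
Qed.

Lemma interior_chart i p : dom i p -> minterior M p <-> 0 < chart i p 0 0.
Proof.
move=> di; split=> [Mp|x0 /boundary_chart /(_ di) E].
  rewrite lt_def; apply/andP; split; last exact: chart_half di.
  by apply/eqP => E; apply: Mp; exists i.
by rewrite E ltxx in x0.
Qed.

Lemma interior_open : open (minterior M).
Proof.
rewrite openE => p Mp; rewrite /interior /=.
have [i di] := dom_cover p.
have := @chart_continuous _ _ M i; move/subspace_continuousP => /(_ _ di) C.
have x0 : 0 < chart i p 0 0 by exact/interior_chart.
have C0 := @coord_continuous R 1 n.+1 0 0 (chart i p).
have N : \forall q \near p, dom i q -> 0 < chart i q 0 0.
  have N0 : nbhs (chart i p) (fun y : V => 0 < y 0 0).
    exact: (C0 [set t | 0 < t] (lt_nbhsr x0)).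
  exact: (C _ N0).
apply: filterS2 N (open_nbhs_nbhs (conj (dom_open i) di)) => q H dq.
by apply/interior_chart; [exact: dq | exact: H].
Qed.

Lemma crd_interior U i :
  crd (U `&` minterior M) i = crd U i `&` [set x | 0 < x 0 0].
Proof.
apply/seteqP; split=> [x [p [dp [Up Mp]] <-]|x [[p [dp Up] <-] x0]].
  by split; [exists p | exact: (interior_chart dp).1].
by exists p => //; split=> //; split=> //; exact: (interior_chart dp).2.
Qed.

Lemma crd_boundary i x : crd (boundary M) i x -> x 0 0 = 0.
Proof. by move=> [p [dp bp] <-]; exact: boundary_chart. Qed.
End charts.

(** * Projective changes of connection *)

Section delta_sums.
Context (R : comRingType) (m : nat).
Implicit Types (F : 'I_m -> R) (d : 'I_m).

Lemma sum_delta F d : \sum_c F c * (c == d)%:R = F d.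
Proof.
rewrite (bigD1 d) //= eqxx mulr1 big1 ?addr0 // => c /negbTE ->.
by rewrite mulr0.
Qed.

Lemma sum_delta_sym F d : \sum_c F c * (d == c)%:R = F d.
Proof. by under eq_bigr do rewrite eq_sym; exact: sum_delta. Qed.
Lemma sumB2 (F G : 'I_m -> 'I_m -> R) :
  \sum_c \sum_e (F c e - G c e) = \sum_c \sum_e F c e - \sum_c \sum_e G c e.
Proof. by rewrite -sumrB; apply: eq_bigr => c _; rewrite sumrB. Qed.
End delta_sums.

Section ricci_change.
Context (R : comRingType) (n : nat).
Variables (g : 'I_n.+1 -> 'I_n.+1 -> 'I_n.+1 -> R) (w : 'I_n.+1 -> R).
Hypothesis g_sym : forall c a b, g c a b = g c b a.
Let g' c a b := g c a b + w a * (c == b)%:R + w b * (c == a)%:R.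

Lemma trace_change e : \sum_c g' c c e = \sum_c g c c e + n.+2%:R * w e.
Proof.
rewrite /g' !big_split /= sum_delta.
under [X in _ + X]eq_bigr do rewrite eqxx mulr1.
by rewrite sumr_const card_ord -mulr_natl -[n.+2%:R]natr1; ring.
Qed.

(** The traces of [g] cancel between the two products. What remains has the coefficients [n + 2 - 2]
    for the term linear in [w] and [2 (n + 2) - (n + 4)] for the quadratic one; both equal [n]. *)
Lemma quadratic_change b d :
  \sum_c \sum_e (g' c c e * g' e b d - g' c b e * g' e c d) =
  \sum_c \sum_e (g c c e * g e b d - g c b e * g e c d)
  + n%:R * (\sum_e g e b d * w e + w b * w d).
Proof.
rewrite !sumB2.
have E1 : \sum_c \sum_e g' c c e * g' e b d =
    \sum_c \sum_e g c c e * g e b d + n.+2%:R * \sum_e g e b d * w e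
    + (\sum_c g c c d + n.+2%:R * w d) * w b
    + (\sum_c g c c b + n.+2%:R * w b) * w d.
  rewrite exchange_big /=; under eq_bigr do rewrite -mulr_suml trace_change.
  rewrite {1}/g'; under eq_bigr do rewrite !mulrDr.
  rewrite !big_split /=.
  under [X in _ + X + _]eq_bigr do rewrite mulrA.
  under [X in _ + _ + X]eq_bigr do rewrite mulrA.
  rewrite (sum_delta (fun e => (\sum_c g c c e + n.+2%:R * w e) * w b)).
  rewrite (sum_delta (fun e => (\sum_c g c c e + n.+2%:R * w e) * w d)).
  congr (_ + _ + _).
  under eq_bigr do rewrite mulrDl mulr_suml.
  rewrite big_split /= [in RHS]exchange_big /= mulr_sumr; congr (_ + _).
  by apply: eq_bigr => e _; ring.
have E2 : \sum_c \sum_e g' c b e * g' e c d =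
    \sum_c \sum_e g c b e * g e c d + (\sum_e g e b d * w e) *+ 2
    + (\sum_c g c c b) * w d + (\sum_c g c c d) * w b
    + (n%:R + 4) * w b * w d.
  have inner c : \sum_e g' c b e * g' e c d =
      \sum_e g c b e * g e c d + g c b d * w c + g c c b * w d + g c c d * w b
      + w b * w c * (c == d)%:R + w b * w d
      + (\sum_e g e c d * w e + w d * w c *+ 2) * (c == b)%:R.
    have X e : g' c b e * g' e c d =
        g c b e * g e c d + (g c b e * w c) * (e == d)%:R
        + (g c b e * w d) * (e == c)%:R + (w b * g e c d) * (c == e)%:R
        + (w b * w c * (e == d)%:R) * (c == e)%:R
        + (w b * w d * (e == c)%:R) * (c == e)%:R
        + (g e c d * w e) * (c == b)%:R
        + (w e * w c * (c == b)%:R) * (e == d)%:R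
        + (w e * w d * (c == b)%:R) * (e == c)%:R.
      by rewrite /g'; ring.
    rewrite (eq_bigr _ (fun e _ => X e)) !big_split /=.
    rewrite (sum_delta (fun e => g c b e * w c)) (sum_delta (fun e => g c b e * w d)).
    rewrite (sum_delta_sym (fun e => w b * g e c d)).
    rewrite (sum_delta_sym (fun e => w b * w c * (e == d)%:R)).
    rewrite (sum_delta_sym (fun e => w b * w d * (e == c)%:R)).
    rewrite -mulr_suml (sum_delta (fun e => w e * w c * (c == b)%:R)).
    rewrite (sum_delta (fun e => w e * w d * (c == b)%:R)) eqxx mulr1n (g_sym c b c).
    by ring.
  rewrite (eq_bigr _ (fun c _ => inner c)) !big_split /=.
  rewrite (sum_delta (fun c => w b * w c)).
  rewrite (sum_delta (fun c => \sum_e g e c d * w e + w d * w c *+ 2)).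
  rewrite sumr_const card_ord -!mulr_suml -mulr_natr -natr1; ring.
rewrite E1 E2 -[n.+2%:R]natr1 -[n.+1%:R]natr1; ring.
Qed.
End ricci_change.

Ltac smooth := repeat first
  [ done | apply: smooth_on_cst | apply: smooth_onD | apply: smooth_onN
  | apply: smooth_onM | (apply: smooth_on_sum => ?) | apply: smooth_on_pder ].

Lemma sym2E (R : realType) (n : nat) (T : 'M[R]_n.+1) a b :
  sym2 T a b = 2^-1 * (T a b + T b a).
Proof. by rewrite !mxE. Qed.

Lemma sym3_ext (R : realType) (n : nat) (T T' : 'I_n.+1 -> 'I_n.+1 -> 'I_n.+1 -> R)
    (k : R) a b c :
  (forall a b c, T a b c = k * T' a b c) -> sym3 T a b c = k * sym3 T' a b c.
Proof. by move=> H; rewrite /sym3 !H; ring. Qed.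

Section connection_in_chart.
Context (R : realType) (n : nat) (M : bmanifold R n) (i : idx M).
Notation V := 'rV[R]_n.+1.
Variables (A : set V) (G : conn M).
Hypothesis oA : ropen A.
Hypothesis sG : forall c a b, smooth_on A (fun x => G i x c a b).

Lemma smooth_gam a : smooth_on A (fun x => gam G i x 0 a).
Proof. by rewrite /gam; under eq_fun do rewrite mxE; smooth. Qed.

Lemma smooth_Ric b d : smooth_on A (fun x => Ric G i x b d).
Proof. by rewrite /Ric; under eq_fun do rewrite mxE; smooth. Qed.

Lemma smooth_Schouten b d : smooth_on A (fun x => Schouten G i x b d).
Proof.
rewrite /Schouten; under eq_fun do rewrite mxE.
by apply: smooth_onM; [exact: smooth_on_cst | exact: smooth_Ric].
Qed.

Hypothesis symG : forall x c a b, A x -> G i x c a b = G i x c b a.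

Lemma trace_gam x d : A x -> \sum_c G i x c c d = n.+2%:R * gam G i x 0 d.
Proof.
move=> Ax; rewrite mxE mulrA divff ?pnatr_eq0 // mul1r.
by apply: eq_bigr => c _; exact: symG.
Qed.

Lemma RicE x b d : A x -> Ric G i x b d =
  \sum_c pder c (fun y => G i y c b d) x
  - n.+2%:R * pder b (fun y => gam G i y 0 d) x
  + \sum_c \sum_e (G i x c c e * G i x e b d - G i x c b e * G i x e c d).
Proof.
move=> Ax; rewrite mxE; congr (_ - _ + _).
rewrite -(pder_sum oA Ax) // -(pderMl oA Ax); last exact: smooth_gam.
by apply: (pder_eq b oA Ax) => y; rewrite inE => Ay; rewrite trace_gam.
Qed.

Hypothesis closedG : forall x a b, A x ->
  pder a (fun y => gam G i y 0 b) x = pder b (fun y => gam G i y 0 a) x.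

(** In [RicE] the divergence and the quadratic terms are symmetric because [G] is torsion free; the
    remaining term is the derivative of [gam], symmetric by [closedG]. *)
Lemma Ric_sym x b d : A x -> Ric G i x b d = Ric G i x d b.
Proof.
move=> Ax; rewrite !RicE // (closedG b d Ax); congr (_ - _ + _).
  apply: eq_bigr => c _; apply: (pder_eq c oA Ax) => y; rewrite inE => Ay.
  exact: symG.
rewrite !sumB2; congr (_ - _).
  by apply: eq_bigr => c _; apply: eq_bigr => e _; rewrite [G i x e b d]symG.
rewrite exchange_big; apply: eq_bigr => c _; apply: eq_bigr => e _ /=.
by rewrite mulrC [G i x e b c]symG // [G i x c e d]symG.
Qed.

Lemma Schouten_sym x b d : A x -> Schouten G i x b d = Schouten G i x d b.
Proof. by move=> Ax; rewrite mxE [RHS]mxE Ric_sym. Qed.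
End connection_in_chart.

(** * L(tau) in the splitting of a projectively related connection *)

Section projective_change.
Context (R : realType) (n : nat) (M : bmanifold R n) (i : idx M).
Notation V := 'rV[R]_n.+1.
Variables (A : set V) (G G' : conn M).
Hypothesis oA : ropen A.
Hypothesis sG : forall c a b, smooth_on A (fun x => G i x c a b).
Hypothesis sG' : forall c a b, smooth_on A (fun x => G' i x c a b).
Hypothesis symG : forall x c a b, A x -> G i x c a b = G i x c b a.
Hypothesis symG' : forall x c a b, A x -> G' i x c a b = G' i x c b a.
Hypothesis closedG : forall x a b, A x ->
  pder a (fun y => gam G i y 0 b) x = pder b (fun y => gam G i y 0 a) x.
Hypothesis closedG' : forall x a b, A x ->
  pder a (fun y => gam G' i y 0 b) x = pder b (fun y => gam G' i y 0 a) x.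

(* The one-form relating [G'] to [G], read off from the connections on E(1). *)
Definition gam_diff (a : 'I_n.+1) (y : V) := gam G' i y 0 a - gam G i y 0 a.
Notation om := gam_diff.

Hypothesis change : forall x c a b, A x ->
  G' i x c a b = G i x c a b + om a x * (c == b)%:R + om b x * (c == a)%:R.

Let smooth_om a : smooth_on A (om a).
Proof. by apply: smooth_onB; exact: smooth_gam. Qed.

Lemma pder_gam_diff_sym x a b : A x -> pder a (om b) x = pder b (om a) x.
Proof.
move=> Ax; rewrite !(pderB oA Ax); try exact: smooth_gam.
by rewrite closedG' // closedG.
Qed.

(** The covariant derivative of the one-form [om] with respect to [G]; symmetric because [om] is
    closed and [G] torsion free. *)
Definition hess_om (a b : 'I_n.+1) (x : V) :=
  pder a (om b) x - \sum_c G i x c a b * om c x.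

Lemma hess_om_sym x a b : A x -> hess_om a b x = hess_om b a x.
Proof.
move=> Ax; rewrite /hess_om pder_gam_diff_sym //; congr (_ - _).
by apply: eq_bigr => c _; rewrite symG.
Qed.

(** Since [om] is closed, the divergence contributes its derivative twice and the trace term
    subtracts it [n + 2] times, leaving the factor [- n]. This matches the factor in
    [quadratic_change]. *)
Lemma Ric_change x b d : A x -> Ric G' i x b d =
  Ric G i x b d - n%:R * (hess_om b d x - om b x * om d x).
Proof.
move=> Ax; rewrite (RicE oA sG' symG' _ _ Ax) (RicE oA sG symG _ _ Ax).
have E1 : \sum_c pder c (fun y => G' i y c b d) x =
    \sum_c pder c (fun y => G i y c b d) x + pder d (om b) x + pder b (om d) x.
  have H c : pder c (fun y => G' i y c b d) x = pder c (fun y => G i y c b d) x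
     + pder c (om b) x * (c == d)%:R + pder c (om d) x * (c == b)%:R.
    rewrite (pder_eq c oA Ax (g := fun y => G i y c b d + (c == d)%:R * om b y
        + (c == b)%:R * om d y)).
      rewrite [LHS](pderD oA Ax) ?(pderD oA Ax (f := fun y => G i y c b d));
        try by smooth.
      by rewrite !(pderMl oA Ax) //; ring.
    by move=> y; rewrite inE => Ay; rewrite change //; ring.
  rewrite (eq_bigr _ (fun c _ => H c)) !big_split /=.
  by rewrite (sum_delta (fun c => pder c (om b) x)) (sum_delta (fun c => pder c (om d) x)).
have E2 : pder b (fun y => gam G' i y 0 d) x =
    pder b (fun y => gam G i y 0 d) x + pder b (om d) x.
  rewrite [pder b (om d) x](pderB oA Ax); try exact: smooth_gam.
  by rewrite addrC subrK.
have E3 := quadratic_change (g := fun c a b => G i x c a b) (fun a => om a x)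
  (fun c a b => symG c a b Ax) b d.
have E4 : \sum_c \sum_e (G' i x c c e * G' i x e b d - G' i x c b e * G' i x e c d)
   = \sum_c \sum_e (G i x c c e * G i x e b d - G i x c b e * G i x e c d)
     + n%:R * (\sum_e G i x e b d * om e x + om b x * om d x).
  rewrite -E3; apply: eq_bigr => c _; apply: eq_bigr => e _.
  by rewrite !change.
rewrite E1 E2 E4 /hess_om (pder_gam_diff_sym d b Ax) -[n.+2%:R]natr1 -[n.+1%:R]natr1.
by ring.
Qed.

Lemma Schouten_change x b d : (0 < n)%N -> A x -> Schouten G' i x b d =
  Schouten G i x b d - hess_om b d x + om b x * om d x.
Proof.
move=> n0 Ax; rewrite [LHS]mxE [Schouten G i x b d]mxE Ric_change //.
have nn : (n%:R : R) != 0 by rewrite pnatr_eq0 -lt0n.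
by field.
Qed.

Variable tau : density M.
Hypothesis stau : smooth_on A (tau i).
Hypothesis tau_par : forall x, A x -> nab0 2 G tau i x = 0.

Lemma parallel_pder x a : A x ->
  pder a (tau i) x = - (2 * gam G i x 0 a * tau i x).
Proof.
move=> /tau_par /rowP /(_ a) /eqP; rewrite [nab0 2 G tau i x 0 a]mxE.
by rewrite [X in _ == X]mxE addr_eq0 => /eqP.
Qed.

Lemma nab0_change x a : A x -> nab0 2 G' tau i x 0 a = 2 * (om a x * tau i x).
Proof. by move=> Ax; rewrite mxE parallel_pder // /om; ring. Qed.

(** No term quadratic in [om] survives: differentiating [tau] and the weight term of [G'] together
    give [2 om_a om_b], which the change of the Christoffel symbols takes away. *)
Lemma nab1_change x a b : A x ->
  nab1 2 G' (nab0 2 G' tau) i x a b = 2 * (tau i x * hess_om a b x).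
Proof.
move=> Ax; rewrite mxE.
rewrite (pder_eq a oA Ax (g := fun y => 2 * (om b y * tau i y))); last first.
  by move=> y; rewrite inE => Ay; exact: nab0_change.
rewrite (pderMl oA Ax) ?(pderM oA Ax) ?parallel_pder //; last by smooth.
rewrite nab0_change //.
have -> : \sum_c G' i x c a b * nab0 2 G' tau i x 0 c =
   2 * tau i x * (\sum_c G i x c a b * om c x + om a x * om b x *+ 2).
  have H c : G' i x c a b * nab0 2 G' tau i x 0 c =
     2 * tau i x * (G i x c a b * om c x) +
     (2 * tau i x * om a x * om c x) * (c == b)%:R
     + (2 * tau i x * om b x * om c x) * (c == a)%:R.
    by rewrite nab0_change // change //; ring.
  rewrite (eq_bigr _ (fun c _ => H c)) !big_split /=.
  rewrite (sum_delta (fun c => 2 * tau i x * om a x * om c x)).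
  rewrite (sum_delta (fun c => 2 * tau i x * om b x * om c x)).
  by rewrite -mulr_sumr; ring.
by rewrite /hess_om /om; ring.
Qed.

Hypothesis n_gt0 : (0 < n)%N.

Lemma slot1_change x a : A x -> slot1 (Lop G' tau) i x 0 a = om a x * tau i x.
Proof. by move=> Ax; rewrite mxE nab0_change //; field. Qed.

(** The Hessian of [om] coming from the second derivative of [tau] cancels the one in
    [Schouten_change]. *)
Lemma slot2_change x a b : A x -> slot2 (Lop G' tau) i x a b =
  tau i x * (Schouten G i x a b + om a x * om b x).
Proof.
move=> Ax.
have E (T S : 'M[R]_n.+1) (t : R) : (2^-1 *: T + t *: S) a b
    = 2^-1 * T a b + t * S a b by rewrite !mxE.
apply: etrans (E (sym2 (nab1 2 G' (nab0 2 G' tau) i x)) _ _) _.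
rewrite !sym2E (nab1_change a b Ax) (nab1_change b a Ax).
rewrite (Schouten_change a b n_gt0 Ax) (Schouten_change b a n_gt0 Ax).
rewrite (hess_om_sym b a Ax) (Schouten_sym oA sG symG closedG b a Ax).
by field.
Qed.

Lemma S2conn0_Lop x : S2conn0 G' (Lop G' tau) i x = 0.
Proof.
by rewrite /S2conn0 /= scalerA divff ?pnatr_eq0 // scale1r subrr.
Qed.

Lemma S2conn1_Lop x : A x -> S2conn1 G' (Lop G' tau) i x = 0.
Proof.
move=> Ax; apply/matrixP => a b; rewrite /S2conn1.
have E (T S U : 'M[R]_n.+1) (t : R) : (T + t *: S - U) a b
    = T a b + t * S a b - U a b by rewrite !mxE.
rewrite E slot2_change // (Schouten_change a b n_gt0 Ax) [RHS]mxE.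
have N1 : nab1 2 G' (slot1 (Lop G' tau)) i x a b = tau i x * hess_om a b x.
  rewrite [tau i x * _](_ : _ = 2^-1 * (2 * (tau i x * hess_om a b x))); last by field.
  rewrite -nab1_change // [RHS](congr1 _ (mxE _ _ _ _)) mxE.
  rewrite (pder_eq a oA Ax (g := fun y => 2^-1 * nab0 2 G' tau i y 0 b)); last first.
    by move=> y _; rewrite mxE.
  rewrite (pderMl oA Ax); last first.
    apply: (eq_smooth_on (f := fun y => 2 * (om b y * tau i y))); last by smooth.
    by move=> y; rewrite inE => Ay; rewrite nab0_change.
  have F c : slot1 (Lop G' tau) i x 0 c = 2^-1 * nab0 2 G' tau i x 0 c by rewrite mxE.
  rewrite F; under eq_bigr do rewrite F mulrCA.
  by rewrite -mulr_sumr; ring.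
by rewrite N1 /=; ring.
Qed.

(** Put [T = P + om om], so that the bottom slot is [tau T] and the Schouten tensor of [G'] is
    [T - hess_om]. Differentiating [tau T] with [G'] yields [nabla P], terms in [hess_om], and
    [- om_b T_ac - om_c T_ba], the two [om_a T_bc] being absorbed by the weight. The products of the
    Schouten tensor with the middle slot cancel everything except [nabla P]. *)
Lemma S2conn2_Lop x a b c : A x -> S2conn2 G' (Lop G' tau) i x a b c =
  tau i x / n%:R * nab2 0 G (Ric G) i x a b c.
Proof.
move=> Ax; rewrite /S2conn2 /nab2.
have sP b' c' : smooth_on A (fun y => Schouten G i y b' c').
  exact: smooth_Schouten.
rewrite (pder_eq a oA Ax (g := fun y => tau i y * (Schouten G i y b c + om b y * om c y)));
  last by move=> y; rewrite inE => Ay; rewrite slot2_change.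
rewrite (pderM oA Ax) ?(pderD oA Ax (f := fun y => Schouten G i y b c))
  ?(pderM oA Ax (f := om b)) //; try by smooth.
rewrite parallel_pder // slot2_change // !slot1_change //.
rewrite (Schouten_change a b n_gt0 Ax) (Schouten_change a c n_gt0 Ax).
pose T b' c' := Schouten G i x b' c' + om b' x * om c' x.
have S1 : \sum_d G' i x d a b * slot2 (Lop G' tau) i x d c =
    tau i x * (\sum_d G i x d a b * Schouten G i x d c
      + (\sum_d G i x d a b * om d x) * om c x + om a x * T b c + om b x * T a c).
  have H d : G' i x d a b * slot2 (Lop G' tau) i x d c =
      tau i x * (G i x d a b * Schouten G i x d c)
      + tau i x * om c x * (G i x d a b * om d x)
      + (tau i x * om a x * T d c) * (d == b)%:R
      + (tau i x * om b x * T d c) * (d == a)%:R.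
    by rewrite slot2_change // change // /T; ring.
  rewrite (eq_bigr _ (fun d _ => H d)) !big_split /= -!mulr_sumr.
  rewrite (sum_delta (fun d => tau i x * om a x * T d c)).
  by rewrite (sum_delta (fun d => tau i x * om b x * T d c)); ring.
have S2 : \sum_d G' i x d a c * slot2 (Lop G' tau) i x b d =
    tau i x * (\sum_d G i x d a c * Schouten G i x b d
      + (\sum_d G i x d a c * om d x) * om b x + om a x * T b c + om c x * T b a).
  have H d : G' i x d a c * slot2 (Lop G' tau) i x b d =
      tau i x * (G i x d a c * Schouten G i x b d)
      + tau i x * om b x * (G i x d a c * om d x)
      + (tau i x * om a x * T b d) * (d == c)%:R
      + (tau i x * om c x * T b d) * (d == a)%:R.
    by rewrite slot2_change // change // /T; ring.
  rewrite (eq_bigr _ (fun d _ => H d)) !big_split /= -!mulr_sumr.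
  rewrite (sum_delta (fun d => tau i x * om a x * T b d)).
  by rewrite (sum_delta (fun d => tau i x * om c x * T b d)); ring.
rewrite S1 S2 /T.
have SE y b' c' : Schouten G i y b' c' = n%:R^-1 * Ric G i y b' c' by rewrite mxE.
have R1 : \sum_d G i x d a b * Schouten G i x d c
    = n%:R^-1 * \sum_d G i x d a b * Ric G i x d c.
  by rewrite mulr_sumr; apply: eq_bigr => d _; rewrite SE mulrCA.
have R2 : \sum_d G i x d a c * Schouten G i x b d
    = n%:R^-1 * \sum_d G i x d a c * Ric G i x b d.
  by rewrite mulr_sumr; apply: eq_bigr => d _; rewrite SE mulrCA.
have R3 : pder a (fun y => Schouten G i y b c) x
    = n%:R^-1 * pder a (fun y => Ric G i y b c) x.
  rewrite -(pderMl oA Ax); last exact: smooth_Ric.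
  by congr pder; apply/funext => y; rewrite SE.
rewrite R1 R2 R3 (Schouten_sym oA sG symG closedG b a Ax) /hess_om.
have -> : gam G' i x 0 a = gam G i x 0 a + om a x by rewrite /om addrC subrK.
by ring.
Qed.
End projective_change.

(** * The Ricci curvature is a tensor *)

Section ricci_tensor.
Context (R : realType) (n : nat) (M : bmanifold R n).
Notation V := 'rV[R]_n.+1.
Variables (G : conn M) (U : set M).
Hypothesis oU : open U.
Hypothesis Gconn : is_connection U G.

(* The connection matrices A_a, acting from the left: (A_a)_bc = Gamma^c_ab. *)
Definition conn_mx (k : idx M) (y : V) a : 'M[R]_n.+1 := \matrix_(b, c) G k y c a b.

Definition dconn_mx (k : idx M) (y : V) f a : 'M[R]_n.+1 :=
  \matrix_(b, c) pder f (fun z => G k z c a b) y.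

(** The curvature in the directions [f], [a]. The upper index labels columns, so the factors of the
    commutator are in reversed order. *)
Definition curv_mx k y f a : 'M[R]_n.+1 :=
  dconn_mx k y f a - dconn_mx k y a f
  + conn_mx k y a *m conn_mx k y f - conn_mx k y f *m conn_mx k y a.

Lemma Ric_curv k y b d : Ric G k y b d = \sum_c curv_mx k y c b d c.
Proof.
rewrite mxE -sumrB -big_split /=; apply: eq_bigr => c _.
rewrite !mxE -addrA -sumrB; congr (_ + _); apply: eq_bigr => e _.
by rewrite !mxE; ring.
Qed.

Variables (i j : idx M).
Notation phi := (fun y => chart j (chartV i y)).
Let A := crd (dom j `&` U) i.

Let oA : ropen A. Proof. by apply: crd_ropen; apply: openI => //; exact: dom_open. Qed.

Let AU : A `<=` crd U i. Proof. by apply: crd_sub => p []. Qed.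
Let Aj : A `<=` crd (dom j) i. Proof. by apply: crd_sub => p []. Qed.

Let sG c a b : smooth_on A (fun y => G i y c a b).
Proof. by apply: smooth_on_sub AU _; case: Gconn. Qed.

Let sJ a b : smooth_on A (fun y => jac i j y a b).
Proof. by apply: smooth_on_sub Aj _; exact: jac_smooth. Qed.

Let sGj c a b : smooth_on A (fun y => G j (phi y) c a b).
Proof.
apply: (@smooth_on_comp _ _ A (crd U j) (fun z => G j z c a b)).
- by case: Gconn.
- by move=> y [p [di [dj Up]] <-]; rewrite chartK //; exists p.
- by move=> e; apply: smooth_on_sub Aj _; exact: trans_smooth.
Qed.

(** The connection form of chart [j] with its form index moved to chart [i] but still in the
    coordinate frame of [j]. What then separates it from the connection form of [i] is a change of
    frame by the Jacobian. *)
Definition pulled_mx (y : V) a : 'M[R]_n.+1 :=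
  \matrix_(e, c) \sum_d jac i j y a d * G j (phi y) c d e.

(** The law for Christoffel symbols in the shape of a gauge transformation, which can be
    differentiated as a matrix identity. *)
Lemma connection_law y a : A y -> conn_mx i y a *m jac i j y =
  (\matrix_(b, c) pder a (fun z => jac i j z b c) y) + jac i j y *m pulled_mx y a.
Proof.
move=> [p [di [dj Up]] <-]; apply/matrixP => b c.
have [_ _ law] := Gconn; have := law i j p c a b di dj Up => /=.
move=> /eqP; rewrite eq_sym subr_eq => /eqP L.
rewrite mxE [RHS]mxE [X in _ = X + _]mxE [X in _ = _ + X]mxE.
under eq_bigr do rewrite [conn_mx _ _ _ _ _]mxE.
rewrite L addrC; congr (_ + _); rewrite exchange_big /=; apply: eq_bigr => e _.
rewrite [pulled_mx _ _ _ _]mxE mulr_sumr; apply: eq_bigr => d _.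
by rewrite chartK //; ring.
Qed.

Lemma pder_pulled y f a e c : A y -> pder f (fun z => pulled_mx z a e c) y =
  \sum_d pder f (fun z => jac i j z a d) y * G j (phi y) c d e
  + \sum_d \sum_g jac i j y a d * jac i j y f g *
      pder g (fun z => G j z c d e) (phi y).
Proof.
move=> Ay; under eq_fun do rewrite mxE.
rewrite (pder_sum oA Ay); last by move=> d; smooth.
rewrite -big_split /=; apply: eq_bigr => d _.
rewrite (pderM oA Ay) //; congr (_ + _).
case: Ay => p [di [dj Up]] <-.
have [sGU _ _] := Gconn.
rewrite (pder_trans f oU (sGU j c d e) di dj Up) mulr_sumr chartK //.
by apply: eq_bigr => g _; rewrite mulrA.
Qed.

Definition pulled_curv y f a : 'M[R]_n.+1 :=
  (\matrix_(e, c) (pder f (fun z => pulled_mx z a e c) y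
    - pder a (fun z => pulled_mx z f e c) y))
  + pulled_mx y a *m pulled_mx y f - pulled_mx y f *m pulled_mx y a.

(* Differentiate [connection_law] and antisymmetrize: second derivatives of the
   Jacobian cancel. *)
Lemma curv_gauge y f a : A y ->
  curv_mx i y f a *m jac i j y = jac i j y *m pulled_curv y f a.
Proof.
move=> Ay.
pose DJ f := \matrix_(b, c) pder f (fun z => jac i j z b c) y : 'M[R]_n.+1.
pose DDJ f a := \matrix_(b, c) pder f (pder a (fun z => jac i j z b c)) y : 'M[R]_n.+1.
pose DB f a := \matrix_(e, c) pder f (fun z => pulled_mx z a e c) y : 'M[R]_n.+1.
have DJE f' b c : DJ f' b c = pder f' (fun z => jac i j z b c) y by rewrite mxE.
have DDJE f' a' b c : DDJ f' a' b c = pder f' (pder a' (fun z => jac i j z b c)) y.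
  by rewrite mxE.
have DBE f' a' e c : DB f' a' e c = pder f' (fun z => pulled_mx z a' e c) y.
  by rewrite mxE.
have LJ f' : DJ f' = conn_mx i y f' *m jac i j y - jac i j y *m pulled_mx y f'.
  by rewrite connection_law // addrK.
have -> : pulled_curv y f a = DB f a - DB a f + pulled_mx y a *m pulled_mx y f
    - pulled_mx y f *m pulled_mx y a.
  congr (_ + _ - _); apply/matrixP => e c.
  by rewrite mxE [RHS]mxE [X in _ = _ + X]mxE !DBE.
clearbody DJ DDJ DB.
have sB a' e c : smooth_on A (fun z => pulled_mx z a' e c).
  by under eq_fun do rewrite mxE; smooth.
have key f' a' : dconn_mx i y f' a' *m jac i j y + conn_mx i y a' *m DJ f' =
    DDJ f' a' + DJ f' *m pulled_mx y a' + jac i j y *m DB f' a'.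
  apply/matrixP => b c.
  have E : {in A, (fun z => \sum_d G i z d a' b * jac i j z d c) =1
      (fun z => pder a' (fun w => jac i j w b c) z
        + \sum_e jac i j z b e * pulled_mx z a' e c)}.
    move=> z; rewrite inE => Az.
    have := connection_law a' Az => /matrixP /(_ b c).
    rewrite mxE [RHS]mxE [X in _ = X + _]mxE [X in _ = _ + X]mxE => <-.
    by apply: eq_bigr => d _; rewrite [conn_mx _ _ _ _ _]mxE.
  have := pder_eq f' oA Ay E.
  rewrite (pder_sum oA Ay) ?(pderD oA Ay) ?(pder_sum oA Ay); try by [move=> d; smooth|smooth].
  under eq_bigr do rewrite (pderM oA Ay) //.
  under [X in _ = _ + X -> _]eq_bigr do rewrite (pderM oA Ay) //.
  rewrite !big_split /= => F.
  have X1 : (dconn_mx i y f' a' *m jac i j y) b c =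
      \sum_d pder f' (fun z => G i z d a' b) y * jac i j y d c.
    by rewrite mxE; apply: eq_bigr => d _; rewrite [dconn_mx _ _ _ _ _ _]mxE.
  have X2 : (conn_mx i y a' *m DJ f') b c =
      \sum_d G i y d a' b * pder f' (fun z => jac i j z d c) y.
    rewrite mxE; apply: eq_bigr => d _.
    by rewrite [conn_mx _ _ _ _ _]mxE DJE.
  have X3 : (DJ f' *m pulled_mx y a') b c =
      \sum_e pder f' (fun z => jac i j z b e) y * pulled_mx y a' e c.
    by rewrite mxE; apply: eq_bigr => e _; rewrite DJE.
  have X4 : (jac i j y *m DB f' a') b c =
      \sum_e jac i j y b e * pder f' (fun z => pulled_mx z a' e c) y.
    by rewrite mxE; apply: eq_bigr => e _; rewrite DBE.
  have ED (X Y : 'M[R]_n.+1) : (X + Y) b c = X b c + Y b c by rewrite mxE.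
  by rewrite !ED X1 X2 X3 X4 DDJE F addrA.
have comm : DDJ f a = DDJ a f.
  by apply/matrixP => b c; rewrite !DDJE (pder_comm oA Ay).
have K1 := key f a; have K2 := key a f.
rewrite !LJ comm in K1; rewrite !LJ in K2.
rewrite !mulmxBr !mulmxBl in K1 K2.
rewrite /curv_mx !(mulmxBl, mulmxDl, mulmxBr, mulmxDr) -!mulmxA.
rewrite -!mulmxA in K1 K2.
apply/matrixP => b c.
have := congr1 (fun X : 'M[R]_n.+1 => X b c) K1.
have := congr1 (fun X : 'M[R]_n.+1 => X b c) K2.
have ED (X Y : 'M[R]_n.+1) : (X + Y) b c = X b c + Y b c by rewrite mxE.
have EN (X : 'M[R]_n.+1) : (- X) b c = - X b c by rewrite mxE.
rewrite /= !(ED, EN) => H1 H2.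
by lra.
Qed.

(** Curvature commutes with pullback: the derivatives of the Jacobian in [pder_pulled] are second
    derivatives of the transition map, symmetric in [f] and [a], and drop out. *)
Lemma pulled_curvE y f a e c : A y -> pulled_curv y f a e c =
  \sum_g \sum_h jac i j y f g * jac i j y a h * curv_mx j (phi y) g h e c.
Proof.
move=> Ay.
have ED (X Y : 'M[R]_n.+1) : (X + Y) e c = X e c + Y e c by rewrite mxE.
have EN (X : 'M[R]_n.+1) : (- X) e c = - X e c by rewrite mxE.
have EZ k (X : 'M[R]_n.+1) : (k *: X) e c = k * X e c by rewrite mxE.
pose J := jac i j y.
pose P g h := pder g (fun z => G j z c h e) (phi y).
pose Q g h := (conn_mx j (phi y) h *m conn_mx j (phi y) g) e c.
have QE f' a' : (pulled_mx y a' *m pulled_mx y f') e c =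
    \sum_g \sum_h J f' g * J a' h * Q g h.
  have BE a'' : pulled_mx y a'' = \sum_d J a'' d *: conn_mx j (phi y) d.
    apply/matrixP => b d; rewrite mxE summxE; apply: eq_bigr => k _.
    by rewrite [RHS]mxE [conn_mx _ _ _ _ _]mxE.
  rewrite !BE mulmx_suml summxE [RHS]exchange_big /=.
  under eq_bigr do rewrite mulmx_sumr summxE.
  apply: eq_bigr => h _; apply: eq_bigr => g _.
  by rewrite -scalemxAl -scalemxAr scalerA EZ [J a' h * _]mulrC.
have PE f' a' : pder f' (fun z => pulled_mx z a' e c) y =
    \sum_d pder f' (fun z => jac i j z a' d) y * G j (phi y) c d e
    + \sum_g \sum_h J f' g * J a' h * P g h.
  rewrite pder_pulled //; congr (_ + _); rewrite exchange_big /=.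
  by apply: eq_bigr => g _; apply: eq_bigr => h _; rewrite [J f' g * _]mulrC.
have comm : \sum_d pder f (fun z => jac i j z a d) y * G j (phi y) c d e =
    \sum_d pder a (fun z => jac i j z f d) y * G j (phi y) c d e.
  apply: eq_bigr => d _; congr (_ * _).
  have E k l : pder k (fun z => jac i j z l d) y =
      pder k (pder l (fun z => phi z 0 d)) y.
    by congr pder; apply/funext => z; rewrite mxE.
  rewrite !E; apply: (pder_comm oA Ay).
  by apply: smooth_on_sub Aj _; exact: trans_smooth.
rewrite /pulled_curv !(ED, EN) mxE !PE !QE comm.
have curvE g h : curv_mx j (phi y) g h e c = P g h - P h g + Q g h - Q h g.
  rewrite /curv_mx !(ED, EN) [dconn_mx _ _ g h _ _]mxE.
  by rewrite [dconn_mx _ _ h g _ _]mxE.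
have sw (T : 'I_n.+1 -> 'I_n.+1 -> R) : \sum_g \sum_h J a g * J f h * T g h =
    \sum_g \sum_h J f g * J a h * T h g.
  rewrite exchange_big; apply: eq_bigr => g _; apply: eq_bigr => h _ /=.
  by rewrite [J a h * _]mulrC.
rewrite !sw.
under [RHS]eq_bigr do under eq_bigr do rewrite curvE !(mulrDr, mulrN).
by under [RHS]eq_bigr do rewrite !big_split /= !sumrN; rewrite !big_split /= !sumrN; ring.
Qed.

(** By [curv_gauge] and [pulled_curvE] the full curvature is tensorial. In the trace, the Jacobian
    of the contracted form index meets the inverse Jacobian of the contracted frame index, and they
    cancel. *)
Lemma Ric_tensor p : dom i p -> dom j p -> U p ->
  let J := jac i j (chart i p) in
  Ric G i (chart i p) = J *m Ric G j (chart j p) *m J^T.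
Proof.
move=> di dj Up J; set y := chart i p.
have Ay : A y by exists p.
have JJ : J *m jac j i (chart j p) = 1%:M by exact: jac_mul.
have KK : jac j i (chart j p) *m J = 1%:M by exact: jac_mul.
set K := jac j i (chart j p) in JJ KK.
have phiE : phi y = chart j p by rewrite /y chartK.
have KJ l g : \sum_c K l c * J c g = (l == g)%:R.
  by have /matrixP /(_ l g) := KK; rewrite mxE [X in _ = X -> _]mxE.
apply/matrixP => b d; rewrite Ric_curv.
have FE c : curv_mx i y c b = J *m pulled_curv y c b *m K.
  by rewrite -curv_gauge // -mulmxA JJ mulmx1.
have E c : curv_mx i y c b d c = \sum_m \sum_l \sum_h \sum_g
    J d m * J b h * curv_mx j (chart j p) g h m l * (K l c * J c g).
  rewrite FE mxE exchange_big /=; apply: eq_bigr => l _.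
  rewrite mxE mulr_suml; apply: eq_bigr => m _.
  rewrite pulled_curvE // phiE exchange_big /= mulr_sumr mulr_suml.
  apply: eq_bigr => h _; rewrite mulr_sumr mulr_suml; apply: eq_bigr => g _.
  by ring.
rewrite (eq_bigr _ (fun c _ => E c)) exchange_big /=.
transitivity (\sum_m \sum_h J d m * J b h * Ric G j (chart j p) h m).
  apply: eq_bigr => m _; rewrite exchange_big /=.
  under eq_bigr do rewrite exchange_big /=.
  rewrite exchange_big /=; apply: eq_bigr => h _.
  rewrite Ric_curv mulr_sumr; apply: eq_bigr => l _.
  rewrite exchange_big /=.
  under eq_bigr => g _ do rewrite -mulr_sumr KJ.
  by rewrite (sum_delta_sym (fun g => J d m * J b h * curv_mx j (chart j p) g h m l)).
rewrite [RHS]mxE; apply: eq_bigr => m _; rewrite [X in _ = X * _]mxE mulr_suml.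
by apply: eq_bigr => h _; rewrite [J^T m d]mxE; ring.
Qed.
End ricci_tensor.

(** * Smoothness of the slots of L(tau), and closed connection forms *)

Section smooth_operators.
Context (R : realType) (n : nat) (M : bmanifold R n) (i : idx M).
Notation V := 'rV[R]_n.+1.
Variables (A : set V) (G : conn M).
Hypothesis oA : ropen A.
Hypothesis sG : forall c a b, smooth_on A (fun x => G i x c a b).

Lemma smooth_nab0 w (f : density M) a : smooth_on A (f i) ->
  smooth_on A (fun x => nab0 w G f i x 0 a).
Proof.
move=> sf; rewrite /nab0; under eq_fun do rewrite mxE.
by smooth; exact: smooth_gam.
Qed.

Lemma smooth_nab1 w (f : oneform M) a b :
  (forall c, smooth_on A (fun x => f i x 0 c)) ->
  smooth_on A (fun x => nab1 w G f i x a b).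
Proof.
move=> sf; rewrite /nab1; under eq_fun do rewrite mxE.
by smooth; exact: smooth_gam.
Qed.

Lemma smooth_nab2 w (f : tensor2 M) a b c :
  (forall d e, smooth_on A (fun x => f i x d e)) ->
  smooth_on A (fun x => nab2 w G f i x a b c).
Proof. by move=> sf; rewrite /nab2; smooth; exact: smooth_gam. Qed.

Variable tau : density M.
Hypothesis stau : smooth_on A (tau i).

Lemma smooth_slot1 a : smooth_on A (fun x => slot1 (Lop G tau) i x 0 a).
Proof.
rewrite /=; under eq_fun do rewrite mxE.
by smooth; exact: smooth_nab0.
Qed.

Lemma smooth_slot2 a b : smooth_on A (fun x => slot2 (Lop G tau) i x a b).
Proof.
have E x : slot2 (Lop G tau) i x a b =
    2^-1 * (2^-1 * (nab1 2 G (nab0 2 G tau) i x a b + nab1 2 G (nab0 2 G tau) i x b a))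
    + tau i x * (2^-1 * (Schouten G i x a b + Schouten G i x b a)).
  by rewrite -!sym2E mxE [X in X + _]mxE [X in _ + X]mxE.
under eq_fun do rewrite E.
by smooth; try exact: smooth_Schouten; apply: smooth_nab1 => c; exact: smooth_nab0.
Qed.

Lemma smooth_S2conn1 a b : smooth_on A (fun x => S2conn1 G (Lop G tau) i x a b).
Proof.
have E x : S2conn1 G (Lop G tau) i x a b = nab1 2 G (slot1 (Lop G tau)) i x a b
    + tau i x * Schouten G i x a b - slot2 (Lop G tau) i x a b.
  by rewrite mxE [X in X + _]mxE [X in _ + X + _]mxE [X in _ + X = _]mxE.
under eq_fun do rewrite E.
apply: smooth_onB; last exact: smooth_slot2.
apply: smooth_onD; first by apply: smooth_nab1 => c; exact: smooth_slot1.
by apply: smooth_onM => //; exact: smooth_Schouten.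
Qed.

Lemma smooth_S2conn2 a b c : smooth_on A (fun x => S2conn2 G (Lop G tau) i x a b c).
Proof.
rewrite /S2conn2; apply: smooth_onD; last first.
  by apply: smooth_onM; [exact: smooth_Schouten | exact: smooth_slot1].
apply: smooth_onD; first by apply: smooth_nab2 => d e; exact: smooth_slot2.
by apply: smooth_onM; [exact: smooth_Schouten | exact: smooth_slot1].
Qed.

(** Up to the factor [- w], [gam] is the logarithmic differential of [v]. Commuting second
    derivatives of [v] gives closedness after division by [w] and [v]. *)
Lemma closed_of_parallel w (v : density M) : w != 0 -> smooth_on A (v i) ->
  (forall x, A x -> v i x != 0) -> (forall x, A x -> nab0 w G v i x = 0) ->
  forall x a b, A x ->
  pder a (fun y => gam G i y 0 b) x = pder b (fun y => gam G i y 0 a) x.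
Proof.
move=> w0 sv v0 par x a b Ax.
have sg c : smooth_on A (fun y => gam G i y 0 c) by exact: smooth_gam.
have P c y : A y -> pder c (v i) y = (- w) * (gam G i y 0 c * v i y).
  move=> /par /rowP /(_ c) /eqP; rewrite [nab0 w G v i y 0 c]mxE.
  rewrite [X in _ == X]mxE addr_eq0 => /eqP ->; ring.
have Q c d : pder c (pder d (v i)) x = (- w) * (pder c (fun y => gam G i y 0 d) x * v i x
    + gam G i x 0 d * ((- w) * (gam G i x 0 c * v i x))).
  rewrite (pder_eq c oA Ax (g := fun y => (- w) * (gam G i y 0 d * v i y))); last first.
    by move=> y; rewrite inE => Ay; rewrite P.
  by rewrite (pderMl oA Ax) ?(pderM oA Ax) // ?P //; smooth.
have C := pder_comm oA Ax a b sv; rewrite !Q in C.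
apply/eqP; rewrite -subr_eq0.
have /eqP : (- w) * v i x * (pder a (fun y => gam G i y 0 b) x
    - pder b (fun y => gam G i y 0 a) x) = 0.
  move/eqP: C; rewrite -subr_eq0 => /eqP C; rewrite -[RHS]C; ring.
by rewrite !mulf_eq0 oppr_eq0 (negbTE w0) (negbTE (v0 x Ax)).
Qed.
End smooth_operators.

(** The trace picks up [w a] once from one delta and [n + 1] times from the other, which the
    normalization of [gam] turns into a single [w a]. Hence the one-form of a projective change is
    [gam_diff]. *)
Lemma gam_proj_change (R : realType) (n : nat) (M : bmanifold R n) (G G' : conn M)
    (i : idx M) x (w : 'I_n.+1 -> R) :
  (forall c a b, G' i x c a b = G i x c a b + w a * (c == b)%:R + w b * (c == a)%:R) ->
  forall a, gam G' i x 0 a = gam G i x 0 a + w a.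
Proof.
move=> H a; rewrite !mxE; under eq_bigr do rewrite H.
rewrite !big_split /= (sum_delta w).
under [X in _ * (_ + X + _)]eq_bigr do rewrite eqxx mulr1.
rewrite sumr_const card_ord -[w a *+ _]mulr_natl -addrA.
have -> : n.+1%:R * w a + w a = n.+2%:R * w a by rewrite -[n.+2%:R]natr1; ring.
by rewrite mulrDr mulrA mulVf ?pnatr_eq0 // mul1r.
Qed.

(** * Solutions of the BGG equation *)

Section setting.
Context (R : realType) (n : nat) (M : bmanifold R n).
Notation V := 'rV[R]_n.+1.
Variables (nabla : conn M) (tau : density M).
Hypothesis n_gt0 : (0 < n)%N.
Hypothesis nabla_conn : is_connection (minterior M) nabla.
Hypothesis tau_def : corresponding_defining_density 2 nabla tau.

(* [G'] belongs to the extended projective class over [U], and the one-form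
   relating it to [nabla] is closed.  Besides the special connections of the
   class this covers the connections provided by projective compactness, without
   having to prove that those are special. *)
Definition tame (U : set M) (G' : conn M) :=
  [/\ open U, is_connection U G',
      forall i x a b, crd (U `&` minterior M) i x ->
        pder a (fun y => gam G' i y 0 b) x = pder b (fun y => gam G' i y 0 a) x
    & forall i x c a b, crd (U `&` minterior M) i x ->
        G' i x c a b = nabla i x c a b + gam_diff i nabla G' a x * (c == b)%:R
                       + gam_diff i nabla G' b x * (c == a)%:R].

Lemma conn_smooth U (G : conn M) i c a b : is_connection U G ->
  smooth_on (crd U i) (fun x => G i x c a b).
Proof. by case. Qed.

Lemma conn_sym U (G : conn M) i x c a b : is_connection U G -> crd U i x ->
  G i x c a b = G i x c b a.
Proof. by case=> _ H _; exact: H. Qed.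

Lemma special_closed U (G : conn M) i x a b : open U -> is_connection U G ->
  special U G -> crd U i x ->
  pder a (fun y => gam G i y 0 b) x = pder b (fun y => gam G i y 0 a) x.
Proof.
move=> oU HG [v [[sv _] v0 par]] Ax.
apply: (closed_of_parallel (crd_ropen i oU) (w := - n.+2%:R) _ _ (sv i) (v0 i) _ _ _ Ax).
- by move=> c a' b'; exact: conn_smooth.
- by rewrite oppr_eq0 pnatr_eq0.
- exact: par.
Qed.

Lemma tau_smooth i : smooth_on (crd [set: M] i) (tau i).
Proof. by case: tau_def => -[[]]. Qed.

Lemma tau_smooth_on U i : smooth_on (crd U i) (tau i).
Proof. exact: smooth_on_sub (crd_sub (@subsetT _ U)) (@tau_smooth i). Qed.

Lemma tau_eq0 i p : dom i p -> tau i (chart i p) = 0 <-> boundary M p.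
Proof. by move=> di; case: tau_def => -[_ H _] _; exact: H. Qed.

Lemma tau_neq0 i x : crd (minterior M) i x -> tau i x != 0.
Proof. by move=> [p [di Ip] <-]; apply/eqP => /(tau_eq0 di). Qed.

Lemma tau_parallel i x : crd (minterior M) i x -> nab0 2 nabla tau i x = 0.
Proof. by case: tau_def => _; apply. Qed.

(** [tau] itself is a nowhere vanishing parallel density in the interior. *)
Lemma nabla_closed i x a b : crd (minterior M) i x ->
  pder a (fun y => gam nabla i y 0 b) x = pder b (fun y => gam nabla i y 0 a) x.
Proof.
move=> Ax.
apply: (closed_of_parallel (crd_ropen i (interior_open M)) (w := 2) (v := tau) _ _ _ _ _ _ _ Ax).
- by move=> c a' b'; exact: conn_smooth.
- by rewrite pnatr_eq0.
- exact: tau_smooth_on.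
- by move=> y; exact: tau_neq0.
- by move=> y; exact: tau_parallel.
Qed.

Lemma tame_special U G' : special_in_class nabla U G' -> tame U G'.
Proof.
move=> [[oU cG' [om _ Hom]] sp]; split=> //.
- move=> i x a b /(crd_sub (@subIsetl _ _ _)); exact: special_closed.
move=> i x c a b Ax.
have E d : gam_diff i nabla G' d x = om i x 0 d.
  rewrite /gam_diff (gam_proj_change (G := nabla) (w := fun d => om i x 0 d)).
    by rewrite addrC addKr.
  by move=> c' a' b'; exact: Hom.
by rewrite !E; exact: Hom.
Qed.

Lemma tame_nabla : tame (minterior M) nabla.
Proof.
split=> //; first exact: interior_open.
  by move=> i x a b; rewrite setIid; exact: nabla_closed.
by move=> i x c a b _; rewrite /gam_diff !subrr !mul0r !addr0.
Qed.

(** Lets the defining conditions of solutions be tested on [nabla] itself, which yields the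
    equations on Ric. *)
Lemma special_nabla : special (minterior M) nabla ->
  special_in_class nabla (minterior M) nabla.
Proof.
move=> sp; split=> //; split=> //; first exact: interior_open.
exists (fun _ _ => 0).
  split=> [i a|i j p _ _ _]; last by rewrite mul0mx.
  by under eq_fun do rewrite mxE; exact: smooth_on_cst.
by move=> i x c a b _; rewrite !mxE !mul0r !addr0.
Qed.

(** The one-form is half the differential of log [rho], hence closed. This is derived from
    [d rho = 2 rho om] by commuting second derivatives of [rho] and dividing by [rho], which is
    nonzero in the interior. *)
Lemma tame_boundary q : proj_compact 2 nabla -> boundary M q ->
  exists U G', tame U G' /\ U q.
Proof.
move=> pc /pc [U [rho [G' [Uq [oU srho _ rho0 _] cG' Hom]]]].
exists U, G'; split=> //.
pose om i x (a : 'I_n.+1) : R :=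
  pder a (fun y => rho (chartV i y)) x / (2 * rho (chartV i x)).
have change i x c a b : crd (U `&` minterior M) i x ->
    G' i x c a b = nabla i x c a b + om i x a * (c == b)%:R + om i x b * (c == a)%:R.
  by move=> /Hom ->; rewrite !mxE.
have E i x a : crd (U `&` minterior M) i x -> gam_diff i nabla G' a x = om i x a.
  move=> Ax; rewrite /gam_diff (gam_proj_change (G := nabla) (w := om i x)).
    by rewrite addrC addKr.
  by move=> c' a' b'; exact: change.
split=> //; last by move=> i x c a b Ax; rewrite !E //; exact: change.
move=> i x a b Ax.
have oA : ropen (crd (U `&` minterior M) i).
  by apply: crd_ropen; apply: openI => //; exact: interior_open.
have sA : crd (U `&` minterior M) i `<=` crd U i by apply: crd_sub => p [].
have sI : crd (U `&` minterior M) i `<=` crd (minterior M) i by apply: crd_sub => p [].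
have sr : smooth_on (crd (U `&` minterior M) i) (fun y => rho (chartV i y)).
  exact: smooth_on_sub sA (srho i).
have rn y : crd (U `&` minterior M) i y -> rho (chartV i y) != 0.
  by move=> /crdP [_ [Uy Iy] _]; apply/eqP => /(rho0 _ Uy).
have sg c : smooth_on (crd (U `&` minterior M) i) (fun y => gam nabla i y 0 c).
  by apply: smooth_gam => // c' a' b'; apply: smooth_on_sub sI _; exact: conn_smooth.
have sg' c : smooth_on (crd (U `&` minterior M) i) (fun y => gam G' i y 0 c).
  by apply: smooth_gam => // c' a' b'; apply: smooth_on_sub sA _; exact: conn_smooth.
have sd c : smooth_on (crd (U `&` minterior M) i) (gam_diff i nabla G' c).
  exact: smooth_onB.
have P c y : crd (U `&` minterior M) i y -> pder c (fun y => rho (chartV i y)) y =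
    2 * (rho (chartV i y) * gam_diff i nabla G' c y).
  by move=> Ay; rewrite E // /om; field; exact: rn.
have Q c d : pder c (pder d (fun y => rho (chartV i y))) x =
    2 * (2 * (rho (chartV i x) * gam_diff i nabla G' c x) * gam_diff i nabla G' d x
     + rho (chartV i x) * pder c (gam_diff i nabla G' d) x).
  rewrite (pder_eq c oA Ax (g := fun y => 2 * (rho (chartV i y) * gam_diff i nabla G' d y)));
    last by move=> y; rewrite inE => Ay; rewrite P.
  rewrite (pderMl oA Ax) ?(pderM oA Ax (f := fun y => rho (chartV i y))) // ?P //.
  exact: smooth_onM.
have C := pder_comm oA Ax a b sr; rewrite !Q in C.
have D : pder a (gam_diff i nabla G' b) x = pder b (gam_diff i nabla G' a) x.
  apply/eqP; rewrite -subr_eq0.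
  have /eqP : 2 * rho (chartV i x) * (pder a (gam_diff i nabla G' b) x
      - pder b (gam_diff i nabla G' a) x) = 0.
    move/eqP: C; rewrite -subr_eq0 => /eqP C; rewrite -[RHS]C; ring.
  by rewrite !mulf_eq0 pnatr_eq0 (negbTE (rn x Ax)).
have S c d : pder c (fun y => gam G' i y 0 d) x = pder c (fun y => gam nabla i y 0 d) x
    + pder c (gam_diff i nabla G' d) x.
  by rewrite [pder c (gam_diff _ _ _ _) x](pderB oA Ax) // addrC subrK.
by rewrite !S D nabla_closed //; exact: sI.
Qed.

Section tame_facts.
Variables (U : set M) (G' : conn M).
Hypothesis HG : tame U G'.
Variable i : idx M.

Lemma tame_ropen : ropen (crd U i).
Proof. by case: HG => oU _ _ _; exact: crd_ropen. Qed.

Lemma tame_smooth c a b : smooth_on (crd U i) (fun x => G' i x c a b).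
Proof. by case: HG => _ H _ _; exact: conn_smooth. Qed.

Let A := crd (U `&` minterior M) i.

Lemma tame_interior x : crd U i x -> 0 < x 0 0 -> A x.
Proof. by move=> Ax x0; rewrite /A crd_interior. Qed.

Let oA : ropen A.
Proof.
by apply: crd_ropen; apply: openI; [by case: HG | exact: interior_open].
Qed.

Let sAU : A `<=` crd U i. Proof. by apply: crd_sub => p []. Qed.
Let sAI : A `<=` crd (minterior M) i. Proof. by apply: crd_sub => p []. Qed.

Let sG c a b : smooth_on A (fun x => nabla i x c a b).
Proof. by apply: smooth_on_sub sAI _; exact: conn_smooth. Qed.

Let sG' c a b : smooth_on A (fun x => G' i x c a b).
Proof. by apply: smooth_on_sub sAU _; exact: tame_smooth. Qed.

Let symG x c a b : A x -> nabla i x c a b = nabla i x c b a.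
Proof. by move=> /sAI; exact: conn_sym. Qed.

Let symG' x c a b : A x -> G' i x c a b = G' i x c b a.
Proof. by move=> /sAU; apply: conn_sym; case: HG. Qed.

Let closedG x a b : A x ->
  pder a (fun y => gam nabla i y 0 b) x = pder b (fun y => gam nabla i y 0 a) x.
Proof. by move=> /sAI; exact: nabla_closed. Qed.

Let closedG' x a b : A x ->
  pder a (fun y => gam G' i y 0 b) x = pder b (fun y => gam G' i y 0 a) x.
Proof. by case: HG => _ _ + _; exact. Qed.

Let change x c a b : A x -> G' i x c a b = nabla i x c a b
  + gam_diff i nabla G' a x * (c == b)%:R + gam_diff i nabla G' b x * (c == a)%:R.
Proof. by case: HG => _ _ _ +; exact. Qed.

Let stau : smooth_on A (tau i). Proof. exact: tau_smooth_on. Qed.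

Let par x : A x -> nab0 2 nabla tau i x = 0.
Proof. by move=> /sAI; exact: tau_parallel. Qed.

Lemma tame_slot1 x a : A x ->
  slot1 (Lop G' tau) i x 0 a = gam_diff i nabla G' a x * tau i x.
Proof. by move=> Ax; apply: (slot1_change (A := A)). Qed.

Lemma tame_slot2 x a b : A x -> slot2 (Lop G' tau) i x a b =
  tau i x * (Schouten nabla i x a b + gam_diff i nabla G' a x * gam_diff i nabla G' b x).
Proof. by move=> Ax; apply: (slot2_change (A := A)). Qed.

Lemma tame_S2conn2 x a b c : A x -> S2conn2 G' (Lop G' tau) i x a b c =
  tau i x / n%:R * nab2 0 nabla (Ric nabla) i x a b c.
Proof. by move=> Ax; apply: (S2conn2_Lop (A := A)). Qed.

Lemma tame_S2conn1 x : crd U i x -> S2conn1 G' (Lop G' tau) i x = 0.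
Proof.
move=> Ax; apply/matrixP => a b; rewrite [RHS]mxE.
apply: (smooth_eq_closure tame_ropen (f := fun x => S2conn1 G' (Lop G' tau) i x a b)
  (g := fun=> 0) _ _ _ Ax).
- apply: smooth_S2conn1; [exact: tame_ropen|exact: tame_smooth|exact: tau_smooth_on].
- exact: smooth_on_cst.
move=> y Ay y0; have Iy := tame_interior Ay y0.
by rewrite (S2conn1_Lop (A := A) (G := nabla)) // mxE.
Qed.

Lemma tame_parallel : (forall x a b c, crd (minterior M) i x ->
    nab2 0 nabla (Ric nabla) i x a b c = 0) ->
  forall x, crd U i x -> [/\ S2conn0 G' (Lop G' tau) i x = 0,
    S2conn1 G' (Lop G' tau) i x = 0 & forall a b c, S2conn2 G' (Lop G' tau) i x a b c = 0].
Proof.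
move=> par0 x Ax; split; [exact: S2conn0_Lop | exact: tame_S2conn1 | move=> a b c].
apply: (smooth_eq_closure tame_ropen (f := fun x => S2conn2 G' (Lop G' tau) i x a b c)
  (g := fun=> 0) _ _ _ Ax).
- apply: smooth_S2conn2; [exact: tame_ropen|exact: tame_smooth|exact: tau_smooth_on].
- exact: smooth_on_cst.
move=> y Ay y0; have Iy := tame_interior Ay y0.
by rewrite tame_S2conn2 // par0 ?mulr0 //; exact: sAI.
Qed.

Lemma tame_bgg : (forall x a b c, crd (minterior M) i x ->
    sym3 (nab2 0 nabla (Ric nabla) i x) a b c = 0) ->
  forall x a b c, crd U i x -> sym3 (S2conn2 G' (Lop G' tau) i x) a b c = 0.
Proof.
move=> sym0 x a b c Ax.
apply: (smooth_eq_closure tame_ropen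
  (f := fun x => sym3 (S2conn2 G' (Lop G' tau) i x) a b c) (g := fun=> 0) _ _ _ Ax).
- have S a' b' c' : smooth_on (crd U i) (fun x => S2conn2 G' (Lop G' tau) i x a' b' c').
    by apply: smooth_S2conn2; [exact: tame_ropen|exact: tame_smooth|exact: tau_smooth_on].
  by rewrite /sym3; smooth.
- exact: smooth_on_cst.
move=> y Ay y0; have Iy := tame_interior Ay y0.
rewrite (sym3_ext (T' := nab2 0 nabla (Ric nabla) i y) (k := tau i y / n%:R)).
  by rewrite sym0 ?mulr0 //; exact: sAI.
by move=> a' b' c'; exact: tame_S2conn2.
Qed.
End tame_facts.

Lemma tau_over_n_neq0 i x : crd (minterior M) i x -> tau i x / n%:R != 0.
Proof.
by move=> Ax; rewrite mulf_neq0 ?tau_neq0 // invr_neq0 // pnatr_eq0 -lt0n.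
Qed.

Lemma nabla_S2conn2 i x a b c : crd (minterior M) i x ->
  S2conn2 nabla (Lop nabla tau) i x a b c =
  tau i x / n%:R * nab2 0 nabla (Ric nabla) i x a b c.
Proof. by move=> Ax; apply: (tame_S2conn2 tame_nabla); rewrite setIid. Qed.

Lemma bgg_solutionP : special (minterior M) nabla ->
  bgg_solution nabla tau <->
  forall i x a b c, crd (minterior M) i x ->
    sym3 (nab2 0 nabla (Ric nabla) i x) a b c = 0.
Proof.
move=> sp; split=> [H i x a b c Ax|H U G' /tame_special HG i x a b c Ax].
  have := H _ _ (special_nabla sp) i x a b c Ax.
  rewrite (sym3_ext (T' := nab2 0 nabla (Ric nabla) i x) (k := tau i x / n%:R)).
    by move/eqP; rewrite mulf_eq0 (negbTE (tau_over_n_neq0 Ax)) => /eqP.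
  by move=> a' b' c'; exact: nabla_S2conn2.
by apply: (tame_bgg HG) Ax => y a' b' c'; exact: H.
Qed.

Lemma normal_solutionP : special (minterior M) nabla ->
  normal_solution nabla tau <->
  forall i x a b c, crd (minterior M) i x -> nab2 0 nabla (Ric nabla) i x a b c = 0.
Proof.
move=> sp; split=> [H i x a b c Ax|H U G' /tame_special HG i x Ax].
  have [_ _ /(_ a b c)] := H _ _ (special_nabla sp) i x Ax.
  by move/eqP; rewrite nabla_S2conn2 // mulf_eq0 (negbTE (tau_over_n_neq0 Ax)) => /eqP.
by apply: (tame_parallel HG _ Ax) => y a' b' c'; exact: H.
Qed.
End setting.

(** * The bundle metric defined by tau *)

Section smooth_matrices.
Context (R : realType) (n : nat).
Notation V := 'rV[R]_n.+1.
Implicit Types (A B : set V).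

Lemma smooth_on_local A (f : V -> R) :
  (forall x, A x -> exists B, [/\ ropen B, B x & smooth_on B f]) ->
  A `<=` @halfspace R n -> smooth_on A f.
Proof.
move=> H sA x Ax; have [B [oB Bx sB]] := H x Ax.
have [U [g [oU Ux Hg UB fg]]] := smooth_ext oB sB Bx.
by exists U, g; split=> // y Uy /sA; exact: fg.
Qed.

Lemma smooth_mulmx A m p q (F : V -> 'M[R]_(m, p)) (H : V -> 'M[R]_(p, q)) a b :
  (forall a b, smooth_on A (fun x => F x a b)) ->
  (forall a b, smooth_on A (fun x => H x a b)) ->
  smooth_on A (fun x => (F x *m H x) a b).
Proof.
move=> sF sH; under eq_fun do rewrite mxE.
by apply: smooth_on_sum => c; exact: smooth_onM.
Qed.

Lemma smooth_block A m1 m2 p1 p2 (F1 : V -> 'M[R]_(m1, p1)) (F2 : V -> 'M[R]_(m1, p2))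
    (F3 : V -> 'M[R]_(m2, p1)) (F4 : V -> 'M[R]_(m2, p2)) a b :
  (forall a b, smooth_on A (fun x => F1 x a b)) ->
  (forall a b, smooth_on A (fun x => F2 x a b)) ->
  (forall a b, smooth_on A (fun x => F3 x a b)) ->
  (forall a b, smooth_on A (fun x => F4 x a b)) ->
  smooth_on A (fun x => block_mx (F1 x) (F2 x) (F3 x) (F4 x) a b).
Proof.
move=> s1 s2 s3 s4.
case: (split_ordP a) => a' ->; case: (split_ordP b) => b' ->.
- by under eq_fun do rewrite block_mxEul; exact: s1.
- by under eq_fun do rewrite block_mxEur; exact: s2.
- by under eq_fun do rewrite block_mxEdl; exact: s3.
- by under eq_fun do rewrite block_mxEdr; exact: s4.
Qed.
End smooth_matrices.

(** * L(tau) as a matrix in 1-jet frames *)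

Section tractor_form.
Context (R : realType) (n : nat) (M : bmanifold R n).
Notation V := 'rV[R]_n.+1.
Variable tau : density M.
Implicit Types (i : idx M) (x : V) (U : set M) (G : conn M).

(* [L(tau)] in the 1-jet frame, i.e. the slots of [Lop G tau] transported back
   through [split_mx G]. *)
Definition tractor_form G i x : 'M[R]_(1 + n.+1) :=
  let g := gam G i x in
  let v := slot1 (Lop G tau) i x in
  let t := tau i x in
  block_mx t%:M (v - t *: g) (v - t *: g)^T
    (slot2 (Lop G tau) i x - g^T *m v - v^T *m g + t *: (g^T *m g)).

Lemma split_tractor_form G i x :
  split_mx G i x *m tractor_form G i x *m (split_mx G i x)^T =
  block_mx (tau i x)%:M (slot1 (Lop G tau) i x) (slot1 (Lop G tau) i x)^T
    (slot2 (Lop G tau) i x).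
Proof.
rewrite /split_mx /tractor_form.
move: (gam G i x) (slot1 _ i x) (slot2 _ i x) (tau i x) => g v r t.
rewrite tr_block_mx !mulmx_block !trmx1 trmx0 trmxK.
rewrite !mul1mx !mul0mx !mulmx1 !mulmx0 !addr0.
congr block_mx; apply/matrixP => a b; rewrite !(mxE, big_ord1) ?ord1 /=; ring.
Qed.

Lemma tractor_form_smooth G A i a b : ropen A ->
  (forall c a b, smooth_on A (fun x => G i x c a b)) -> smooth_on A (tau i) ->
  smooth_on A (fun x => tractor_form G i x a b).
Proof.
move=> oA sG st.
have sg c : smooth_on A (fun x => gam G i x 0 c) by exact: smooth_gam.
have s1 c : smooth_on A (fun x => slot1 (Lop G tau) i x 0 c) by exact: smooth_slot1.
have s2 c d : smooth_on A (fun x => slot2 (Lop G tau) i x c d) by exact: smooth_slot2.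
apply: smooth_block => {a b} a b.
- by under eq_fun do rewrite mxE; rewrite !ord1 eqxx.
- have E x : (slot1 (Lop G tau) i x - tau i x *: gam G i x) a b =
    slot1 (Lop G tau) i x 0 b - tau i x * gam G i x 0 b.
    by rewrite (ord1 a) mxE [X in _ + X]mxE [X in _ - X]mxE.
  by under eq_fun do rewrite E; smooth.
- have E x : (slot1 (Lop G tau) i x - tau i x *: gam G i x)^T a b =
    slot1 (Lop G tau) i x 0 a - tau i x * gam G i x 0 a.
    by rewrite (ord1 b) mxE mxE [X in _ + X]mxE [X in _ - X]mxE.
  by under eq_fun do rewrite E; smooth.
have P (u v : 'rV[R]_n.+1) : (u^T *m v) a b = u 0 a * v 0 b.
  by rewrite mxE big_ord1 mxE.
have E x : (slot2 (Lop G tau) i x - (gam G i x)^T *m slot1 (Lop G tau) i x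
    - (slot1 (Lop G tau) i x)^T *m gam G i x
    + tau i x *: ((gam G i x)^T *m gam G i x)) a b =
    slot2 (Lop G tau) i x a b - gam G i x 0 a * slot1 (Lop G tau) i x 0 b
    - slot1 (Lop G tau) i x 0 a * gam G i x 0 b
    + tau i x * (gam G i x 0 a * gam G i x 0 b).
  rewrite mxE [X in X + _]mxE [X in X + _ + _]mxE [X in _ + X]mxE.
  by rewrite [X in _ + X + _ + _]mxE [X in _ + X + _]mxE !P.
by under eq_fun do rewrite E; smooth.
Qed.

Lemma slot2_sym G i x : (slot2 (Lop G tau) i x)^T = slot2 (Lop G tau) i x.
Proof.
apply/matrixP => a b; rewrite mxE /= mxE [RHS]mxE [X in X + _]mxE [X in _ + X]mxE.
by rewrite [X in _ = X + _]mxE [X in _ = _ + X]mxE !sym2E ![_ b a + _]addrC.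
Qed.

Lemma tractor_form_sym G i x : (tractor_form G i x)^T = tractor_form G i x.
Proof.
rewrite /tractor_form tr_block_mx tr_scalar_mx trmxK; congr block_mx.
have := slot2_sym G i x.
move: (slot2 _ i x) (slot1 _ i x) (gam G i x) (tau i x) => r v g t.
move=> /matrixP s2; apply/matrixP => a b; have := s2 a b.
by rewrite !(mxE, big_ord1) => ->; ring.
Qed.
End tractor_form.

(** * Gluing the local expressions of L(tau) *)

Section global_form.
Context (R : realType) (n : nat) (M : bmanifold R n).
Notation V := 'rV[R]_n.+1.
Variables (nabla : conn M) (tau : density M).
Hypothesis n_gt0 : (0 < n)%N.
Hypothesis nabla_conn : is_connection (minterior M) nabla.
Hypothesis tau_def : corresponding_defining_density 2 nabla tau.
Implicit Types (i j : idx M) (x : V) (U : set M) (G : conn M).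

Definition interior_form i x : 'M[R]_(1 + n.+1) :=
  let g := gam nabla i x in
  let t := tau i x in
  block_mx t%:M (- (t *: g)) (- (t *: g))^T
    (t *: (Schouten nabla i x + g^T *m g)).

Definition unipotent_mx (g : 'rV[R]_n.+1) : 'M[R]_(1 + n.+1) :=
  block_mx 1%:M 0 (- g^T) 1%:M.

(** In the splitting of [nabla] the form is block diagonal, because [tau] is parallel;
    [unipotent_mx] of its [gam] is the inverse of [split_mx nabla]. Both the determinant and the
    transition law are read off from this factorization. *)
Lemma interior_formE i x : interior_form i x =
  unipotent_mx (gam nabla i x) *m
    block_mx (tau i x)%:M 0 0 (tau i x *: Schouten nabla i x) *m
    (unipotent_mx (gam nabla i x))^T.
Proof.
rewrite /interior_form /unipotent_mx.
move: (gam nabla i x) (Schouten nabla i x) (tau i x) => g P t.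
rewrite tr_block_mx !mulmx_block !trmx1 trmx0.
rewrite !mul1mx !mul0mx !mulmx1 !mulmx0 !addr0 !add0r.
by congr block_mx; apply/matrixP => a b; rewrite !(mxE, big_ord1) ?ord1 /=; ring.
Qed.

(** With [om] written as the difference of the two [gam], the one of [G] cancels, so all tame
    connections give the same form. *)
Lemma tame_tractor_form U G i x : tame nabla U G ->
  crd (U `&` minterior M) i x -> tractor_form tau G i x = interior_form i x.
Proof.
move=> HG Ax; rewrite /tractor_form /interior_form.
have s1 a := tame_slot1 tau_def G a Ax.
have s2 a b := tame_slot2 n_gt0 nabla_conn tau_def HG a b Ax.
have gE a : gam_diff i nabla G a x = gam G i x 0 a - gam nabla i x 0 a by [].
move: s1 s2; move: (slot1 _ i x) (slot2 _ i x) => v r s1 s2.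
have v1 a : v 0 a = (gam G i x 0 a - gam nabla i x 0 a) * tau i x by rewrite s1.
have r1 a b : r a b = tau i x * (Schouten nabla i x a b
    + (gam G i x 0 a - gam nabla i x 0 a) * (gam G i x 0 b - gam nabla i x 0 b)).
  by rewrite s2.
move: v1 r1; move: (gam G i x) (gam nabla i x) (tau i x) (Schouten nabla i x).
move=> g' g t P v1 r1.
have E : v - t *: g' = - (t *: g).
  by apply/rowP => a; rewrite !mxE v1; ring.
rewrite E; congr block_mx; apply/matrixP => a b.
by rewrite !(mxE, big_ord1) !v1 r1; ring.
Qed.

Lemma tame_tractor_form_eq U G W K i x : tame nabla U G -> tame nabla W K ->
  crd U i x -> crd W i x -> tractor_form tau G i x = tractor_form tau K i x.
Proof.
move=> HG HK Ux Wx; apply/matrixP => a b.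
have Ax : crd (U `&` W) i x.
  by have [dx Ux' <-] := crdP Ux; have [_ Wx' _] := crdP Wx; exists (chartV i x).
have oA : ropen (crd (U `&` W) i).
  by apply: crd_ropen; apply: openI; [case: HG | case: HK].
have sU : crd (U `&` W) i `<=` crd U i by apply: crd_sub => p [].
have sW : crd (U `&` W) i `<=` crd W i by apply: crd_sub => p [].
apply: (smooth_eq_closure oA (f := fun x => tractor_form tau G i x a b)
  (g := fun x => tractor_form tau K i x a b) _ _ _ Ax).
- apply: tractor_form_smooth => //; last exact: (tau_smooth_on tau_def).
  by move=> c a' b'; apply: smooth_on_sub sU _; exact: (tame_smooth HG).
- apply: tractor_form_smooth => //; last exact: (tau_smooth_on tau_def).
  by move=> c a' b'; apply: smooth_on_sub sW _; exact: (tame_smooth HK).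
move=> y Ay y0.
rewrite (tame_tractor_form HG); last by apply: tame_interior => //; exact: sU.
by rewrite (tame_tractor_form HK) //; apply: tame_interior => //; exact: sW.
Qed.

(** The transition function of E(1), which is the local [d] in [cotractor_trans]. *)
Definition weight_fn i j (y : V) : R := `|\det (jac i j y)| `^ (- 1 / n.+2%:R).

Lemma det_jac_neq0 i j y : crd (dom j) i y -> \det (jac i j y) != 0.
Proof.
move=> [p [di dj] <-]; have := jac_unit di dj.
by rewrite unitmxE unitfE.
Qed.

Lemma weight_fn_smooth i j : smooth_on (crd (dom j) i) (weight_fn i j).
Proof.
apply: smooth_on_powR; first by move=> y; exact: det_jac_neq0.
by apply: smooth_on_det => a b; exact: jac_smooth.
Qed.

Lemma weight_fn_gt0 i j y : crd (dom j) i y -> 0 < weight_fn i j y.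
Proof. by move=> Ay; apply: powR_gt0; rewrite normr_gt0 det_jac_neq0. Qed.

Lemma tau_trans i j p : dom i p -> dom j p ->
  tau i (chart i p) = weight_fn i j (chart i p) ^+ 2 * tau j (chart j p).
Proof.
move=> di dj; have [[[_ H] _ _] _] := tau_def; rewrite (H i j p di dj I).
congr (_ * _); rewrite /weight_fn -powR_mulrn ?powR_ge0 // -powRrM; congr (_ `^ _).
by rewrite [RHS]mulrAC mulN1r.
Qed.

Lemma tau_pder i x a : crd (minterior M) i x ->
  pder a (tau i) x = - (2 * gam nabla i x 0 a * tau i x).
Proof.
move=> Ax; apply: (parallel_pder (A := crd (minterior M) i)) => // y.
exact: tau_parallel.
Qed.

(* Obtained from the transformation law of the parallel density [tau] rather
   than by tracing the one of the Christoffel symbols. *)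
Lemma gam_trans i j p a : dom i p -> dom j p -> minterior M p ->
  pder a (weight_fn i j) (chart i p) = weight_fn i j (chart i p) *
   (\sum_b jac i j (chart i p) a b * gam nabla j (chart j p) 0 b
     - gam nabla i (chart i p) 0 a).
Proof.
move=> di dj Ip; set x := chart i p; set d := weight_fn i j.
pose A := crd (dom j `&` minterior M) i.
have Ax : A x by exists p.
have oA : ropen A.
  by apply: crd_ropen; apply: openI; [exact: dom_open|exact: interior_open].
have sAj : A `<=` crd (dom j) i by apply: crd_sub => q [].
have dpos : d x != 0 by rewrite gt_eqF // weight_fn_gt0 //; exact: sAj.
have sd : smooth_on A d by exact: smooth_on_sub sAj (@weight_fn_smooth i j).
have stj : smooth_on A (fun y => tau j (chart j (chartV i y))).
  apply: (smooth_on_comp (B := crd [set: M] j) (f := tau j)).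
  - exact: (tau_smooth tau_def).
  - by move=> y [q [dq [djq _]] <-]; rewrite chartK //; exists q.
  - by move=> b; apply: smooth_on_sub sAj _; exact: trans_smooth.
have E : {in A, tau i =1 (fun y => d y * d y * tau j (chart j (chartV i y)))}.
  move=> y; rewrite inE => -[q [dq [djq _]] <-].
  by rewrite chartK // (tau_trans dq djq) expr2.
have Ixi : crd (minterior M) i x by exists p.
have Ixj : crd (minterior M) j (chart j p) by exists p.
have := pder_eq a oA Ax E.
rewrite tau_pder // (pderM oA Ax) //; last exact: smooth_onM.
rewrite (pderM oA Ax) //.
rewrite (pder_trans a openT (@tau_smooth _ _ _ _ _ tau_def j) di dj I).
rewrite /x chartK // (tau_trans di dj) -/x -/d.
have -> : \sum_b jac i j x a b * pder b (tau j) (chart j p) =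
    - (2 * tau j (chart j p)) * \sum_b jac i j x a b * gam nabla j (chart j p) 0 b.
  by rewrite mulr_sumr; apply: eq_bigr => b _; rewrite tau_pder //; ring.
move=> H.
have t0 := tau_neq0 tau_def Ixj.
set S := \sum_b _ in H *.
have nz : 2 * d x * tau j (chart j p) != 0 by rewrite !mulf_neq0 // pnatr_eq0.
apply: (mulfI nz); move: H => /eqP; rewrite -subr_eq0 => /eqP H.
apply/eqP; rewrite -subr_eq0; apply/eqP.
rewrite -[RHS]oppr0 -[in RHS]H; ring.
Qed.

(** By [gam_trans], the unipotent factors of [interior_formE] intertwine [cotractor_trans] with a
    block diagonal matrix. The claim splits into the laws of [tau] and of the Schouten tensor. *)
Lemma interior_form_trans i j p : dom i p -> dom j p -> minterior M p ->
  interior_form i (chart i p) = cotractor_trans i j (chart i p) *m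
    interior_form j (chart j p) *m (cotractor_trans i j (chart i p))^T.
Proof.
move=> di dj Ip; set x := chart i p; set y := chart j p.
have Pt : Schouten nabla i x = jac i j x *m Schouten nabla j y *m (jac i j x)^T.
  rewrite /Schouten (Ric_tensor (interior_open M) nabla_conn di dj Ip).
  by rewrite -scalemxAr -scalemxAl.
pose d := weight_fn i j x.
pose c : 'cV[R]_n.+1 := \col_a pder a (weight_fn i j) x.
have cE : c = d *: (jac i j x *m (gam nabla j y)^T) - d *: (gam nabla i x)^T.
  apply/matrixP => a b; rewrite (ord1 b) {b} mxE gam_trans // -/x -/d mulrBr.
  rewrite [RHS]mxE [X in _ = X + _]mxE [X in _ = _ + X]mxE.
  rewrite [X in _ = _ - X]mxE [X in _ = _ - _ * X]mxE; congr (_ * _ - _).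
  by rewrite mxE; apply: eq_bigr => b _; rewrite [X in _ = _ * X]mxE.
have -> : cotractor_trans i j x = block_mx d%:M 0 c (d *: jac i j x) by [].
have E : block_mx d%:M 0 c (d *: jac i j x) *m unipotent_mx (gam nabla j y) =
    unipotent_mx (gam nabla i x) *m block_mx d%:M 0 0 (d *: jac i j x).
  rewrite /unipotent_mx !mulmx_block !mul1mx !mul0mx !mulmx1 !mulmx0 !addr0 !add0r.
  rewrite cE; congr block_mx.
  rewrite mulmxN -scalemxAl addrAC subrr add0r.
  by rewrite mul_mx_scalar scalerN.
rewrite !interior_formE !mulmxA E -!mulmxA -trmx_mul E trmx_mul.
rewrite !mulmxA; congr (_ *m _); rewrite -!mulmxA; congr (_ *m _).
rewrite tr_block_mx !trmx0 !mulmx_block !(mul0mx, mulmx0, addr0, add0r).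
rewrite (tau_trans di dj) -/x -/y -/d Pt tr_scalar_mx.
congr block_mx; first by rewrite -!scalar_mxM; congr (_%:M); ring.
move: (jac i j x) (Schouten nabla j y) => J P.
rewrite [(d *: J)^T]linearZ /= -!(scalemxAl, scalemxAr) !scalerA !mulmxA.
by congr (_ *: _); ring.
Qed.

(* [T] selects a tame connection around each point. *)
Variable T : M -> set M * conn M.
Hypothesis HT : forall p, tame nabla (T p).1 (T p).2 /\ (T p).1 p.

Definition global_form : S2cotractor M :=
  fun i x => tractor_form tau (T (chartV i x)).2 i x.

Lemma global_formE U G i x : tame nabla U G -> crd U i x ->
  global_form i x = tractor_form tau G i x.
Proof.
move=> HG Ux; have [H1 H2] := HT (chartV i x).
apply: (tame_tractor_form_eq H1 HG) => //.
by have [dx _ E] := crdP Ux; rewrite -{2}E; exists (chartV i x).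
Qed.

Lemma global_form_interior i x : crd (minterior M) i x ->
  global_form i x = interior_form i x.
Proof.
move=> Ax; have HN := tame_nabla nabla_conn tau_def.
by rewrite (global_formE HN) // (tame_tractor_form HN) // setIid.
Qed.

Lemma global_form_smooth i a b : smooth_on (crd [set: M] i) (fun x => global_form i x a b).
Proof.
apply: smooth_on_local => [x Ax|]; last by case: (crd_ropen i (@openT M)).
have [HG Up] := HT (chartV i x).
exists (crd (T (chartV i x)).1 i); split.
- exact: (tame_ropen HG).
- by have [dx _ E] := crdP Ax; rewrite -{2}E; exists (chartV i x).
apply: (eq_smooth_on (f := fun y => tractor_form tau (T (chartV i x)).2 i y a b)).
  by move=> y; rewrite inE => Ay; rewrite (global_formE HG).
apply: tractor_form_smooth; first exact: (tame_ropen HG).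
  exact: (tame_smooth HG).
exact: (tau_smooth_on tau_def).
Qed.

Lemma cotractor_trans_smooth i j a b :
  smooth_on (crd (dom j) i) (fun x => cotractor_trans i j x a b).
Proof.
have oA : ropen (crd (dom j) i) by apply: crd_ropen; exact: dom_open.
have sd := @weight_fn_smooth i j.
apply: smooth_block => {a b} a b.
- by under eq_fun do rewrite mxE; rewrite !ord1 eqxx.
- by under eq_fun do rewrite mxE; exact: smooth_on_cst.
- by under eq_fun do rewrite mxE; exact: smooth_on_pder.
- by under eq_fun do rewrite mxE; apply: smooth_onM => //; exact: jac_smooth.
Qed.

Lemma global_form_trans i j p : dom i p -> dom j p ->
  global_form i (chart i p) = cotractor_trans i j (chart i p) *m
    global_form j (chart j p) *m (cotractor_trans i j (chart i p))^T.
Proof.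
move=> di dj; apply/matrixP => a b.
have oA : ropen (crd (dom j) i) by apply: crd_ropen; exact: dom_open.
have Ax : crd (dom j) i (chart i p) by exists p.
have sg := @cotractor_trans_smooth i j.
have sH c d : smooth_on (crd (dom j) i)
    (fun x => global_form j (chart j (chartV i x)) c d).
  apply: (smooth_on_comp (B := crd [set: M] j) (f := fun y => global_form j y c d)).
  - exact: global_form_smooth.
  - by move=> y [q [dq djq] <-]; rewrite chartK //; exists q.
  - by move=> e; exact: trans_smooth.
have key : {in crd (dom j) i, forall x, 0 < x 0 0 -> global_form i x a b =
   (cotractor_trans i j x *m global_form j (chart j (chartV i x))
      *m (cotractor_trans i j x)^T) a b}.
  move=> x; rewrite inE => -[q [dq djq] <-] x0.
  have Iq : minterior M q by exact: (interior_chart dq).2.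
  rewrite chartK // !global_form_interior ?(interior_form_trans dq djq Iq) //.
    by exists q.
  by exists q.
have := smooth_eq_closure oA (f := fun x => global_form i x a b)
  (g := fun x => (cotractor_trans i j x *m global_form j (chart j (chartV i x))
      *m (cotractor_trans i j x)^T) a b) _ _ _ Ax.
rewrite chartK //; apply.
- exact: smooth_on_sub (crd_sub (@subsetT _ _)) (@global_form_smooth i a b).
- apply: smooth_mulmx => [c d|c d]; first exact: smooth_mulmx.
  by under eq_fun do rewrite mxE; exact: sg.
- by move=> y Ay; apply: key; rewrite inE.
Qed.

Lemma global_form_S2cotractor : is_S2cotractor [set: M] global_form.
Proof.
split.
- exact: global_form_smooth.
- by move=> i x _; exact: tractor_form_sym.
- by move=> i j p di dj _; exact: global_form_trans.
Qed.

Lemma global_form_slots U G i x : tame nabla U G -> crd U i x ->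
  [/\ slot0 (slots G global_form) i x = slot0 (Lop G tau) i x,
      slot1 (slots G global_form) i x = slot1 (Lop G tau) i x
    & slot2 (slots G global_form) i x = slot2 (Lop G tau) i x].
Proof.
move=> HG Ax; rewrite /slots /slot0 /slot1 /slot2 (global_formE HG) //.
rewrite split_tractor_form block_mxKul block_mxKur block_mxKdr.
by split=> //; rewrite mxE eqxx.
Qed.

Lemma global_form_is_L : is_L nabla tau global_form.
Proof.
split; first exact: global_form_S2cotractor.
by move=> U G' /tame_special HG i x Ax; exact: (global_form_slots HG Ax).
Qed.
End global_form.

(** * Parallelity, nondegeneracy and holonomy *)

Section determinant.
Context (R : realType).

(** Jacobi's formula, from the Leibniz expansion and the product rule. *)
Lemma is_derive_det (W : normedModType R) m (F : W -> 'M[R]_m) (dF : 'M[R]_m) (t v : W) :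
  (forall i j, is_derive t v (fun s => F s i j) (dF i j)) ->
  is_derive t v (fun s => \det (F s)) (\tr (dF *m \adj (F t))).
Proof.
move=> H.
have D := is_derive_bigsum (index_enum {perm 'I_m}) xpredT
  (fun s : {perm 'I_m} => is_derive_mul (is_derive_const ((-1) ^+ s) t v)
     (is_derive_bigprod (f := fun i w => F w i (s i)) (fun i => H i (s i)))).
rewrite /determinant; have := D; congr is_derive.
under eq_bigr do rewrite mul0r add0r mulr_sumr.
rewrite exchange_big /=; apply: eq_bigr => k _.
rewrite [RHS]mxE.
(* Differentiating the factor of row [k] gives the determinant with that row replaced. Expanding
   along it produces cofactors of [F t]. *)
pose Fk : 'M[R]_m := \matrix_(i, j) if i == k then dF k j else F t i j.
have FkE i j : Fk i j = if i == k then dF k j else F t i j by rewrite mxE.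
transitivity (\det Fk).
  apply: eq_bigr => s _; rewrite [in RHS](bigD1 k) //= FkE eqxx; congr (_ * (_ * _)).
  by apply: eq_bigr => j /negbTE jk; rewrite FkE jk.
rewrite (expand_det_row Fk k); apply: eq_bigr => j _.
rewrite FkE eqxx mxE; congr (_ * _); rewrite /cofactor; congr (_ * \det _).
by apply/matrixP => a b; rewrite !mxE ?FkE [lift k a == k]eq_sym (negbTE (neq_lift k a)).
Qed.

Lemma trace_adj_sym m (A Q : 'M[R]_m) :
  \tr ((A *m Q + Q *m A^T) *m \adj Q) = 2 * \tr A * \det Q.
Proof.
rewrite mulmxDl mxtraceD -mulmxA mul_mx_adj mul_mx_scalar mxtraceZ.
rewrite -mulmxA mxtrace_mulC -mulmxA mul_adj_mx mul_mx_scalar mxtraceZ mxtrace_tr.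
ring.
Qed.

(* [y t ^+ 2 * expR (- 2 K t)] is nonincreasing. *)
Lemma derivable_nonzero_backwards (y dy : R -> R) (K e : R) : 0 < e -> 0 <= K ->
  {within `[0, e], continuous y} ->
  (forall t, t \in `]0, e[ -> is_derive t (1 : R) y (dy t)) ->
  (forall t, t \in `]0, e[ -> `|dy t| <= K * `|y t|) ->
  y e != 0 -> y 0 != 0.
Proof.
move=> e0 K0 cy Dy By ye.
pose z t := y t ^+ 2 * expR (- (2 * K) * t).
pose dz t := 2 * y t * dy t * expR (- (2 * K) * t)
  + y t ^+ 2 * (- (2 * K) * expR (- (2 * K) * t)).
have De t : is_derive t (1 : R) (fun s : R => expR (- (2 * K) * s))
    (- (2 * K) * expR (- (2 * K) * t)).
  apply: (@is_derive_comp1 R R expR (fun s => - (2 * K) * s)).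
  have := is_derive_mul (is_derive_const (- (2 * K)) t (1 : R)) (is_derive_id t (1 : R)).
  by rewrite mul0r add0r mulr1.
have Dz t : t \in `]0, e[ -> is_derive t (1 : R) z (dz t).
  move=> te; have Y := is_derive_mul (Dy t te) (Dy t te).
  have := is_derive_mul Y (De t).
  rewrite (_ : (fun s => y s * y s * _) = z); last by apply/funext => s; rewrite /z expr2.
  by congr is_derive; rewrite /dz; ring.
have dz0 t : t \in `]0, e[ -> dz t <= 0.
  move=> te; rewrite /dz.
  have -> : 2 * y t * dy t * expR (- (2 * K) * t) +
     y t ^+ 2 * (- (2 * K) * expR (- (2 * K) * t)) =
     2 * expR (- (2 * K) * t) * (y t * dy t - K * y t ^+ 2) by ring.
  rewrite pmulr_rle0 ?mulr_gt0 ?expR_gt0 // subr_le0.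
  apply: (le_trans (ler_norm _)); rewrite normrM.
  rewrite -(real_normK (num_real (y t))) expr2 mulrCA.
  by rewrite ler_wpM2l // By.
have cz : {within `[0, e], continuous z}.
  move=> t; apply: (@continuousM _ (subspace `[0, e]) (fun t => y t ^+ 2)).
    by apply: (@continuousM _ (subspace `[0, e]) y y); exact: cy.
  have C : continuous (fun s : R => expR (- (2 * K) * s)).
    move=> s; apply: (differentiable_continuous ((derivable1_diffP _ _).1 _)).
    by have [] := De s.
  exact: (continuous_subspaceT C).
have D1 t : t \in `]0, e[ -> derivable z t 1 by move=> /Dz [].
have D2 t : t \in `]0, e[ -> derive1 z t <= 0.
  by move=> te; rewrite derive1E; have [_ ->] := Dz t te; exact: dz0.
have H : z e <= z 0.
  have e00 := ltW e0.
  by apply: (ler0_derive1_le_cc D1 D2 cz); rewrite ?in_itv /= ?lexx ?e00.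
move: H; rewrite /z mulr0 expR0 mulr1 => H.

apply/eqP => y0; move: H; rewrite y0 expr0n /= leNgt => /negP; apply.
by rewrite mulr_gt0 ?expR_gt0 // lt_def sqr_ge0 andbT expf_eq0 /= ye.
Qed.
End determinant.

(** * Parallel forms as solutions of a linear matrix equation *)

Section parallel_form.
Context (R : realType) (n : nat) (M : bmanifold R n).
Notation V := 'rV[R]_n.+1.
Implicit Types (i j : idx M) (x : V) (U : set M) (G : conn M).

Lemma S2conn_ext A G (t t' : triple M) i x : ropen A -> A x ->
  (forall y, A y -> [/\ slot0 t i y = slot0 t' i y, slot1 t i y = slot1 t' i y
     & slot2 t i y = slot2 t' i y]) ->
  [/\ S2conn0 G t i x = S2conn0 G t' i x, S2conn1 G t i x = S2conn1 G t' i x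
    & forall a b c, S2conn2 G t i x a b c = S2conn2 G t' i x a b c].
Proof.
move=> oA Ax H; have [E0 E1 E2] := H x Ax.
split.
- rewrite /S2conn0 E1 /nab0 E0; congr (_ - _); apply/rowP => a; rewrite mxE [RHS]mxE.
  congr (_ + _); apply: (pder_eq a oA Ax) => y; rewrite inE => Ay.
  by have [->] := H y Ay.
- rewrite /S2conn1 E0 E2 /nab1 E1; congr (_ + _ - _); apply/matrixP => a b.
  rewrite mxE [RHS]mxE; congr (_ - _ + _).
  apply: (pder_eq a oA Ax) => y; rewrite inE => Ay.
  by have [_ -> _] := H y Ay.
move=> a b c; rewrite /S2conn2 /nab2 E1 E2; congr (_ - _ - _ + _ + _ + _).
apply: (pder_eq a oA Ax) => y; rewrite inE => Ay.
by have [_ _ ->] := H y Ay.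
Qed.

Variable tau : density M.

(* [tractor_form] in the splitting determined by [G]. *)
Definition split_form G i x : 'M[R]_(1 + n.+1) :=
  block_mx (tau i x)%:M (slot1 (Lop G tau) i x) (slot1 (Lop G tau) i x)^T
    (slot2 (Lop G tau) i x).

Lemma split_form_sym G i x : (split_form G i x)^T = split_form G i x.
Proof. by rewrite /split_form tr_block_mx tr_scalar_mx trmxK slot2_sym. Qed.

Lemma split_form_smooth G A i a b : ropen A ->
  (forall c a b, smooth_on A (fun x => G i x c a b)) -> smooth_on A (tau i) ->
  smooth_on A (fun x => split_form G i x a b).
Proof.
move=> oA sG st; apply: smooth_block => {a b} a b.
- by under eq_fun do rewrite mxE; rewrite !ord1 eqxx.
- by rewrite (ord1 a); exact: smooth_slot1.
- by under eq_fun do rewrite mxE; rewrite (ord1 b); exact: smooth_slot1.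
- exact: smooth_slot2.
Qed.

Definition conn_mul G i x a : 'M[R]_(1 + n.+1) :=
  cotractor_conn_mx G i x a *m split_form G i x.

Lemma conn_mulE G i x a :
  let g := gam G i x 0 a in
  let v := slot1 (Lop G tau) i x in
  let r := slot2 (Lop G tau) i x in
  conn_mul G i x a = block_mx (g * tau i x - v 0 a)%:M
    (\row_b (g * v 0 b - r a b))
    (\col_b (Schouten G i x a b * tau i x + g * v 0 b - \sum_c G i x c a b * v 0 c))
    (\matrix_(b, c) (Schouten G i x a b * v 0 c + g * r b c
       - \sum_d G i x d a b * r d c)).
Proof.
move=> g v r; rewrite /conn_mul /cotractor_conn_mx /split_form mulmx_block -/g -/v -/r.
move: g v r (tau i x) (Schouten G i x) => g v r t P.
have mulN (p : nat) (X : 'M[R]_(n.+1, p)) c : (- basisv R a *m X) 0 c = - X a c.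
  by rewrite mulNmx mxE /basisv -rowE mxE.
have S (p : nat) (X : 'M[R]_(n.+1, p)) b c :
  (\matrix_(b, c) (g * (b == c)%:R - G i x c a b) *m X) b c =
    g * X b c - \sum_d G i x d a b * X d c.
  have E d : (\matrix_(b, c) (g * (b == c)%:R - G i x c a b)) b d * X d c =
      (g * X d c) * (d == b)%:R - G i x d a b * X d c.
    by rewrite mxE eq_sym; ring.
  rewrite mxE (eq_bigr _ (fun d _ => E d)) sumrB.
  by rewrite (sum_delta (fun d => g * X d c)).
congr block_mx; apply/matrixP => b c.
- by rewrite !ord1 mxE mulN !mxE /= big_ord1 !mxE /= !mulr1n.
- by rewrite !ord1 mxE mulN !mxE big_ord1 !mxE /= mulr1n.
- rewrite !ord1 mxE S mxE big_ord1 !mxE /= mulr1n addrA.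
  by under eq_bigr do rewrite mxE.
- by rewrite mxE S mxE big_ord1 !mxE addrA.
Qed.

(** The three slot equations combined into [d_a Q = - (A_a Q + Q A_a^T)] for the symmetric matrix
    [Q = split_form]. This is the shape used along curves, for the determinant and for the pairing
    of parallel fields. *)
Lemma split_form_parallel G i x a k l :
  S2conn0 G (Lop G tau) i x = 0 -> S2conn1 G (Lop G tau) i x = 0 ->
  (forall b c, S2conn2 G (Lop G tau) i x a b c = 0) ->
  pder a (fun y => split_form G i y k l) x =
    - (conn_mul G i x a k l + conn_mul G i x a l k).
Proof.
move=> H0 H1 H2; rewrite conn_mulE.
set g := gam G i x 0 a; set v := slot1 (Lop G tau) i x; set r := slot2 (Lop G tau) i x.
have rs b c : r b c = r c b.
  by have /matrixP /(_ c b) := slot2_sym tau G i x; rewrite mxE.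
have P0 : pder a (tau i) x = 2 * v 0 a - 2 * g * tau i x.
  have := congr1 (fun X : 'rV[R]_n.+1 => X 0 a) H0.
  rewrite /S2conn0 -/v mxE [X in X + _]mxE [X in _ + X]mxE [X in _ - X]mxE.
  rewrite [X in _ = X]mxE -/g => E; apply/eqP; rewrite -subr_eq0; apply/eqP.
  by rewrite -[RHS]E -?[slot0 (Lop G tau)]/tau; ring.
have P1 b : pder a (fun y => slot1 (Lop G tau) i y 0 b) x =
    \sum_c G i x c a b * v 0 c - 2 * g * v 0 b - tau i x * Schouten G i x a b + r a b.
  have := congr1 (fun X : 'M[R]_n.+1 => X a b) H1.
  rewrite /S2conn1 -/r mxE [X in X + _]mxE [X in X + _ + _]mxE [X in _ + X + _]mxE.
  rewrite [X in _ + X = _]mxE [X in _ = X]mxE -/g -/v => E.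
  by apply/eqP; rewrite -subr_eq0; apply/eqP; rewrite -[RHS]E -?[slot0 (Lop G tau)]/tau; ring.
have P2 b c : pder a (fun y => slot2 (Lop G tau) i y b c) x =
    \sum_d G i x d a b * r d c + \sum_d G i x d a c * r b d - 2 * g * r b c
    - Schouten G i x a b * v 0 c - Schouten G i x a c * v 0 b.
  have := H2 b c; rewrite /S2conn2 /nab2 -/g -/v -/r => E.
  by apply/eqP; rewrite -subr_eq0; apply/eqP; rewrite -[RHS]E -?[slot0 (Lop G tau)]/tau; ring.
rewrite /split_form.
case: (split_ordP k) => k' ->; case: (split_ordP l) => l' ->.
- under eq_fun do rewrite block_mxEul mxE !ord1 eqxx mulr1n.
  by rewrite P0 !block_mxEul !mxE !ord1 eqxx mulr1n; ring.
- rewrite (ord1 k'); under eq_fun do rewrite block_mxEur.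
  by rewrite P1 block_mxEur block_mxEdl [X in _ = - (X + _)]mxE [X in _ = - (_ + X)]mxE; ring.
- rewrite (ord1 l'); under eq_fun do rewrite block_mxEdl mxE.
  by rewrite P1 block_mxEdl block_mxEur [X in _ = - (X + _)]mxE [X in _ = - (_ + X)]mxE; ring.
under eq_fun do rewrite block_mxEdr.
rewrite P2 !block_mxEdr [X in _ = - (X + _)]mxE [X in _ = - (_ + X)]mxE (rs l' k').
rewrite (eq_bigr _ (fun d _ => congr1 _ (rs k' d))); ring.
Qed.
End parallel_form.

Section curves.
Context (R : realType) (n : nat).
Notation V := 'rV[R]_n.+1.

Lemma smooth_along_cvg (A : set V) (f : V -> R) (c : R -> V) (S : set R) (t : R) :
  smooth_on A f -> {for t, continuous c} -> (forall s, S s -> A (c s)) -> S t ->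
  f (c s) @[s --> within S (nbhs t)] --> f (c t).
Proof.
move=> sf cc SA St.
have Act := SA _ St.
have H := smooth_on_within_cvg sf Act.
apply: (@cvg_trans _ (f @ within A (nbhs (c t)))) => //.
move=> P HP.
have N : \forall y \near c t, A y -> P (f y) by exact: HP.
have N' : \forall s \near t, A (c s) -> P (f (c s)) by exact: (cc _ N).
suff : \forall s \near t, S s -> P (f (c s)) by [].
by apply: filterS N' => s Hs /SA; exact: Hs.
Qed.

Lemma line_is_derive (x : V) (a b : 'I_n.+1) (t : R) :
  is_derive t (1 : R) (fun s : R => (x + s *: basisv R a) 0 b) ((b == a)%:R : R).
Proof.
under eq_fun do rewrite !mxE eqxx /=.
have := is_derive_add (is_derive_const (x 0 b) t (1 : R))
  (is_derive_mul (is_derive_id t (1 : R)) (is_derive_const ((b == a)%:R : R) t (1 : R))).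
by congr is_derive; rewrite add0r mulr0 addr0 mul1r.
Qed.

Lemma line_continuous (x : V) (a : 'I_n.+1) (t : R) :
  {for t, continuous (fun s : R => x + s *: basisv R a)}.
Proof.
by apply: cvgD; [exact: cvg_cst | apply: cvgZr_tmp; exact: cvg_id].
Qed.
End curves.

Section bilinear_forms.
Context (R : realType) (m : nat).
Implicit Types (Q S : 'M[R]_m) (v w : 'cV[R]_m).

Lemma bformE Q v w : bform Q v w = \sum_l (\sum_k v k 0 * Q k l) * w l 0.
Proof.
rewrite /bform mxE; apply: eq_bigr => l _; rewrite mxE; congr (_ * _).
by apply: eq_bigr => k _; rewrite mxE.
Qed.

Lemma bform_congr Q S v w : bform (S *m Q *m S^T) v w = bform Q (S^T *m v) (S^T *m w).
Proof. by rewrite /bform trmx_mul trmxK !mulmxA. Qed.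

Lemma bform_delta Q a b : bform Q (delta_mx a 0) (delta_mx b 0) = Q a b.
Proof. by rewrite /bform trmx_delta -rowE -colE !mxE. Qed.

Lemma bform_inj Q S : (forall v w, bform Q v w = bform S v w) -> Q = S.
Proof.
move=> E; apply/matrixP => a b; have := E (delta_mx a 0) (delta_mx b 0).
by rewrite !bform_delta.
Qed.

Lemma is_derive_bform (W : normedModType R) (P V : W -> 'cV[R]_m) (Q : W -> 'M[R]_m)
    (dP dV : 'cV[R]_m) (dQ : 'M[R]_m) (t u : W) :
  (forall k, is_derive t u (fun s => P s k 0) (dP k 0)) ->
  (forall k l, is_derive t u (fun s => Q s k l) (dQ k l)) ->
  (forall k, is_derive t u (fun s => V s k 0) (dV k 0)) ->
  is_derive t u (fun s => bform (Q s) (P s) (V s))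
    ((dP^T *m Q t *m V t + (P t)^T *m dQ *m V t + (P t)^T *m Q t *m dV) 0 0).
Proof.
move=> HP HQ HV; under eq_fun do rewrite bformE.
have D := is_derive_bigsum (index_enum 'I_m) xpredT
  (fun l => is_derive_mul (is_derive_bigsum (index_enum 'I_m) xpredT
     (fun k => is_derive_mul (HP k) (HQ k l))) (HV l)).
have := D; congr is_derive.
have -> : (dP^T *m Q t *m V t + (P t)^T *m dQ *m V t + (P t)^T *m Q t *m dV) 0 0 =
    bform (Q t) dP (V t) + bform dQ (P t) (V t) + bform (Q t) (P t) dV.
  by rewrite /bform mxE [X in X + _]mxE.
rewrite !bformE -!big_split; apply: eq_bigr => l _ /=.
by rewrite big_split /= mulrDl.
Qed.
End bilinear_forms.

(** * Nondegeneracy up to the boundary and reduction of holonomy *)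

Section normal.
Context (R : realType) (n : nat) (M : bmanifold R n).
Notation V := 'rV[R]_n.+1.
Variables (nabla : conn M) (tau : density M).
Hypothesis n_gt0 : (0 < n)%N.
Hypothesis nabla_conn : is_connection (minterior M) nabla.
Hypothesis tau_def : corresponding_defining_density 2 nabla tau.
Implicit Types (i j : idx M) (x : V) (U : set M) (G : conn M).
Variable T : M -> set M * conn M.
Hypothesis HT : forall p, tame nabla (T p).1 (T p).2 /\ (T p).1 p.
Hypothesis Ric_parallel : forall i x a b c, crd (minterior M) i x ->
  nab2 0 nabla (Ric nabla) i x a b c = 0.
Notation H := (global_form tau T).

Lemma tame_split_parallel U G i x a k l : tame nabla U G -> crd U i x ->
  pder a (fun y => split_form tau G i y k l) x =
    - (conn_mul tau G i x a k l + conn_mul tau G i x a l k).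
Proof.
move=> HG Ax.
have [H0 H1 H2] := tame_parallel n_gt0 nabla_conn tau_def HG (@Ric_parallel i) Ax.
exact: split_form_parallel.
Qed.

Lemma global_form_parallel : tractor_parallel nabla H.
Proof.
move=> U G' /tame_special HG i x Ax.
have [|E0 E1 E2] := @S2conn_ext _ _ _ (crd U i) G' (slots G' H) (Lop G' tau) i x
  (tame_ropen HG i) Ax.
  by move=> y Ay; exact: (global_form_slots n_gt0 nabla_conn tau_def HT HG Ay).
rewrite E0 E1.
have [H0 H1 H2] := tame_parallel n_gt0 nabla_conn tau_def HG (@Ric_parallel i) Ax.
by split=> // a b c; rewrite E2.
Qed.

Lemma split_formE U G i x : tame nabla U G -> crd U i x ->
  split_form tau G i x = split_mx G i x *m H i x *m (split_mx G i x)^T.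
Proof.
move=> HG Ax.
by rewrite (global_formE n_gt0 nabla_conn tau_def HT HG Ax) split_tractor_form.
Qed.

Lemma det_split_mx G i x : \det (split_mx G i x) = 1.
Proof. by rewrite /split_mx det_lblock !det1 mulr1. Qed.

Lemma det_split_form U G i x : tame nabla U G -> crd U i x ->
  \det (split_form tau G i x) = \det (H i x).
Proof.
by move=> HG Ax; rewrite (split_formE HG Ax) !det_mulmx det_tr det_split_mx mul1r mulr1.
Qed.

Hypothesis Ric_nondeg : nondegenerate_on (minterior M) (Ric nabla).

(** By [interior_formE] the determinant is [tau (tau / n)^(n+1) det Ric]. *)
Lemma global_form_interior_unit i x : crd (minterior M) i x -> \det (H i x) != 0.
Proof.
move=> Ax; rewrite (global_form_interior n_gt0 nabla_conn tau_def HT Ax).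
rewrite interior_formE !det_mulmx det_tr /unipotent_mx det_lblock !det1 !mulr1 mul1r.
rewrite det_ublock det_scalar expr1 /Schouten scalerA detZ.
rewrite !mulf_neq0 ?(tau_neq0 tau_def) ?expf_neq0 //.
  by rewrite mulf_neq0 ?(tau_neq0 tau_def) // invr_neq0 // pnatr_eq0 -lt0n.
by have := Ric_nondeg Ax; rewrite unitmxE unitfE.
Qed.

Lemma cotractor_conn_smooth U G i a k l : tame nabla U G ->
  smooth_on (crd U i) (fun x => cotractor_conn_mx G i x a k l).
Proof.
move=> HG; have oA := tame_ropen HG i.
have sG c b d : smooth_on (crd U i) (fun x => G i x c b d) by exact: (tame_smooth HG).
have sg c : smooth_on (crd U i) (fun x => gam G i x 0 c) by exact: smooth_gam.
apply: smooth_block => {k l} k l.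
- by under eq_fun do rewrite mxE; rewrite !ord1 eqxx; exact: sg.
- exact: smooth_on_cst.
- have sP b d : smooth_on (crd (M:=M) U i) (fun x => Schouten G i x b d).
    exact: smooth_Schouten.
  by under eq_fun do rewrite mxE mxE; exact: sP.
by under eq_fun do rewrite mxE; smooth.
Qed.

(** Provides the segment and the constant for [derivable_nonzero_backwards]: the trace is continuous
    up to the boundary, so near [x] it differs from its value at [x] by less than 1. *)
Lemma trace_line_bound U G i x : tame nabla U G -> crd U i x ->
  exists e C : R, [/\ 0 < e, 0 <= C & forall t : R, 0 <= t <= e ->
    crd U i (x + t *: basisv R 0) /\
    `|\tr (cotractor_conn_mx G i (x + t *: basisv R 0) 0)| <= C].
Proof.
move=> HG Ax; have [sA oA] := tame_ropen HG i.
pose f y := \tr (cotractor_conn_mx G i y 0).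
have sf : smooth_on (crd U i) f.
  by apply: smooth_on_sum => k; exact: (cotractor_conn_smooth 0 k k HG).
have /cvgrPdist_lt /(_ 1 ltr01) N := smooth_on_within_cvg sf Ax.
have N' : \forall y \near x, crd U i y -> `|f x - f y| < 1 by exact: N.
have : nbhs (0 : R) (fun h => (@halfspace R n (x + h *: basisv R 0) ->
     crd U i (x + h *: basisv R 0)) /\ (crd U i (x + h *: basisv R 0) ->
     `|f x - f (x + h *: basisv R 0)| < 1)).
  exact: near_dir (filterI (oA x Ax) N').
move/nbhs_ballP => [d /= d0 Hd].
exists (d / 2), (`|f x| + 1); split; rewrite ?divr_gt0 ?addr_ge0 //.
move=> t /andP[t0 td].
have [|H1 H2] := Hd t.
  by rewrite /ball /= sub0r normrN ger0_norm // (le_lt_trans td) // ltr_pdivrMr // ltr_pMr // ltr1n.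
have At : crd U i (x + t *: basisv R 0) by apply: H1; apply: half_dir => //; exact: sA.
split=> //; rewrite -/(f _); have /ltW := H2 At; rewrite distrC => H3.
rewrite -(subrK (f x) (f (_ + _))) addrC.
by apply: (le_trans (ler_normD _ _)); rewrite lerD2l.
Qed.

(* Along the segment entering the interior in the direction of the first
   coordinate, det H solves a linear equation y' = -2 tr(A_0) y, so that it
   vanishes at the boundary point only if it vanishes at the interior end. *)
Lemma global_form_unit : nondegenerate_on [set: M] H.
Proof.
move=> i x Ax; rewrite unitmxE unitfE.
have [dx _ Ex] := crdP Ax.
have [HG Tp] := HT (chartV i x).
set U := (T (chartV i x)).1 in HG Tp; set G := (T (chartV i x)).2 in HG.
have Ux : crd U i x by rewrite -Ex; exists (chartV i x).
have oA := tame_ropen HG i.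
have [e [C [e0 C0 HC]]] := trace_line_bound HG Ux.
pose c (t : R) := x + t *: basisv R 0.
have c0 : c 0 = x by rewrite /c scale0r addr0.
have Ac t : 0 <= t <= e -> crd U i (c t) by move=> /HC [].
have hx : 0 <= x 0 0 by rewrite -Ex; exact: chart_half.
have cI t : 0 < t <= e -> crd (minterior M) i (c t).
  move=> /andP[t0 te]; have Act : crd U i (c t) by apply: Ac; rewrite ltW.
  have : crd (U `&` minterior M) i (c t).
    by apply: tame_interior => //; rewrite /c !mxE eqxx mulr1 ltr_wpDl.
  by apply: crd_sub => p [].
pose y t := \det (split_form tau G i (c t)).
have sQ k l : smooth_on (crd U i) (fun z => split_form tau G i z k l).
  apply: split_form_smooth => //; first exact: (tame_smooth HG).
  exact: (tau_smooth_on tau_def).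
pose dy t := - (2 * \tr (cotractor_conn_mx G i (c t) 0) * y t).
have Dy t : t \in `]0, e[ -> is_derive t (1 : R) y (dy t).
  move=> te; have : 0 < t < e by move: te; rewrite in_itv.
  move=> /andP[t0 te'].
  have Act : crd U i (c t) by apply: Ac; rewrite !ltW.
  have NA : \forall s \near t, crd U i (c s).
    have : \forall s \near t, s \in `]0, e[ by exact: near_in_itvoo.
    by apply: filterS => s; rewrite in_itv /= => /andP[s0 se]; apply: Ac; rewrite !ltW.
  pose Q := split_form tau G i (c t); pose A := cotractor_conn_mx G i (c t) 0.
  have D k l : is_derive t (1 : R) (fun s => split_form tau G i (c s) k l)
      ((- (A *m Q + Q *m A^T)) k l).
    have := derive_along_curve oA (sQ k l) Act NA (fun b => line_is_derive x 0 b t).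
    rewrite (eq_bigr (fun b => pder b (fun z => split_form tau G i z k l) (c t) * (b == 0)%:R));
      last by move=> b _; rewrite mulrC.
    rewrite sum_delta (tame_split_parallel _ _ _ HG Act); congr is_derive.
    have -> : Q *m A^T = (A *m Q)^T by rewrite trmx_mul split_form_sym.
    by rewrite [RHS]mxE [X in _ = - X]mxE [X in _ = - (_ + X)]mxE.
  have := is_derive_det D; congr is_derive.
  by rewrite mulNmx linearN /= trace_adj_sym.
have By t : t \in `]0, e[ -> `|dy t| <= (2 * C) * `|y t|.
  rewrite in_itv /= => /andP[t0 te]; rewrite /dy normrN !normrM ger0_norm //.
  apply: ler_wpM2r => //; apply: ler_wpM2l => //.
  have tt : 0 <= t <= e by rewrite (ltW t0) (ltW te).
  by have [] := HC t tt.
have cy : {within `[0, e], continuous y}.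
  apply/subspace_continuousP => t te.
  apply: (smooth_along_cvg (A := crd U i) (f := fun z => \det (split_form tau G i z))) => //.
  - exact: smooth_on_det.
  - exact: line_continuous.
have K0 : 0 <= 2 * C by rewrite mulr_ge0.
have ee : 0 < e <= e by rewrite e0 lexx.
have E0 : y 0 = \det (H i x) by rewrite /y c0 (det_split_form HG Ux).
have Ace : crd U i (c e) by apply: Ac; rewrite lexx ltW.
have Ee : y e = \det (H i (c e)) by rewrite /y (det_split_form HG Ace).
have B := derivable_nonzero_backwards e0 K0 cy Dy By.
rewrite E0 Ee in B; apply: B.
by apply: global_form_interior_unit; exact: cI.
Qed.

(** With [B] the connection matrix contracted with the velocity, [P] and [W] satisfy [P' = B^T P]
    and [W' = B^T W] while [Q' = - (B Q + Q B^T)], so the derivative of the pairing vanishes. *)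
Lemma parallel_pairing U G i c (P W : R -> 'cV[R]_(1 + n.+1)) : tame nabla U G ->
  C1_curve c -> (forall t : R, 0 <= t <= 1 -> crd U i (c t)) ->
  tractor_parallel_along G i c P -> tractor_parallel_along G i c W ->
  bform (split_form tau G i (c 0)) (P 0) (W 0) =
  bform (split_form tau G i (c 1)) (P 1) (W 1).
Proof.
move=> HG cC1 Ac HP HW.
have oA := tame_ropen HG i.
have sQ k l : smooth_on (crd U i) (fun z => split_form tau G i z k l).
  apply: split_form_smooth => //; first exact: (tame_smooth HG).
  exact: (tau_smooth_on tau_def).
have Dc t b : is_derive t (1 : R) (fun s => c s 0 b) (derive1 (fun s => c s 0 b) t).
  by rewrite derive1E; apply: derivableP; have [] := cC1 b.
have cc t : {for t, continuous c}.
  apply: (@cvg_rv _ _ _ (nbhs t) _) => b; have [Hd _] := Dc t b.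
  exact: (differentiable_continuous ((derivable1_diffP _ _).1 Hd)).
pose f t := bform (split_form tau G i (c t)) (P t) (W t).
have Df (t : R) : t \in `]0, 1[ -> is_derive t (1 : R) f 0.
  rewrite in_itv /= => t01; have [t0 t1] := andP t01.
  have Act : crd U i (c t) by apply: Ac; rewrite !ltW.
  have NA : \forall s \near t, crd U i (c s).
    have : \forall s \near t, s \in `]0, 1[ by apply: near_in_itvoo; rewrite in_itv.
    by apply: filterS => s; rewrite in_itv /= => /andP[s0 s1]; apply: Ac; rewrite !ltW.
  pose Q := split_form tau G i (c t).
  pose B := \sum_a derive1 (fun s => c s 0 a) t *: cotractor_conn_mx G i (c t) a.
  have BT X : \sum_a derive1 (fun s => c s 0 a) t *:
      ((cotractor_conn_mx G i (c t) a)^T *m X) = B^T *m X :> 'cV[R]_(1 + n.+1).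
    rewrite /B linear_sum mulmx_suml; apply: eq_bigr => a _.
    by rewrite linearZ /= -scalemxAl.
  have DP k : is_derive t (1 : R) (fun s => P s k 0) ((B^T *m P t) k 0).
    by have [_ /(_ t t01)] := HP k; rewrite BT.
  have DW k : is_derive t (1 : R) (fun s => W s k 0) ((B^T *m W t) k 0).
    by have [_ /(_ t t01)] := HW k; rewrite BT.
  have DQ k l : is_derive t (1 : R) (fun s => split_form tau G i (c s) k l)
      ((- (B *m Q + Q *m B^T)) k l).
    have := derive_along_curve oA (sQ k l) Act NA (Dc t); congr is_derive.
    have -> : Q *m B^T = (B *m Q)^T by rewrite trmx_mul split_form_sym.
    have BQ k' l' : (B *m Q) k' l' =
        \sum_a derive1 (fun s => c s 0 a) t * conn_mul tau G i (c t) a k' l'.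
      rewrite /B mulmx_suml summxE; apply: eq_bigr => a _.
      by rewrite -scalemxAl mxE.
    rewrite [RHS]mxE [X in _ = - X]mxE [X in _ = - (_ + X)]mxE !BQ -big_split -sumrN.
    apply: eq_bigr => a _; rewrite (tame_split_parallel _ _ _ HG Act).
    by rewrite mulrN mulrDr.
  have := is_derive_bform DP DQ DW; congr is_derive.
  rewrite trmx_mul trmxK !mulmxA mulmxN mulNmx mulmxDr mulmxDl !mulmxA.
  have E (X Y : 'M[R]_1) : (X - (X + Y) + Y) 0 0 = 0.
    by rewrite opprD addrA subrr add0r addNr mxE.
  exact: E.
have cf : {within `[0, 1], continuous f}.
  have -> : f = fun t => \sum_l (\sum_k P t k 0 * split_form tau G i (c t) k l) * W t l 0.
    by apply/funext => t; rewrite /f bformE.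
  apply/subspace_continuousP => t t01.
  apply: cvg_sumR => l _; apply: cvgM.
    apply: cvg_sumR => k _; apply: cvgM.
      by have [+ _] := HP k; move/subspace_continuousP => /(_ t t01).
    apply: (smooth_along_cvg (A := crd U i) (f := fun z => split_form tau G i z k l)) => //.
  by have [+ _] := HW l; move/subspace_continuousP => /(_ t t01).
have [s _] := MVT_segment (f := f) (df := fun=> 0) ler01 Df cf.
rewrite mul0r => /eqP; rewrite subr_eq0 => /eqP E; exact: esym E.
Qed.

Lemma transport_isometry i p j q A : tractor_transport nabla i p j q A ->
  A^T *m H j (chart j q) *m A = H i (chart i p).
Proof.
elim=> {i p j q A}.
- move=> i j p di dj; rewrite trmxK.
  by rewrite -(global_form_trans n_gt0 nabla_conn tau_def HT di dj).
- move=> i U G c A /tame_special HG cC1 Ac trans.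
  have A0 : crd U i (c 0) by apply: Ac; rewrite lexx ler01.
  have A1 : crd U i (c 1) by apply: Ac; rewrite ler01 lexx.
  have [_ _ ->] := crdP A0; have [_ _ ->] := crdP A1.
  (* The transport relation supplies parallel fields one vector at a time, so the matrix identity is
     tested on pairs of vectors. *)
  apply: bform_inj => v w.
  have [P [HP P0 P1]] := trans v; have [W [HW W0 W1]] := trans w.
  have := parallel_pairing HG cC1 Ac HP HW.
  rewrite (split_formE HG A0) (split_formE HG A1) !bform_congr P0 P1 W0 W1 => ->.
  by have := bform_congr (H i (c 1)) A^T v w; rewrite !trmxK.
- move=> i p j q k r A B _ IA _ IB.
  by rewrite trmx_mul -IA -IB !mulmxA.
Qed.

Lemma holonomy_orthogonal i p : dom i p ->
  tractor_holonomy nabla i p `<=` orthogonal_group (H i (chart i p)).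
Proof.
move=> di A /transport_isometry E; split=> //.
have U : H i (chart i p) \in unitmx by apply: global_form_unit; exists p.
(* [det A] is a factor of the invertible determinant of [A^T H A = H]. *)
move: (U); rewrite -{1}E !unitmxE !det_mulmx det_tr !unitrM => /andP[/andP[]].
by [].
Qed.
End normal.

(** * Signature, curved orbits and the boundary *)

Section quadratic_forms.
Context (R : realType).

Lemma bform_block k (t : R) (w : 'rV[R]_k) (r : 'M[R]_k) (v v' : 'cV[R]_(1 + k)) :
  bform (block_mx t%:M w w^T r) v v' =
  usubmx v 0 0 * t * usubmx v' 0 0
  + usubmx v 0 0 * (w *m dsubmx v') 0 0
  + (w *m dsubmx v) 0 0 * usubmx v' 0 0
  + bform r (dsubmx v) (dsubmx v').
Proof.
rewrite -{1}[v]vsubmxK -{1}[v']vsubmxK /bform.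
move: (usubmx v) (usubmx v') (dsubmx v) (dsubmx v') => s s' u u'.
rewrite tr_col_mx mul_row_block mul_row_col.
have E (X Y : 'M[R]_1) : (X *m Y) 0 0 = X 0 0 * Y 0 0 by rewrite mxE big_ord1.
have ED (X Y : 'M[R]_1) : (X + Y) 0 0 = X 0 0 + Y 0 0 by rewrite mxE.
have T (X : 'M[R]_1) : X^T = X by apply/matrixP => a b; rewrite !ord1 mxE.
have -> : u^T *m w^T = w *m u by rewrite -trmx_mul T.
have H1 : (s^T *m t%:M *m s') 0 0 = s 0 0 * t * s' 0 0.
  by rewrite T mul_mx_scalar -scalemxAl mxE E; ring.
have H3 : (s^T *m w *m u') 0 0 = s 0 0 * (w *m u') 0 0 by rewrite -mulmxA E T.
by rewrite !mulmxDl !ED H1 H3 (E (w *m u)) !addrA; ring.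
Qed.

Variable m : nat.
Implicit Types (Q : 'M[R]_m) (v w : 'cV[R]_m).

Lemma bformDl Q v v' w : bform Q (v + v') w = bform Q v w + bform Q v' w.
Proof. by rewrite /bform linearD /= !mulmxDl mxE. Qed.

Lemma bformDr Q v w w' : bform Q v (w + w') = bform Q v w + bform Q v w'.
Proof. by rewrite /bform mulmxDr mxE. Qed.

Lemma bformZl Q (k : R) v w : bform Q (k *: v) w = k * bform Q v w.
Proof. by rewrite /bform linearZ /= -!scalemxAl mxE. Qed.

Lemma bformZr Q (k : R) v w : bform Q v (k *: w) = k * bform Q v w.
Proof. by rewrite /bform -scalemxAr mxE. Qed.

Lemma bform_sym Q v w : Q^T = Q -> bform Q v w = bform Q w v.
Proof.
move=> sQ; rewrite /bform.
have T (X : 'M[R]_1) : X 0 0 = X^T 0 0 by rewrite mxE.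
by rewrite T !trmx_mul trmxK sQ mulmxA.
Qed.

Lemma bform_opp Q v w : bform (- Q) v w = - bform Q v w.
Proof. by rewrite /bform mulmxN mulNmx mxE. Qed.

Definition indefinite_form Q :=
  (exists v, 0 < bform Q v v) /\ (exists v, bform Q v v < 0).

Lemma indefinite_congr (Q S : 'M[R]_m) :
  indefinite_form (S *m Q *m S^T) -> indefinite_form Q.
Proof. by move=> [[v Hv] [w Hw]]; split;
  [exists (S^T *m v) | exists (S^T *m w)]; rewrite -bform_congr. Qed.

Lemma unit_form_pairing Q v : Q \in unitmx -> v != 0 -> exists w, bform Q v w != 0.
Proof.
move=> uQ v0; have : v^T *m Q != 0.
  apply: contra_neq v0 => E; apply: trmx_inj.
  by rewrite -[v^T](mulmxK uQ) E mul0mx trmx0.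
move=> /eqP N; apply/not_existsP => H; apply: N; apply/rowP => b.
have /negP/negbNE/eqP := H (delta_mx b 0).
by rewrite /bform -colE !mxE.
Qed.

(** Choose [w] not orthogonal to [v]. As [v] is isotropic, the value at [k *: v + w] is affine in
    [k] with nonzero slope and hence takes every real value. *)
Lemma isotropic_indefinite Q v : Q^T = Q -> Q \in unitmx -> v != 0 ->
  bform Q v v = 0 -> indefinite_form Q.
Proof.
move=> sQ uQ v0 vv; have [w vw] := unit_form_pairing uQ v0.
have E k : bform Q (k *: v + w) (k *: v + w) = 2 * k * bform Q v w + bform Q w w.
  rewrite !(bformDl, bformDr, bformZl, bformZr) vv (bform_sym w v sQ); ring.
have S r : exists x, bform Q x x = r.
  exists (((r - bform Q w w) / (2 * bform Q v w)) *: v + w).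
  by rewrite E; field.
split; first by have [x Hx] := S 1; exists x; rewrite Hx ltr01.
by have [x Hx] := S (- 1); exists x; rewrite Hx oppr_lt0 ltr01.
Qed.

Lemma semidefinite_definite Q v : Q^T = Q -> Q \in unitmx ->
  (forall w, 0 <= bform Q w w) -> v != 0 -> 0 < bform Q v v.
Proof.
move=> sQ uQ psd v0; rewrite lt_def psd andbT; apply/eqP => vv.
have [_ [w]] := isotropic_indefinite sQ uQ v0 vv.
by rewrite ltNge psd.
Qed.
End quadratic_forms.

(** * Definiteness is an open condition *)

Section definite_open.
Context (R : realType) (m : nat).

Lemma bform_continuous_row (Q : 'M[R]_m.+1) :
  continuous (fun u : 'rV[R]_m.+1 => bform Q u^T u^T).
Proof.
move=> u.
have E (v : 'rV[R]_m.+1) : bform Q v^T v^T = \sum_l (\sum_k v 0 k * Q k l) * v 0 l.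
  rewrite bformE; apply: eq_bigr => l _; rewrite mxE; congr (_ * _).
  by apply: eq_bigr => k _; rewrite mxE.
rewrite /continuous_at E; under eq_fun do rewrite E.
apply: (cvg_sumR (F := nbhs u) (f := fun l (v : 'rV[R]_m.+1) =>
  (\sum_k v 0 k * Q k l) * v 0 l)) => l _.
apply: cvgM; last exact: coord_continuous.
apply: (cvg_sumR (F := nbhs u) (f := fun k (v : 'rV[R]_m.+1) => v 0 k * Q k l)) => k _.
by apply: cvgM; [exact: coord_continuous | exact: cvg_cst].
Qed.

Lemma definite_lower_bound (Q : 'M[R]_m.+1) :
  (forall v, v != 0 -> 0 < bform Q v v) ->
  exists2 c : R, 0 < c & forall u : 'rV[R]_m.+1, `|u| = 1 -> c <= bform Q u^T u^T.
Proof.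
move=> pd; pose K := [set u : 'rV[R]_m.+1 | `|u| = 1].
have K0 : K !=set0.
  (* The norm is the sup norm, for which the vector with all entries 1 is a unit vector. *)
  exists (const_mx 1); rewrite /K /= /Num.Def.normr /= mx_normrE.
  apply/eqP; rewrite eq_le; apply/andP; split.
    by apply: bigmax_le => //= i _; rewrite mxE normr1.
  apply: le_trans (le_bigmax _ _ (0, 0)); by rewrite mxE normr1.
have cK : compact K.
  apply: bounded_closed_compact.
    by exists 1; split; [exact: num_real | move=> x x1 u /= ->; exact: ltW].
  have -> : K = (fun u : 'rV[R]_m.+1 => `|u|) @^-1` [set 1] by [].
  apply: preimage_closed; last exact: closed_eq.
  by move=> u _; exact: norm_continuous.
have [u Ku min] := EVT_min_rV K0 cK (continuous_subspaceT (@bform_continuous_row Q)).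
exists (bform Q u^T u^T).
  apply: pd; apply/eqP => /(congr1 trmx); rewrite trmxK trmx0 => u0.
  move: Ku; rewrite inE /K /= u0 normr0 => /esym/eqP.
  by rewrite oner_eq0.
by move=> v v1; apply: min; rewrite inE.
Qed.

(** On vectors of sup norm 1, two forms differ by at most the sum of the absolute differences of
    their entries. Once this is less than the lower bound for [Q0], positivity persists, and it
    extends to all vectors by scaling. *)
Lemma definite_near (T : Type) (F : set_system T) {FF : Filter F}
    (Q : T -> 'M[R]_m.+1) (Q0 : 'M[R]_m.+1) :
  (forall k l, Q t k l @[t --> F] --> Q0 k l) ->
  (forall v, v != 0 -> 0 < bform Q0 v v) ->
  \forall t \near F, forall v, v != 0 -> 0 < bform (Q t) v v.
Proof.
move=> cQ /definite_lower_bound [c c0 Hc].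
have C : (\sum_k \sum_l `|Q t k l - Q0 k l|) @[t --> F]
    --> \sum_k \sum_l `|Q0 k l - Q0 k l|.
  apply: (@cvg_sumR R 'I_m.+1 T F FF _ _ (fun k t => \sum_l `|Q t k l - Q0 k l|)
    (fun k => \sum_l `|Q0 k l - Q0 k l|)) => k _.
  apply: (@cvg_sumR R 'I_m.+1 T F FF _ _ (fun l t => `|Q t k l - Q0 k l|)
    (fun l => `|Q0 k l - Q0 k l|)) => l _.
  by apply: cvg_norm; apply: cvgB; [exact: cQ | exact: cvg_cst].
rewrite [X in _ --> X]big1 in C; last first.
  by move=> k _; rewrite big1 // => l _; rewrite subrr normr0.
have /cvgrPdist_lt /(_ c c0) := C.
apply: filterS => t; rewrite sub0r normrN ger0_norm; last first.
  by apply: sumr_ge0 => k _; apply: sumr_ge0.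
move=> Ht v v0.
pose u : 'rV[R]_m.+1 := `|v^T|^-1 *: v^T.
have nv : `|v^T| != 0 by rewrite normr_eq0; apply: contra_neq v0 => /(congr1 trmx); rewrite trmxK trmx0.
have u1 : `|u| = 1 by rewrite normrZ normfV normr_id mulVf.
have vu : v = `|v^T| *: u^T by rewrite /u linearZ /= trmxK scalerA divff // scale1r.
rewrite vu bformZl bformZr mulrA -expr2 mulr_gt0 //.
  by rewrite lt_def expf_neq0 // exprn_ge0.
apply: lt_le_trans (_ : 0 < c - \sum_k \sum_l `|Q t k l - Q0 k l|) _; first by rewrite subr_gt0.
have -> : bform (Q t) u^T u^T = bform Q0 u^T u^T + bform (Q t - Q0) u^T u^T.
  rewrite /bform mulmxBr mulmxBl [X in _ = _ + X]mxE [X in _ = _ + (_ + X)]mxE.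
  by rewrite addrC subrK.
apply: lerD; first exact: Hc.
rewrite lerNl -bform_opp; apply: le_trans (ler_norm _) _.
rewrite bformE exchange_big /=; apply: le_trans (ler_norm_sum _ _ _) _.
apply: ler_sum => l _; rewrite normrM.
have ub k : `|u^T k 0| <= 1 by rewrite mxE -u1; exact: coord_le_norm.
apply: le_trans (_ : `|\sum_k u^T k 0 * (- (Q t - Q0)) k l| * 1 <= _); first exact: ler_wpM2l.
rewrite mulr1; apply: le_trans (ler_norm_sum _ _ _) _; apply: ler_sum => k _.
rewrite normrM; apply: le_trans (_ : 1 * `|(- (Q t - Q0)) k l| <= _); first exact: ler_wpM2r.
by rewrite mul1r mxE normrN !mxE.
Qed.
End definite_open.

Section charts_continuity.
Context (R : realType) (n : nat) (M : bmanifold R n).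

Lemma smooth_chart_cvg (i : idx M) f p : smooth_on (crd [set: M] i) f -> dom i p ->
  f (chart i q) @[q --> p] --> f (chart i p).
Proof.
move=> sf di.
have Ax : crd [set: M] i (chart i p) by exists p.
have H := smooth_on_within_cvg sf Ax.
have := @chart_continuous _ _ M i; move/subspace_continuousP => /(_ _ di) C.
move=> P HP.
have N : \forall y \near chart i p, crd [set: M] i y -> P (f y) by exact: (H _ HP).
have N' : \forall q \near p, dom i q -> crd [set: M] i (chart i q) -> P (f (chart i q)).
  exact: (C _ N).
suff : \forall q \near p, P (f (chart i q)) by [].
apply: filterS2 N' (open_nbhs_nbhs (conj (dom_open i) di)) => q Hq dq.
by apply: Hq => //; exists q.
Qed.
End charts_continuity.

(** Increments in a direction other than the first stay on the boundary hyperplane, where [f]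
    vanishes. It is applied to [tau] and to the first coordinate of transition maps. *)
Lemma pder_tangential (R : realType) (n : nat) (A : set 'rV[R]_n.+1)
    (f : 'rV[R]_n.+1 -> R) x a : ropen A -> A x -> x 0 0 = 0 -> a != 0 ->
  (forall y, A y -> y 0 0 = 0 -> f y = 0) -> pder a f x = 0.
Proof.
move=> [sA oA] Ax x0 a0 f0.
have PF := within_dir_proper a (sA x Ax).
have L : (fun h : R => h^-1 * (f (x + h *: basisv R a) - f x)) @
    within [set h : R | halfspace (x + h *: basisv R a)] 0^' --> (0 : R).
  apply: (@cvg_trans _ ((fun=> (0 : R)) @
     within [set h : R | halfspace (x + h *: basisv R a)] 0^')); last exact: cvg_cst.
  apply/near_eq_cvg/near_within_dnbhs.
  have N : \forall y \near x, halfspace y -> A y by exact: oA.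
  apply: filterS (near_dir a N) => h Hh _ hh /=.
  rewrite (f0 _ Ax x0) f0 ?subrr ?mulr0 //; first exact: Hh.
  by rewrite !mxE x0 eqxx eq_sym (negbTE a0) mulr0 addr0.
exact: cvg_lim L.
Qed.

(** * Curved orbits and signature *)

Section geometry.
Context (R : realType) (n : nat) (M : bmanifold R n).
Notation V := 'rV[R]_n.+1.
Variables (nabla : conn M) (tau : density M).
Hypothesis n_gt0 : (0 < n)%N.
Hypothesis nabla_conn : is_connection (minterior M) nabla.
Hypothesis tau_def : corresponding_defining_density 2 nabla tau.
Implicit Types (i j : idx M) (x : V) (U : set M) (G : conn M).
Variable T : M -> set M * conn M.
Hypothesis HT : forall p, tame nabla (T p).1 (T p).2 /\ (T p).1 p.
Notation H := (global_form tau T).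

Definition half_grad i x : 'rV[R]_n.+1 := \row_a (2^-1 * pder a (tau i) x).

(** The [gam] terms cancel in the off-diagonal block, so it is half the differential of [tau]
    whichever connection was selected. *)
Lemma global_form_block i x :
  H i x = block_mx (tau i x)%:M (half_grad i x) (half_grad i x)^T (drsubmx (H i x)).
Proof.
rewrite /global_form /tractor_form block_mxKdr.
set v := _ - _ *: _; suff -> : v = half_grad i x by [].
apply/rowP => a; rewrite /v /half_grad [RHS]mxE.
rewrite mxE [X in _ + X]mxE [X in _ - X]mxE [X in X - _]mxE [X in _ * X - _]mxE.
by field.
Qed.

Lemma global_form_tline i x : bform (H i x) (tline R n) (tline R n) = tau i x.
Proof.
rewrite global_form_block bform_block /tline col_mxKu col_mxKd.
by rewrite /bform !mulmx0 !mxE eqxx mulr1n; ring.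
Qed.

Lemma tau_sign i j p : dom i p -> dom j p -> (0 < tau i (chart i p)) = (0 < tau j (chart j p)).
Proof.
move=> di dj; rewrite (tau_trans tau_def di dj) pmulr_rgt0 // exprn_gt0 //.
by apply: weight_fn_gt0; exists p.
Qed.

Lemma tau_sign_neg i j p : dom i p -> dom j p ->
  (tau i (chart i p) < 0) = (tau j (chart j p) < 0).
Proof.
move=> di dj; rewrite (tau_trans tau_def di dj) pmulr_rlt0 // exprn_gt0 //.
by apply: weight_fn_gt0; exists p.
Qed.

Lemma closed_orbitE : closed_orbit H = boundary M.
Proof.
apply/seteqP; split=> [p Hp|p bp i di].
  have [i di] := dom_cover p.
  by apply/(tau_eq0 tau_def di); rewrite -(global_form_tline i); exact: Hp.
by rewrite global_form_tline; apply/(tau_eq0 tau_def di).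
Qed.

Lemma positive_orbitP i p : dom i p -> positive_orbit H p <-> 0 < tau i (chart i p).
Proof.
move=> di; split=> [Hp|t0 j dj]; first by rewrite -global_form_tline; exact: Hp.
by rewrite global_form_tline (tau_sign dj di).
Qed.

Lemma negative_orbitP i p : dom i p -> negative_orbit H p <-> tau i (chart i p) < 0.
Proof.
move=> di; split=> [Hp|t0 j dj]; first by rewrite -global_form_tline; exact: Hp.
by rewrite global_form_tline (tau_sign_neg dj di).
Qed.

Lemma open_orbits : positive_orbit H `|` negative_orbit H = minterior M.
Proof.
apply/seteqP; split=> p; have [i di] := dom_cover p.
  move=> Hp /(tau_eq0 tau_def di) t0; case: Hp.
    by move/(positive_orbitP di); rewrite t0 ltxx.
  by move/(negative_orbitP di); rewrite t0 ltxx.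
move=> Ip; have : tau i (chart i p) != 0 by apply/eqP => /(tau_eq0 tau_def di).
rewrite neq_lt => /orP[t0|t0]; first by right; apply/(negative_orbitP di).
by left; apply/(positive_orbitP di).
Qed.

Lemma tau_chart_cvg i p : dom i p -> tau i (chart i q) @[q --> p] --> tau i (chart i p).
Proof. by move=> di; apply: smooth_chart_cvg di; exact: (tau_smooth tau_def). Qed.

Lemma positive_orbit_open : open (positive_orbit H).
Proof.
rewrite openE => p Hp; rewrite /interior /=; have [i di] := dom_cover p.
have t0 := (positive_orbitP di).1 Hp.
have N : \forall q \near p, 0 < tau i (chart i q).
  exact: (tau_chart_cvg di (lt_nbhsr t0)).
apply: filterS2 N (open_nbhs_nbhs (conj (dom_open i) di)) => q Hq dq.
exact/(positive_orbitP dq).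
Qed.

Lemma negative_orbit_open : open (negative_orbit H).
Proof.
rewrite openE => p Hp; rewrite /interior /=; have [i di] := dom_cover p.
have t0 := (negative_orbitP di).1 Hp.
have N : \forall q \near p, tau i (chart i q) < 0.
  exact: (tau_chart_cvg di (lt_nbhsl t0)).
apply: filterS2 N (open_nbhs_nbhs (conj (dom_open i) di)) => q Hq dq.
exact/(negative_orbitP dq).
Qed.

Lemma connected_interior_orbit : connected (minterior M) ->
  positive_orbit H = minterior M \/ negative_orbit H = minterior M.
Proof.
move=> conn; have [[p Hp]|N] := pselect (positive_orbit H !=set0); [left|right].
  apply: conn; first by exists p.
    exists (positive_orbit H); first exact: positive_orbit_open.
    by rewrite setIidr // -open_orbits; exact: subsetUl.
  (* Inside the interior, the positive orbit is the complement of the open negative one and hence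
     also relatively closed. *)
  exists (~` negative_orbit H); first exact: open_closedC negative_orbit_open.
  rewrite -open_orbits; apply/seteqP; split=> q; last by case=> -[].
  move=> Hq; split; first by left.
  have [i di] := dom_cover q => /(negative_orbitP di); apply/negP; rewrite -leNgt ltW //.
  exact/(positive_orbitP di).
rewrite -open_orbits; apply/seteqP; split=> q; first by right.
by case=> // Hq; exfalso; apply: N; exists q.
Qed.

Hypothesis H_unit : nondegenerate_on [set: M] H.

Lemma global_form_symE i x : (H i x)^T = H i x.
Proof. exact: tractor_form_sym. Qed.

Lemma global_form_cvg i p k l : dom i p ->
  H i (chart i q) k l @[q --> p] --> H i (chart i p) k l.
Proof.
move=> di; apply: (smooth_chart_cvg (f := fun x => H i x k l)) di.
exact: (global_form_smooth n_gt0 nabla_conn tau_def HT).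
Qed.

(** One chart suffices here, so openness can be checked in a single chart; [indefinite_pointsP]
    passes to all charts. *)
Definition indefinite_points : set M :=
  [set p | exists2 i, dom i p & indefinite_form (H i (chart i p))].

Lemma indefinite_pointsP p : indefinite_points p -> indefinite_at H p.
Proof.
move=> [i di Hi] j dj; apply: (indefinite_congr (S := cotractor_trans i j (chart i p))).
by rewrite -(global_form_trans n_gt0 nabla_conn tau_def HT di dj).
Qed.

Lemma bform_chart_cvg i p v : dom i p ->
  bform (H i (chart i q)) v v @[q --> p] --> bform (H i (chart i p)) v v.
Proof.
move=> di; rewrite bformE; under eq_fun do rewrite bformE.
apply: (cvg_sumR (F := nbhs p) (f := fun l q =>
  (\sum_k v k 0 * H i (chart i q) k l) * v l 0)) => l _.
apply: cvgM; last exact: cvg_cst.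
apply: (cvg_sumR (F := nbhs p) (f := fun k q => v k 0 * H i (chart i q) k l)) => k _.
by apply: cvgM; [exact: cvg_cst | exact: global_form_cvg].
Qed.

Lemma indefinite_points_open : open indefinite_points.
Proof.
rewrite openE => p [i di [[v Hv] [w Hw]]]; rewrite /interior /=.
have N1 : \forall q \near p, 0 < bform (H i (chart i q)) v v.
  have C := @bform_chart_cvg i p v di; exact: (C [set t | 0 < t] (lt_nbhsr Hv)).
have N2 : \forall q \near p, bform (H i (chart i q)) w w < 0.
  have C := @bform_chart_cvg i p w di; exact: (C [set t | t < 0] (lt_nbhsl Hw)).
apply: filterS3 N1 N2 (open_nbhs_nbhs (conj (dom_open i) di)) => q H1 H2 dq.
by exists i => //; split; [exists v | exists w].
Qed.

(** A nondegenerate form that is not indefinite is positive or negative definite, and either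
    property persists nearby by [definite_near]. *)
Lemma not_indefinite_points_open : open (~` indefinite_points).
Proof.
rewrite openE => p Np; rewrite /interior /=; have [i di] := dom_cover p.
have Ax : crd [set: M] i (chart i p) by exists p.
have uQ := H_unit Ax.
have v0 : delta_mx 0 0 != 0 :> 'cV[R]_(1 + n.+1).
  by apply/eqP => /matrixP /(_ 0 0); rewrite !mxE !eqxx => /eqP; rewrite oner_eq0.
have semi : (forall w, 0 <= bform (H i (chart i p)) w w) \/
    (forall w, 0 <= bform (- H i (chart i p)) w w).
  have [[w Hw]|N1] := pselect (exists w, bform (H i (chart i p)) w w < 0); [right|left].
    move=> u; rewrite bform_opp oppr_ge0 leNgt; apply/negP => Hu; apply: Np.
    by exists i => //; split; [exists u | exists w].
  by move=> w; rewrite leNgt; apply/negP => Hw; apply: N1; exists w.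
have [psd|nsd] := semi.
  have pd v : v != 0 -> 0 < bform (H i (chart i p)) v v.
    by apply: semidefinite_definite => //; exact: global_form_symE.
  have N : \forall q \near p, forall v, v != 0 -> 0 < bform (H i (chart i q)) v v.
    exact: (definite_near (F := nbhs p) (fun k l => @global_form_cvg i p k l di) pd).
  apply: filterS2 N (open_nbhs_nbhs (conj (dom_open i) di)) => q Hq dq.
  move=> /indefinite_pointsP /(_ i dq) [_ [v]].
  have [->|v00] := eqVneq v 0; first by rewrite /bform mulmx0 mxE ltxx.
  by rewrite ltNge ltW // Hq.
have pd v : v != 0 -> 0 < bform (- H i (chart i p)) v v.
  apply: semidefinite_definite => //; first by rewrite linearN /= global_form_symE.
  by rewrite unitmxE -scaleN1r detZ unitrM unitrX ?unitrN ?unitr1 // -unitmxE.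
have N := definite_near (F := nbhs p) (Q := fun q => - H i (chart i q)) _ pd.
have {}N : \forall q \near p, forall v, v != 0 -> 0 < bform (- H i (chart i q)) v v.
  apply: N => k l; rewrite mxE; under eq_fun do rewrite mxE.
  by apply: cvgN; exact: global_form_cvg.
apply: filterS2 N (open_nbhs_nbhs (conj (dom_open i) di)) => q Hq dq.
move=> /indefinite_pointsP /(_ i dq) [[v Hv] _]; move: Hv.
have [->|v00] := eqVneq v 0; first by rewrite /bform mulmx0 mxE ltxx.
by have := Hq v v00; rewrite bform_opp oppr_gt0 => /ltW; rewrite leNgt => /negP.
Qed.

Lemma tline_neq0 : tline R n != 0.
Proof.
apply/eqP => /(congr1 (fun v => usubmx v 0 0)); rewrite /tline col_mxKu !mxE eqxx.
by move/eqP; rewrite oner_eq0.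
Qed.

Lemma boundary_indefinite q : boundary M q -> indefinite_points q.
Proof.
move=> bq; have [i di] := dom_cover q; exists i => //.
have Ax : crd [set: M] i (chart i q) by exists q.
apply: (isotropic_indefinite (global_form_symE i _) (H_unit Ax) tline_neq0).
by rewrite global_form_tline; apply/(tau_eq0 tau_def di).
Qed.

Lemma component_indefinite p q : boundary M q -> connected_component [set: M] q p ->
  indefinite_at H p.
Proof.
move=> /boundary_indefinite Iq [C [Cq _ conn] Cp]; apply: indefinite_pointsP.
have E : C `&` indefinite_points = C.
  apply: conn; first by exists q.
    by exists indefinite_points => //; exact: indefinite_points_open.
  exists indefinite_points => //.
  by rewrite -[indefinite_points]setCK; exact: open_closedC not_indefinite_points_open.
by have [] : (C `&` indefinite_points) p by rewrite E.
Qed.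
End geometry.

(** * The conformal structure on the boundary *)

Section conformal_boundary.
Context (R : realType) (n : nat) (M : bmanifold R n).
Notation V := 'rV[R]_n.+1.
Variables (nabla : conn M) (tau : density M).
Hypothesis n_gt0 : (0 < n)%N.
Hypothesis nabla_conn : is_connection (minterior M) nabla.
Hypothesis tau_def : corresponding_defining_density 2 nabla tau.
Implicit Types (i j : idx M) (x : V).
Variable T : M -> set M * conn M.
Hypothesis HT : forall p, tame nabla (T p).1 (T p).2 /\ (T p).1 p.
Notation H := (global_form tau T).
Hypothesis H_unit : nondegenerate_on [set: M] H.

Lemma crd_boundaryT i x : crd (boundary M) i x -> crd [set: M] i x.
Proof. exact: crd_sub. Qed.

Lemma tau_boundary i x : crd (boundary M) i x -> tau i x = 0.
Proof. by move=> [p [di bp] <-]; apply/(tau_eq0 tau_def di). Qed.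

Lemma half_grad_boundary i x a : crd (boundary M) i x -> a != 0 ->
  half_grad tau i x 0 a = 0.
Proof.
move=> bx a0; rewrite mxE (pder_tangential (crd_ropen i (@openT M)) _ _ a0) ?mulr0 //.
- exact: crd_boundaryT.
- exact: crd_boundary bx.
by move=> y [p [di _] <-] y0; apply: tau_boundary; exists p => //; split=> //; exists i.
Qed.

Lemma half_grad_mul i x (u : 'cV[R]_n.+1) : crd (boundary M) i x ->
  (half_grad tau i x *m u) 0 0 = half_grad tau i x 0 0 * u 0 0.
Proof.
move=> bx; rewrite mxE (bigD1 0) //= big1 ?addr0 // => a a0.
by rewrite half_grad_boundary // mul0r.
Qed.

Lemma tline_pairing i x v : crd (boundary M) i x ->
  bform (H i x) (tline R n) v = half_grad tau i x 0 0 * dsubmx v 0 0.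
Proof.
move=> bx; rewrite global_form_block bform_block tau_boundary // /tline col_mxKu col_mxKd.
rewrite half_grad_mul // mulmx0 /bform trmx0 !mul0mx !mxE eqxx mulr1n; ring.
Qed.

(** Otherwise, by [tline_pairing], the line E(-1) would lie in the kernel of the nondegenerate
    form. *)
Lemma half_grad_neq0 i x : crd (boundary M) i x -> half_grad tau i x 0 0 != 0.
Proof.
move=> bx; have [v] := unit_form_pairing (H_unit (crd_boundaryT bx)) (tline_neq0 R n).
by rewrite tline_pairing // mulf_eq0 negb_or => /andP[].
Qed.

Lemma jac_boundary i j p a : dom i p -> dom j p -> boundary M p -> a != 0 ->
  jac i j (chart i p) a 0 = 0.
Proof.
move=> di dj bp a0; rewrite mxE.
apply: (pder_tangential (crd_ropen i (dom_open j)) _ _ a0); first by exists p.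
  exact: boundary_chart.
move=> y [q [dq djq] <-] y0; rewrite chartK //.
by apply: boundary_chart => //; exists i.
Qed.

Definition boundary_form i x : 'M[R]_n := row' 0 (col' 0 (drsubmx (H i x))).

Lemma bform_row' (r : 'M[R]_n.+1) (u v : 'cV[R]_n.+1) : u 0 0 = 0 -> v 0 0 = 0 ->
  bform r u v = bform (row' 0 (col' 0 r)) (row' 0 u) (row' 0 v).
Proof.
move=> u0 v0; rewrite !bformE big_ord_recl v0 mulr0 add0r.
apply: eq_bigr => l _; rewrite big_ord_recl u0 mul0r add0r mxE; congr (_ * _).
by apply: eq_bigr => k _; rewrite !mxE.
Qed.

(** On the boundary the upper left entry of the form vanishes and its off-diagonal block has only a
    transversal entry. Orthogonality to E(-1) thus kills the transversal component, and then only
    the lower right block contributes. *)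
Lemma boundary_form_induced : induces_on_boundary H boundary_form.
Proof.
move=> i x bx perp.
have perpP v : perp v <-> dsubmx v 0 0 = 0.
  rewrite /perp tline_pairing //; split=> [/eqP|->]; last by rewrite mulr0.
  by rewrite mulf_eq0 (negbTE (half_grad_neq0 bx)) => /eqP.
split=> //.
  by rewrite /perp global_form_tline tau_boundary.
move=> v w /perpP v0 /perpP w0.
rewrite global_form_block bform_block tau_boundary // !half_grad_mul // v0 w0.
by rewrite (bform_row' _ v0 w0) /boundary_form; ring.
Qed.

(* A vector u in the kernel of the boundary form lifts to (s, 0, u) in the kernel
   of H, where s compensates the pairing with the transversal coordinate. *)
Lemma boundary_form_unit : nondegenerate_on (boundary M) boundary_form.
Proof.
move=> i x bx; rewrite unitmxE unitfE; apply/det0P => -[u u0 uh].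
pose U : 'cV[R]_n.+1 := \col_a oapp (fun k => u 0 k) 0 (unlift 0 a).
have U0 : U 0 0 = 0 by rewrite mxE unlift_none.
have UL k : U (lift 0 k) 0 = u 0 k by rewrite mxE liftK.
pose r := drsubmx (H i x).
pose z := \sum_k U k 0 * r k 0.
pose w0 := half_grad tau i x 0 0.
have w00 : w0 != 0 by exact: half_grad_neq0.
pose v : 'cV[R]_(1 + n.+1) := col_mx (- (z / w0))%:M U.
have v0 : v != 0.
  apply: contra_neq u0 => v0; apply/rowP => k; rewrite mxE -UL.
  by rewrite -(col_mxKd (- (z / w0))%:M U) -/v v0 !mxE.
have [y] := unit_form_pairing (H_unit (crd_boundaryT bx)) v0.
rewrite global_form_block bform_block tau_boundary // !half_grad_mul //.
rewrite col_mxKu col_mxKd U0 -/r -/w0 [X in X * _ * _]mxE eqxx mulr1n.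
have -> : bform r U (dsubmx y) = z * dsubmx y 0 0.
  rewrite bformE big_ord_recl -/z big1 ?addr0 // => l _.
  have := congr1 (fun X : 'rV[R]_n => X 0 l) uh; rewrite !mxE => E.
  rewrite big_ord_recl U0 mul0r add0r (eq_bigr (fun k => u 0 k * boundary_form i x k l)).
    by rewrite E mul0r.
  by move=> k _; rewrite UL !mxE.
have -> : ((- (z / w0))%:M : 'M[R]_1) 0 0 = - (z / w0) by rewrite mxE eqxx mulr1n.
by move/eqP; apply; field.
Qed.

(** Tangential basis vectors stay orthogonal to E(-1) under a change of frame, by [jac_boundary], so
    the induced form computes their pairings in chart [j]. Each vector is scaled by the weight,
    hence the square. *)
Lemma boundary_form_trans i j p : dom i p -> dom j p -> boundary M p ->
  let J := row' 0 (col' 0 (jac i j (chart i p))) in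
  boundary_form i (chart i p) = weight_fn i j (chart i p) ^+ 2 *:
    (J *m boundary_form j (chart j p) *m J^T).
Proof.
move=> di dj bp J; set d := weight_fn i j (chart i p).
set g := cotractor_trans i j (chart i p).
have bx : crd (boundary M) j (chart j p) by exists p.
have [_ perpP ind] := boundary_form_induced bx.
pose E a : 'cV[R]_(1 + n.+1) := delta_mx (rshift 1 (lift 0 a)) 0.
have dE a : dsubmx (g^T *m E a) = d *: (row (lift 0 a) (jac i j (chart i p)))^T.
  apply/matrixP => b c; rewrite (ord1 c) {c} mxE /E -colE mxE mxE.
  by rewrite /g /cotractor_trans block_mxEdr mxE [RHS]mxE; congr (_ * _); rewrite !mxE.
have ZE (X : 'M[R]_n.+1) k b : (d *: (row k X)^T) b 0 = d * X k b by rewrite !mxE.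
have pE a : bform (H j (chart j p)) (tline R n) (g^T *m E a) = 0.
  by apply/perpP; rewrite dE ZE jac_boundary ?mulr0.
apply/matrixP => a b.
have -> : boundary_form i (chart i p) a b = bform (H i (chart i p)) (E a) (E b).
  by rewrite /E bform_delta /boundary_form; move: (H i (chart i p)) => Q; rewrite !mxE.
rewrite (global_form_trans n_gt0 nabla_conn tau_def HT di dj) bform_congr ind //.
have RE k : row' 0 (dsubmx (g^T *m E k)) = d *: (row k J)^T.
  rewrite dE /J; move: (jac i j (chart i p)) => X.
  by apply/matrixP => k' l'; rewrite !mxE.
rewrite !RE bformZl bformZr mulrA -expr2 [RHS]mxE; congr (_ * _).
rewrite /bform trmxK -row_mul mxE [RHS]mxE; apply: eq_bigr => k _.
by rewrite [row _ _ _ _]mxE [(row b J)^T _ _]mxE [row _ _ _ _]mxE [J^T _ _]mxE.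
Qed.

Lemma boundary_form_conformal : boundary_conformal_structure boundary_form.
Proof.
split.
- move=> i a b.
  apply: (eq_smooth_on (f := fun x => H i x (rshift 1 (lift 0 a)) (rshift 1 (lift 0 b)))).
    by move=> x _; rewrite /boundary_form; move: (H i x) => Q; rewrite !mxE.
  apply: (smooth_on_sub (@crd_boundaryT i)).
  exact: (global_form_smooth n_gt0 nabla_conn tau_def HT).
- move=> i x _; apply/matrixP => a b; have := global_form_symE tau T i x.
  rewrite /boundary_form; move: (H i x) => Q sQ.
  by rewrite !mxE -[in LHS]sQ mxE.
- exact: boundary_form_unit.
move=> i j p di dj bp J; exists (weight_fn i j (chart i p) ^+ 2).
  by rewrite exprn_gt0 // weight_fn_gt0 //; exists p.
exact: boundary_form_trans.
Qed.
End conformal_boundary.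

Theorem theorem3p4 (R : realType) (n : nat) (n_gt0 : (0 < n)%N)
    (M : bmanifold R n) (boundary_neq0 : boundary M !=set0)
    (nabla : conn M)
    (nabla_conn : is_connection (minterior M) nabla)
    (nabla_special : special (minterior M) nabla)
    (nabla_compact : proj_compact 2 nabla)
    (tau : density M)
    (tau_def : corresponding_defining_density 2 nabla tau) :
  (bgg_solution nabla tau <->
     forall i x a b c, crd (minterior M) i x ->
       sym3 (nab2 0 nabla (Ric nabla) i x) a b c = 0)
  /\
  (normal_solution nabla tau <->
     forall i x a b c, crd (minterior M) i x ->
       nab2 0 nabla (Ric nabla) i x a b c = 0)
  /\
  (normal_solution nabla tau ->
   nondegenerate_on (minterior M) (Ric nabla) ->
   [/\ is_metric (minterior M) (Ric nabla),
       levi_civita (minterior M) (Ric nabla) nabla,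
       einstein (minterior M) (Ric nabla)
     & exists H : S2cotractor M,
         [/\ is_L nabla tau H,
             nondegenerate_on [set: M] H /\ tractor_parallel nabla H,
             forall p q, boundary M q -> connected_component [set: M] q p ->
               indefinite_at H p,
             forall i p, dom i p ->
               tractor_holonomy nabla i p `<=`
                 orthogonal_group (H i (chart i p))
           & [/\ closed_orbit H = boundary M,
                 positive_orbit H `|` negative_orbit H = minterior M,
                 connected (minterior M) ->
                   positive_orbit H = minterior M \/
                   negative_orbit H = minterior M
               & exists2 h : idx M -> 'rV[R]_n.+1 -> 'M[R]_n,
                   boundary_conformal_structure h &
                   induces_on_boundary H h]]]).
Proof.
split; first exact: bgg_solutionP.
split; first exact: normal_solutionP.
move=> /(normal_solutionP n_gt0 nabla_conn tau_def nabla_special) Ric_parallel Ric_nondeg.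
have Ric_metric : is_metric (minterior M) (Ric nabla).
  have oA i := crd_ropen i (interior_open M).
  split=> //.
    split=> [i a b|i j p di dj Ip J].
      by apply: smooth_Ric => // c a' b'; exact: conn_smooth.
    exact: (Ric_tensor (interior_open M) nabla_conn di dj Ip).
  move=> i x Ax; apply/matrixP => a b; rewrite mxE.
  apply: (Ric_sym (oA i)) => //.
  - by move=> c a' b'; exact: conn_smooth.
  - by move=> y c a' b'; exact: conn_sym.
  - by move=> y a' b'; exact: (nabla_closed nabla_conn tau_def).
have LC : levi_civita (minterior M) (Ric nabla) nabla by split.
split=> //.
  (* The metric is the Ricci tensor of its own Levi-Civita connection, so the Einstein constant is
     1. *)
  by split=> //; exists nabla => //; exists 1 => i x _; rewrite scale1r.
have /choice [T HT] : forall p, exists UG : set M * conn M,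
    tame nabla UG.1 UG.2 /\ UG.1 p.
  (* Projective compactness provides a tame connection at boundary points; at interior points
     [nabla] serves. *)
  move=> p; have [bp|Ip] := pselect (boundary M p).
    by have [U [G' H]] := tame_boundary nabla_conn tau_def nabla_compact bp; exists (U, G').
  by exists (minterior M, nabla); split=> //; exact: (tame_nabla nabla_conn tau_def).
have Hunit := global_form_unit n_gt0 nabla_conn tau_def HT Ric_parallel Ric_nondeg.
exists (global_form tau T); split.
- exact: (global_form_is_L n_gt0 nabla_conn tau_def HT).
- by split=> //; exact: (global_form_parallel n_gt0 nabla_conn tau_def HT Ric_parallel).
- move=> p q; exact: (component_indefinite n_gt0 nabla_conn tau_def HT Hunit).
- move=> i p.
  exact: (holonomy_orthogonal n_gt0 nabla_conn tau_def HT Ric_parallel Ric_nondeg).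
split.
- exact: (closed_orbitE tau_def).
- exact: (open_orbits tau_def).
- exact: (connected_interior_orbit tau_def).
exists (boundary_form tau T).
  exact: (boundary_form_conformal n_gt0 nabla_conn tau_def HT Hunit).
exact: (boundary_form_induced tau_def Hunit).
Qed.
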